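(* Let $H:[0,T]\times\mathbb{R}^n\times\mathbb{R}^n\to\mathbb{R}$ satisfy (H1)–(H4) and (HLC), with $c(\cdot)$, each $k_R(\cdot)$ and $t\mapsto H(t,0,0)$ integrable on $[0,T]$. Let $(\mathbb{R}^{n+1},f,l)$ be the Steiner representation of $H$, $g:\mathbb{R}^n\to\mathbb{R}$ locally Lipschitz, and $$V(t_0,x_0)=\inf_{(x,a)(\cdot)\in S_f(t_0,x_0)}\Big\{g(x(T))+\int_{t_0}^T l(t,x(t),a(t))\,dt\Big\}.$$ Then for every $M>0$ there exist an absolutely continuous $\alpha_M:[0,T]\to\mathbb{R}$ and $C_M>0$ such that $$|V(t,x)-V(s,y)|\le|\alpha_M(t)-\alpha_M(s)|+C_M|x-y|\quad\text{for all } t,s\in[0,T],\ x,y\in\bar B_M.$$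
   Context: Hypotheses: (H1) $H(\cdot,x,p)$ Lebesgue measurable; (H2) $H(t,\cdot,\cdot)$ continuous; (H3) $H(t,x,\cdot)$ convex; (H4) there is measurable $c\ge0$ with $|H(t,x,p)-H(t,x,q)|\le c(t)(1+|x|)|p-q|$; (HLC) for each $R>0$ there is measurable $k_R\ge0$ with $|H(t,x,p)-H(t,y,p)|\le k_R(t)(1+|p|)|x-y|$ for $x,y\in\bar B_R$ (closed ball radius $R$ about $0$), all $p$. $H^*(t,x,v)=\sup_p\{\langle v,p\rangle-H(t,x,p)\}$. $S_f(t_0,x_0)$: pairs $x(\cdot)$ absolutely continuous on $[t_0,T]$, $a(\cdot)\in L^1([t_0,T],\mathbb{R}^{n+1})$, $\dot x=f(t,x,a)$ a.e., $x(t_0)=x_0$. Steiner representation: $E(t,x)=\mathrm{epi}\,H^*(t,x,\cdot)\subset\mathbb{R}^{n+1}$; $\Phi(t,x,a)=E(t,x)\cap\bar B(a,2d(a,E(t,x)))$; Steiner point $s_m(K)=m\int_{S^{m-1}}p\max_{y\in K}\langle p,y\rangle\,\mu(dp)$ ($\mu$ normalized rotation-invariant measure on the unit sphere); $(f,l)(t,x,a)=s_{n+1}(\Phi(t,x,a))$ with $f\in\mathbb{R}^n$, $l\in\mathbb{R}$. *)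

(* Defs.v *)
From HB Require Import structures.
From mathcomp Require Import all_boot all_order all_algebra.
From mathcomp Require Import all_classical all_reals all_analysis.
Set Implicit Arguments. Unset Strict Implicit. Unset Printing Implicit Defensive.
Import Order.TTheory GRing.Theory Num.Theory.
Import numFieldNormedType.Exports.
Local Open Scope classical_set_scope.
Local Open Scope ring_scope.

Section Defs.
Variable R : realType.

(** The real line equipped with the Lebesgue (completed) sigma-algebra. *)
Definition lebT : measurableType _ :=
  caratheodory_type (R:=R) (wlength (R:=R) idfun)^*%mu.
Definition leb : {measure set lebT -> \bar R} := @completed_lebesgue_measure R.

Definition dotv (m : nat) (u v : 'rV[R]_m) : R := \sum_(i < m) u 0 i * v 0 i.
Definition enorm (m : nat) (v : 'rV[R]_m) : R := Num.sqrt (dotv v v).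

Definition abs_cont (a b : R) (F : R -> R) : Prop :=
  forall eps : R, 0 < eps -> exists2 del : R, 0 < del &
    forall (k : nat) (u v : nat -> R),
      (forall i, (i < k)%N -> a <= u i /\ u i <= v i /\ v i <= b) ->
      (forall i j, (i < k)%N -> (j < k)%N -> i <> j -> v i <= u j \/ v j <= u i) ->
      \sum_(i < k) (v i - u i) < del ->
      \sum_(i < k) `|F (v i) - F (u i)| < eps.

Definition abs_cont_vec (n : nat) (a b : R) (x : R -> 'rV[R]_n) : Prop :=
  forall i : 'I_n, abs_cont a b (fun t => x t 0 i).

(** Conversions between tuples (carrying the product Borel sigma-algebra)
    and row vectors. *)
Definition row_of_tuple (m : nat) (p : m.-tuple R) : 'rV[R]_m := \row_i tnth p i.
Definition tuple_of_row (m : nat) (v : 'rV[R]_m) : m.-tuple R := [tuple v 0 i | i < m].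

Definition sphere (m : nat) : set (m.-tuple R) :=
  [set p | enorm (row_of_tuple p) = 1].

Definition unif_sphere_measure (m : nat)
    (mu : {measure set (m.-tuple R) -> \bar R}) : Prop :=
  [/\ mu (~` @sphere m) = 0%E, mu setT = 1%E &
      forall Q : 'M[R]_m, Q *m Q^T = 1%:M ->
        forall A : set (m.-tuple R), measurable A ->
          mu [set p | A (tuple_of_row (row_of_tuple p *m Q))] = mu A].

(** Support function max_{y in K} <p,y> (K compact: sup = max). *)
Definition supp_fun (m : nat) (K : set 'rV[R]_m) (p : 'rV[R]_m) : R :=
  sup [set dotv p y | y in K].

Definition steiner (m : nat) (mu : {measure set (m.-tuple R) -> \bar R})
    (K : set 'rV[R]_m) : 'rV[R]_m :=
  \row_i (m%:R * \int[mu]_(p in @sphere m)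
             ((row_of_tuple p) 0 i * supp_fun K (row_of_tuple p))).

Variable n : nat.
Variable H : R -> 'rV[R]_n -> 'rV[R]_n -> R.

Definition Hstar (t : R) (x v : 'rV[R]_n) : \bar R :=
  ereal_sup [set ((dotv v p) - H t x p)%:E | p in [set: 'rV[R]_n]].

Definition epiH (t : R) (x : 'rV[R]_n) : set 'rV[R]_(n + 1) :=
  [set z | (Hstar t x (lsubmx z) <= (rsubmx z 0 0)%:E)%E].

Definition dist_set (m : nat) (a : 'rV[R]_m) (E : set 'rV[R]_m) : R :=
  inf [set enorm (a - y) | y in E].

Definition PhiH (t : R) (x : 'rV[R]_n) (a : 'rV[R]_(n + 1)) : set 'rV[R]_(n + 1) :=
  epiH t x `&` [set y | enorm (y - a) <= 2 * dist_set a (epiH t x)].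

Variable mu : {measure set ((n + 1).-tuple R) -> \bar R}.

Definition steiner_fl (t : R) (x : 'rV[R]_n) (a : 'rV[R]_(n + 1)) : 'rV[R]_(n + 1) :=
  steiner mu (PhiH t x a).
Definition steiner_f (t : R) (x : 'rV[R]_n) (a : 'rV[R]_(n + 1)) : 'rV[R]_n :=
  lsubmx (steiner_fl t x a).
Definition steiner_l (t : R) (x : 'rV[R]_n) (a : 'rV[R]_(n + 1)) : R :=
  rsubmx (steiner_fl t x a) 0 0.

Variable T : R.

Definition S_f (t0 : R) (x0 : 'rV[R]_n) (x : R -> 'rV[R]_n) (a : R -> 'rV[R]_(n + 1)) : Prop :=
  [/\ abs_cont_vec t0 T x,
      (forall i : 'I_(n + 1), leb.-integrable (`[t0, T] : set lebT) (fun t => (a t 0 i)%:E)),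
      {ae leb, forall t : lebT, ((t : R) \in `]t0, T[%R) ->
                 is_derive t 1 x (steiner_f t (x t) (a t))}
    & x t0 = x0].

Definition value_fun (g : 'rV[R]_n -> R) (t0 : R) (x0 : 'rV[R]_n) : \bar R :=
  ereal_inf [set ((g (xa.1 T))%:E + \int[leb]_(t in (`[t0, T] : set lebT))
                                    (steiner_l t (xa.1 t) (xa.2 t))%:E)%E
            | xa in [set xa : (R -> 'rV[R]_n) * (R -> 'rV[R]_(n + 1)) | S_f t0 x0 xa.1 xa.2]].

End Defs.

(* Main.v *)
Require Import Defs.
From HB Require Import structures.
From mathcomp Require Import all_boot all_order all_algebra.
From mathcomp Require Import all_classical all_reals all_analysis.
From mathcomp Require Import measurable_realfun ring lra.
Import Order.TTheory GRing.Theory Num.Theory.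
Import numFieldNormedType.Exports.
Local Open Scope classical_set_scope.
Local Open Scope ring_scope.
Set Implicit Arguments.
Unset Strict Implicit.
Unset Printing Implicit Defensive.

(** By (H3)-(H4) the Steiner selection of Phi lies in the epigraph E(t,x) and
    reproduces every point of it.  Hence V is the value of the Bolza problem
    over pairs z = (x', w) with z(t) in E(t,x(t)): such a pair is its own
    control, and a control of finite cost yields such a pair when its running
    cost is lowered to H*(t,x,x'), which is measurable and, being bounded below
    by an integrable function, integrable.  Since E(t,.) is Lipschitz by
    (HLC), Filippov's iteration by nearest points turns an admissible pair from
    (t0,x0) into one from (s0,y0) at an additional cost of at most a multiple of
    |x0 - y0| + |Psi(t0) - Psi(s0)|.  Here Psi is a primitive of
    psi = |H(t,0,0)| + k r + c (1 + r), for which |H(t,x,p)| <= psi(t) |(p,-1)|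
    on the ball of radius r that contains all trajectories by Gronwall's
    inequality; before t0 the old pair is prolonged by z = 0, whose distance to
    E is at most psi. *)

(** * Euclidean geometry of row vectors *)

(** For rho >= 0 the distance from z to E(t,x) is at most rho exactly when <z,(p,-1)> - H(t,x,p) <=
    rho |(p,-1)| for all p. This family of inequalities carries the proof: read with (HLC) it
    compares E(t,x) with E(t,y); restricted to rational p it makes distances, and then nearest
    points, measurable in t; at z = 0 it gives the defect psi.

    (HLC) is local, while Filippov's iterates are not known to stay in one ball. So H is truncated
    in the state, and Gronwall's inequality shows afterwards that the limit never meets the
    truncation. There is no circle in the constants, because r depends on c and M alone.

    On the control side the running cost l(t,x(t),a(t)) comes without measurability; it is compared
    with its lowered version through the integral as a supremum over simple functions.

    Gronwall's inequality and Filippov's iteration share one contraction: in the weight exp(2C),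
    with C the primitive of c, integration against c has norm at most 1/2. *)

Section Euclid.
Variables (R : realType) (m : nat).
Implicit Types (u v w : 'rV[R]_m) (a : R).

Lemma dotvC u v : dotv u v = dotv v u.
Proof. by apply: eq_bigr => i _; rewrite mulrC. Qed.

Lemma dotvDl u v w : dotv (u + v) w = dotv u w + dotv v w.
Proof. by rewrite -big_split; apply: eq_bigr => i _; rewrite mxE mulrDl. Qed.

Lemma dotvZl a u v : dotv (a *: u) v = a * dotv u v.
Proof. by rewrite mulr_sumr; apply: eq_bigr => i _; rewrite mxE mulrA. Qed.

Lemma dotvNl u v : dotv (- u) v = - dotv u v.
Proof. by rewrite -scaleN1r dotvZl mulN1r. Qed.

Lemma dotvBl u v w : dotv (u - v) w = dotv u w - dotv v w.
Proof. by rewrite dotvDl dotvNl. Qed.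

Lemma dotvDr u v w : dotv u (v + w) = dotv u v + dotv u w.
Proof. by rewrite !(dotvC u) dotvDl. Qed.

Lemma dotvZr a u v : dotv u (a *: v) = a * dotv u v.
Proof. by rewrite !(dotvC u) dotvZl. Qed.

Lemma dotvBr u v w : dotv u (v - w) = dotv u v - dotv u w.
Proof. by rewrite !(dotvC u) dotvBl. Qed.

Lemma dotv0l v : dotv 0 v = 0.
Proof. by rewrite /dotv big1// => i _; rewrite mxE mul0r. Qed.

Lemma dotv0r v : dotv v 0 = 0.
Proof. by rewrite dotvC dotv0l. Qed.

Lemma dotvv_ge0 v : 0 <= dotv v v.
Proof. by apply: sumr_ge0 => i _; rewrite -expr2 sqr_ge0. Qed.

Lemma enorm_ge0 v : 0 <= enorm v.
Proof. exact: sqrtr_ge0. Qed.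

Lemma enorm_sqr v : enorm v ^+ 2 = dotv v v.
Proof. by rewrite sqr_sqrtr// dotvv_ge0. Qed.

Lemma enorm0 : enorm (0 : 'rV[R]_m) = 0.
Proof. by rewrite /enorm dotv0l sqrtr0. Qed.

Lemma normr_coord_le v i : `|v 0 i| <= enorm v.
Proof.
rewrite -[leLHS]sqrtr_sqr; apply: ler_wsqrtr; rewrite /dotv (bigD1 i)//= -expr2.
by rewrite lerDl; apply: sumr_ge0 => j _; rewrite -expr2 sqr_ge0.
Qed.

Lemma enorm_eq0 v : enorm v = 0 -> v = 0.
Proof.
move=> v0; apply/rowP => i; rewrite mxE; apply/eqP.
by rewrite -normr_le0 -v0 normr_coord_le.
Qed.

Lemma enormZ a v : enorm (a *: v) = `|a| * enorm v.
Proof.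
rewrite /enorm dotvZl dotvZr mulrA -expr2 sqrtrM ?sqr_ge0//.
by rewrite sqrtr_sqr.
Qed.

Lemma enormN v : enorm (- v) = enorm v.
Proof. by rewrite -scaleN1r enormZ normrN1 mul1r. Qed.

Lemma enormBC u v : enorm (u - v) = enorm (v - u).
Proof. by rewrite -enormN opprB. Qed.

Lemma dotv_CS u v : `|dotv u v| <= enorm u * enorm v.
Proof.
rewrite -ler_sqr ?nnegrE ?mulr_ge0 ?enorm_ge0//.
rewrite exprMn !enorm_sqr real_normK ?num_real//.
have [v0|vn0] := eqVneq (dotv v v) 0.
  have -> : v = 0 by apply/enorm_eq0; rewrite /enorm v0 sqrtr0.
  by rewrite !dotv0r expr0n mulr0.
have v_gt0 : 0 < dotv v v by rewrite lt_def vn0 dotvv_ge0.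
have := dotvv_ge0 (dotv v v *: u - dotv u v *: v).
rewrite !dotvBl !dotvBr !dotvZl !dotvZr (dotvC v u) => h.
rewrite -subr_ge0 -(pmulr_rge0 _ v_gt0); lra.
Qed.

Lemma dotv_le u v : dotv u v <= enorm u * enorm v.
Proof. exact: le_trans (ler_norm _) (dotv_CS u v). Qed.

Lemma enormD u v : enorm (u + v) <= enorm u + enorm v.
Proof.
rewrite -ler_sqr ?nnegrE ?addr_ge0 ?enorm_ge0//.
rewrite sqrrD !enorm_sqr dotvDl !dotvDr (dotvC v u).
have := dotv_le u v; lra.
Qed.

Lemma enormB u v : enorm (u - v) <= enorm u + enorm v.
Proof. by rewrite -(enormN v); exact: enormD. Qed.

Lemma enorm_dist_triangle u v w : enorm (u - w) <= enorm (u - v) + enorm (v - w).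
Proof. by rewrite -[u - w](subrKA v); exact: enormD. Qed.

Lemma enorm_lipschitz u v : `|enorm u - enorm v| <= enorm (u - v).
Proof.
have h1 := enormD (u - v) v; have h2 := enormD (v - u) u.
rewrite !subrK in h1 h2; rewrite enormBC in h2.
by rewrite ler_norml; apply/andP; split; lra.
Qed.

Lemma enorm_sum_le v : enorm v <= \sum_i `|v 0 i|.
Proof.
have s0 : 0 <= \sum_i `|v 0 i| by apply: sumr_ge0.
rewrite -ler_sqr ?nnegrE ?enorm_ge0// enorm_sqr expr2 mulr_suml.
apply: ler_sum => i _; rewrite -expr2 -real_normK ?num_real// expr2.
by apply: ler_wpM2l => //; rewrite (bigD1 i)//= lerDl; apply: sumr_ge0.
Qed.

Lemma enorm_le_mono u v : (forall i, `|u 0 i| <= `|v 0 i|) -> enorm u <= enorm v.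
Proof.
move=> uv; apply: ler_wsqrtr; apply: ler_sum => i _; rewrite -!expr2.
by rewrite -[leLHS]real_normK ?num_real// -[leRHS]real_normK ?num_real// lerXn2r ?nnegrE.
Qed.

End Euclid.

Section EuclidRow.
Variables (R : realType) (m1 m2 : nat).

Lemma dotv_row_mx (a c : 'rV[R]_m1) (b d : 'rV[R]_m2) :
  dotv (row_mx a b) (row_mx c d) = dotv a c + dotv b d.
Proof.
by rewrite /dotv big_split_ord; congr +%R; apply: eq_bigr => i _;
  rewrite ?row_mxEl ?row_mxEr.
Qed.

Lemma enorm_lsubmx (z : 'rV[R]_(m1 + m2)) : enorm (lsubmx z) <= enorm z.
Proof.
apply: ler_wsqrtr; rewrite -[in leRHS](hsubmxK z) dotv_row_mx lerDl.
exact: dotvv_ge0.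
Qed.

End EuclidRow.

Section RowTopology.
Variables (R : realType) (m : nat).
Implicit Types (u v x y : 'rV[R]_m).

Lemma coord_le_mxnorm x i : `|x 0 i| <= `|x|.
Proof. by rewrite /Num.Def.normr/= mx_normrE; exact: (le_bigmax _ _ (ord0, i)). Qed.

Lemma enorm_le_mxnorm x : enorm x <= m%:R * `|x|.
Proof.
apply: le_trans (enorm_sum_le x) _.
rewrite -[X in X%:R](card_ord m) mulr_natl -sumr_const.
by apply: ler_sum => i _; exact: coord_le_mxnorm.
Qed.

Lemma mxnorm_le_enorm x : `|x| <= enorm x.
Proof.
rewrite /Num.Def.normr/= mx_normrE bigmax_le ?enorm_ge0//= => -[i j] _.
by rewrite (ord1 i)/= normr_coord_le.
Qed.

Lemma enorm_lipschitz_continuous (f : 'rV[R]_m -> R) (L : R) :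
  (forall x y, `|f x - f y| <= L * enorm (x - y)) -> continuous f.
Proof.
move=> fL x; pose FF : Filter (nbhs x) := nbhs_filter x.
apply/(@cvgrPdist_le _ _ _ _ FF) => /= e e0.
have D0 : 0 < `|L| * m%:R + 1 by rewrite ltr_wpDl// mulr_ge0.
have := nbhsx_ballx x (e / (`|L| * m%:R + 1)) (divr_gt0 e0 D0).
apply: filterS => y; rewrite mx_norm_ball /ball_/= => xy.
apply: le_trans (fL x y) _.
apply: (@le_trans _ _ (`|L| * (m%:R * `|x - y|))).
  apply: le_trans (ler_wpM2r (enorm_ge0 _) (ler_norm L)) _.
  by apply: ler_wpM2l => //; exact: enorm_le_mxnorm.
rewrite mulrA; apply: (@le_trans _ _ ((`|L| * m%:R + 1) * `|x - y|)).
  by rewrite ler_wpM2r// lerDl.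
by rewrite mulrC -ler_pdivlMr// ltW.
Qed.

Lemma enorm_continuous : continuous (@enorm R m).
Proof.
by apply: (@enorm_lipschitz_continuous _ 1) => x y; rewrite mul1r enorm_lipschitz.
Qed.

Lemma dotv_continuous u : continuous (dotv u).
Proof.
apply: (@enorm_lipschitz_continuous _ (enorm u)) => x y.
by rewrite -dotvBr dotv_CS.
Qed.

(** Only the sublevel set of [x0] has to be bounded: its intersection with [C] is compact, and
    points of [C] outside it cannot beat [x0]. *)
Lemma closed_coercive_min (C : set 'rV[R]_m) (f : 'rV[R]_m -> R) x0 (B : R) :
  closed C -> C x0 -> continuous f ->
  (forall x, C x -> f x <= f x0 -> enorm x <= B) ->
  exists2 x, C x & forall y, C y -> f x <= f y.
Proof.
move=> cC Cx0 cf fB.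
pose A := C `&` [set x | f x <= f x0].
have cA : compact A.
  apply: bounded_closed_compact.
    exists B; split; first exact: num_real.
    move=> M BM x [Cx fx]; apply: le_trans (mxnorm_le_enorm x) _.
    exact: le_trans (fB x Cx fx) (ltW BM).
  apply: closedI => //; apply: (preimage_closed (f := f) (D := [set r | r <= f x0])).
    by move=> x _; exact: cf.
  exact: closed_le.
have A0 : A !=set0 by exists x0; split => //=.
have [|x /set_mem[Cx fx] xmin] := EVT_min_rV A0 cA (f := f).
  exact: continuous_subspaceT.
exists x => // y Cy; have [yx0|yx0] := leP (f y) (f x0).
  by apply: xmin; rewrite inE.
exact: le_trans fx (ltW yx0).
Qed.

End RowTopology.

(** * Nearest points of closed convex sets *)

Section Projection.
Variables (R : realType) (m : nat).
Implicit Types (E : set 'rV[R]_m) (z : 'rV[R]_m).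

Definition nearest E z : set 'rV[R]_m :=
  [set y | E y /\ forall y', E y' -> enorm (z - y) <= enorm (z - y')].

Definition nearest_point E z := get (nearest E z).

Lemma nearest_pointP E z : closed E -> E !=set0 -> nearest E z (nearest_point E z).
Proof.
move=> cE [y0 Ey0]; apply: getPex.
have cf : continuous (fun y : 'rV[R]_m => enorm (z - y)).
  apply: (@enorm_lipschitz_continuous _ _ _ 1) => x y; rewrite mul1r.
  apply: le_trans (enorm_lipschitz _ _) _.
  by rewrite opprD opprK addrACA subrr add0r addrC enormBC.
have [|x Ex xmin] := @closed_coercive_min _ _ E _ y0 (enorm z + enorm (z - y0)) cE Ey0 cf.
  move=> x Ex /= xy0; rewrite -[x](subKr z); apply: le_trans (enormB _ _) _.
  by rewrite lerD2l.
by exists x; split.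
Qed.

Lemma nearest_point_id E z : closed E -> E z -> nearest_point E z = z.
Proof.
move=> cE Ez; have [_ /(_ z Ez)] := nearest_pointP z cE (ex_intro _ z Ez).
rewrite subrr enorm0 => z0; apply/esym/eqP; rewrite -subr_eq0; apply/eqP.
by apply: enorm_eq0; apply/eqP; rewrite eq_le z0 enorm_ge0.
Qed.

Definition segment_closed E := forall x y (lam : R), E x -> E y -> 0 <= lam <= 1 ->
  E (lam *: x + (1 - lam) *: y).

(** First-order conditions are drawn from this: the error [t * c] disappears as [t] tends to 0. *)
Lemma le_of_slope (a b c : R) : (forall t, 0 < t <= 1 -> b - t * c <= a) -> b <= a.
Proof.
move=> h; rewrite leNgt; apply/negP => ab.
have d0 : 0 < b - a by rewrite subr_gt0.
have c0 : 0 < `|c| + (b - a) by rewrite ltr_wpDl.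
(* With this [t] the error is less than half the gap [b - a]. *)
have /h : 0 < (b - a) / (2 * (`|c| + (b - a))) <= 1.
  rewrite divr_gt0 ?mulr_gt0//= ler_pdivrMr ?mulr_gt0//.
  have := normr_ge0 c; lra.
set t := _ / _ => tc.
have te : t * (2 * (`|c| + (b - a))) = b - a by rewrite /t divfK// gt_eqF// mulr_gt0.
have t0 : 0 < t by rewrite divr_gt0// mulr_gt0.
have : t * c <= t * `|c| by rewrite ler_wpM2l ?ler_norm// ltW.
have : 0 < t * (b - a) by rewrite mulr_gt0.
have : 0 <= t * `|c| by rewrite mulr_ge0// ltW.
lra.
Qed.

(** Moving from the nearest point P towards [y] cannot decrease the distance to [z]; the change of
    its square, divided by [t], leaves the inner product in the limit. *)
Lemma nearest_point_variational E z y : closed E -> segment_closed E -> E y ->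
  dotv (z - nearest_point E z) (y - nearest_point E z) <= 0.
Proof.
move=> cE vE Ey; have [EP Pmin] := nearest_pointP z cE (ex_intro _ y Ey).
set P := nearest_point E z in EP Pmin *.
apply: (@le_of_slope _ _ (enorm (y - P) ^+ 2 / 2)) => t /andP[t0 t1].
have /Pmin : E (t *: y + (1 - t) *: P) by apply: vE => //; rewrite ltW.
have -> : z - (t *: y + (1 - t) *: P) = (z - P) - t *: (y - P).
  by apply/rowP => i; rewrite !mxE; ring.
rewrite -ler_sqr ?nnegrE ?enorm_ge0// !enorm_sqr => h.
have : t * (dotv (z - P) (y - P) - t * (dotv (y - P) (y - P) / 2)) <= 0.
  move: h; move: (z - P) (y - P) => a b.
  rewrite (dotvBl a) !dotvBr !dotvZl !dotvZr (dotvC b a); lra.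
by rewrite pmulr_rle0.
Qed.

Definition hsqdist E z : R := enorm (z - nearest_point E z) ^+ 2 / 2.

(** The nearest point of [z] competes at [z + e]. Together with [hsqdist_lower] this places the
    increment between its linear part and that part plus |e|^2/2. *)
Lemma hsqdist_upper E z e : closed E -> E !=set0 ->
  hsqdist E (z + e) <= hsqdist E z + dotv (z - nearest_point E z) e + enorm e ^+ 2 / 2.
Proof.
move=> cE E0; have [EP _] := nearest_pointP z cE E0; have [_ min'] := nearest_pointP (z + e) cE E0.
move: (min' _ EP); rewrite -ler_sqr ?nnegrE ?enorm_ge0// /hsqdist.
have -> : z + e - nearest_point E z = (z - nearest_point E z) + e by rewrite addrAC.
move: (z - nearest_point E z) => a; rewrite [in X in _ <= X -> _]enorm_sqr.
rewrite dotvDl !dotvDr (dotvC e a) -!enorm_sqr; lra.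
Qed.

(** With a = z - P and c = (z + e - P') - a, |a + c|^2 >= |a|^2 + 2 <a,c>, and <a,c> >= <a,e>
    because <a, P' - P> <= 0 by [nearest_point_variational]. *)
Lemma hsqdist_lower E z e : closed E -> segment_closed E -> E !=set0 ->
  hsqdist E z + dotv (z - nearest_point E z) e <= hsqdist E (z + e).
Proof.
move=> cE vE E0; have [EP _] := nearest_pointP z cE E0; have [EP' _] := nearest_pointP (z + e) cE E0.
have := nearest_point_variational z cE vE EP'; rewrite /hsqdist.
set P := nearest_point E z; set P' := nearest_point E (z + e).
have := dotvv_ge0 ((z + e - P') - (z - P)).
have -> : z + e - P' = (z - P) + (e - (P' - P)).
  by apply/rowP => i; rewrite !mxE; ring.
move: (z - P) (P' - P) => a b; rewrite [a + _]addrC addrK !enorm_sqr.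
have -> : dotv a e = dotv a (e - b) + dotv a b by rewrite -dotvDr subrK.
by move: (e - b) => c; rewrite dotvDl !dotvDr (dotvC c a); lra.
Qed.

End Projection.

(** * Distance to the epigraph of a conjugate *)

Section Epigraph.
Variables (R : realType) (n : nat).
Implicit Types (h : 'rV[R]_n -> R) (p q : 'rV[R]_n) (z : 'rV[R]_(n + 1)).

(* With [slope p] = (p, -1) the condition [dotv (slope p) (v, w) <= h p] reads
   [<p, v> - h p <= w], so that [epi_conj h] is the epigraph of the conjugate of [h]. *)
Definition slope p : 'rV[R]_(n + 1) := row_mx p (const_mx (- 1)).

Definition epi_conj h : set 'rV[R]_(n + 1) :=
  [set z | forall p, dotv (slope p) z <= h p].

Definition convex_fun h := forall p q (lam : R), 0 <= lam <= 1 ->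
  h (lam *: p + (1 - lam) *: q) <= lam * h p + (1 - lam) * h q.

Lemma dotv_slope p z : dotv (slope p) z = dotv p (lsubmx z) - rsubmx z 0 0.
Proof.
by rewrite -[z in LHS]hsubmxK dotv_row_mx [X in _ + X]big_ord1 mxE mulN1r.
Qed.

Lemma enorm_slope_sqr p : enorm (slope p) ^+ 2 = enorm p ^+ 2 + 1.
Proof.
by rewrite !enorm_sqr dotv_row_mx [X in _ + X]big_ord1 mxE mulrNN mulr1.
Qed.

Lemma enorm_slope_ge1 p : 1 <= enorm (slope p).
Proof.
rewrite -ler_sqr ?nnegrE ?enorm_ge0// enorm_slope_sqr expr1n lerDr.
exact: sqr_ge0.
Qed.

Lemma enorm_le_slope p : enorm p <= enorm (slope p).
Proof.
by rewrite -ler_sqr ?nnegrE ?enorm_ge0// enorm_slope_sqr lerDl.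
Qed.

Lemma slope_lipschitz p q : enorm (slope p - slope q) = enorm (p - q).
Proof.
rewrite /slope opp_row_mx add_row_mx subrr /enorm dotv_row_mx.
by rewrite dotv0l addr0.
Qed.

Lemma closed_epi_conj h : closed (epi_conj h).
Proof.
have -> : epi_conj h = \bigcap_(p in setT) [set z | dotv (slope p) z <= h p].
  by apply/seteqP; split => z /=; [move=> hz p _; exact: hz|move=> hz p; exact: hz].
apply: closed_bigI => p _.
apply: (preimage_closed (f := dotv (slope p)) (D := [set r | r <= h p])).
  by move=> x _; exact: dotv_continuous.
exact: closed_le.
Qed.

Lemma convex_epi_conj h : segment_closed (epi_conj h).
Proof.
move=> x y lam Ex Ey /andP[l0 l1] p; rewrite dotvDr !dotvZr.
have := Ex p; have := Ey p => hy hx.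
have : lam * dotv (slope p) x <= lam * h p by rewrite ler_wpM2l.
have : (1 - lam) * dotv (slope p) y <= (1 - lam) * h p.
  by rewrite ler_wpM2l// subr_ge0.
lra.
Qed.

(* A minimizer of [h p - <slope p, z> + rho * |slope p| + eps * |p|^2] is a
   point of differentiability of the penalty, so the minorant of [h] that
   touches there is affine; its coefficients are the approximate projection. *)
Lemma epi_conj_approx h (L rho : R) z (e : R) :
  convex_fun h -> (forall p q, `|h p - h q| <= L * enorm (p - q)) -> 0 <= rho ->
  (forall p, dotv (slope p) z - h p <= rho * enorm (slope p)) -> 0 < e ->
  exists2 z', epi_conj h z' & enorm (z - z') <= rho + e.
Proof.
move=> hconv hL rho0 hz e0.
set v := lsubmx z; set w := rsubmx z 0 0.
pose S p := enorm (slope p).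
have S0 p : 0 < S p by apply: lt_le_trans (enorm_slope_ge1 p).
have Ssq p : S p ^+ 2 = enorm p ^+ 2 + 1 by rewrite enorm_slope_sqr.
pose phi0 p := h p - (dotv p v - w) + rho * S p.
have phi0_ge0 p : 0 <= phi0 p.
  by have := hz p; rewrite dotv_slope -/v -/w -/(S p) /phi0; lra.
(* Chosen so that 2 eps |p| <= e at the minimizer: there eps |p|^2 <= phi0 0, hence (2 eps |p|)^2 <=
   4 eps phi0 0 <= e^2. *)
pose eps := e ^+ 2 / (4 * (phi0 0 + 1)).
have c0 : 0 < phi0 0 + 1 by rewrite ltr_wpDl.
have eps0 : 0 < eps by rewrite divr_gt0 ?exprn_gt0// mulr_gt0.
have eps4 : 4 * eps * (phi0 0 + 1) = e ^+ 2.
  by rewrite /eps mulrAC mulrC divfK// gt_eqF// mulr_gt0.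
clearbody eps; pose phi p := phi0 p + eps * enorm p ^+ 2.
have bnd p : phi p <= phi 0 -> eps * enorm p ^+ 2 <= phi0 0.
  have := phi0_ge0 p; rewrite /phi enorm0 expr0n/= mulr0 addr0; lra.
have phic : continuous phi.
  have h1 : continuous h by exact: enorm_lipschitz_continuous hL.
  have h2 : continuous (fun p => dotv p v).
    have -> : (fun p => dotv p v) = dotv v by apply/funext => p; rewrite dotvC.
    exact: dotv_continuous.
  have h3 : continuous S.
    apply: (@enorm_lipschitz_continuous _ _ _ 1) => p q.
    by rewrite mul1r -slope_lipschitz enorm_lipschitz.
  have h4 := @enorm_continuous R n.
  move=> p; have FF : Filter (nbhs p) := nbhs_filter p.
  apply: (@cvgD _ _ _ _ FF); last first.
    by apply: (@cvgM _ _ _ FF); [exact: cvg_cst|apply: (@cvgM _ _ _ FF); exact: h4].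
  apply: (@cvgD _ _ _ _ FF); last by apply: (@cvgM _ _ _ FF); [exact: cvg_cst|exact: h3].
  apply: (@cvgB _ _ _ _ FF); first exact: h1.
  by apply: (@cvgB _ _ _ _ FF); [exact: h2|exact: cvg_cst].
have [|p _ pmin] := @closed_coercive_min _ _ setT phi 0 (phi0 0 / eps + 1)
    closedT I phic.
  move=> p _ /bnd; rewrite mulrC -ler_pdivlMr// => hp.
  rewrite -ler_sqr ?nnegrE ?enorm_ge0//; last first.
    by rewrite addr_ge0// divr_ge0// ltW.
  apply: le_trans hp _; have : 0 <= phi0 0 / eps by rewrite divr_ge0// ltW.
  set a := phi0 0 / eps; rewrite sqrrD mulr1 expr1n => a0.
  by have := sqr_ge0 a; lra.
have {}bnd : eps * enorm p ^+ 2 <= phi0 0 by apply: bnd; exact: pmin.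
(* [r *: p] is the gradient of rho |slope| at [p], so stationarity of [phi] makes [g] a subgradient
   of [h] there. *)
pose r := rho / S p.
have rS : r * S p = rho by rewrite /r divfK// gt_eqF.
have r0 : 0 <= r by rewrite divr_ge0// ltW.
pose g := v - (r + 2 * eps) *: p.
have tangent q : h p + dotv (q - p) g <= h q.
  apply: (@le_of_slope _ _ _ ((r / 2 + eps) * enorm (q - p) ^+ 2)) => t /andP[t0 t1].
  have [d dE] : exists d, d = q - p by exists (q - p).
  rewrite -dE; have [pt ptE] : exists pt, pt = p + t *: d by exists (p + t *: d).
  have hpt : h pt <= t * h q + (1 - t) * h p.
    have -> : pt = t *: q + (1 - t) *: p.
      by rewrite ptE dE; apply/rowP => i; rewrite !mxE; ring.
    by apply: hconv; rewrite (ltW t0).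
  have := pmin pt I; rewrite /phi /phi0.
  have npt : enorm pt ^+ 2 = enorm p ^+ 2 + t * (2 * dotv p d + t * enorm d ^+ 2).
    by rewrite !enorm_sqr ptE dotvDl !dotvDr !dotvZl !dotvZr (dotvC d p); ring.
  have hS : rho * (S pt - S p) <= r / 2 * (t * (2 * dotv p d + t * enorm d ^+ 2)).
    have -> : t * (2 * dotv p d + t * enorm d ^+ 2) = S pt ^+ 2 - S p ^+ 2.
      by rewrite !Ssq npt; ring.
    rewrite -rS -subr_ge0.
    have -> : r / 2 * (S pt ^+ 2 - S p ^+ 2) - r * S p * (S pt - S p) =
              r / 2 * (S pt - S p) ^+ 2 by field.
    by rewrite mulr_ge0 ?sqr_ge0// divr_ge0.
  have -> : dotv pt v = dotv p v + t * dotv d v by rewrite ptE dotvDl dotvZl.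
  rewrite npt => hphi.
  rewrite -subr_ge0 -(pmulr_rge0 _ t0).
  rewrite /g dotvBr dotvZr (dotvC d p).
  lra.
(* The last coordinate w + r makes z - z' equal to r (p,-1) + 2 eps (p,0), whose first part has norm
   rho. *)
exists (row_mx g (const_mx (w + r))).
  move=> q; rewrite dotv_slope row_mxKl row_mxKr mxE.
  apply: le_trans (tangent q).
  rewrite dotvBl; have := phi0_ge0 p; rewrite /phi0 -rS.
  have -> : dotv p g = dotv p v - (r + 2 * eps) * enorm p ^+ 2.
    by rewrite /g dotvBr dotvZr enorm_sqr.
  have -> : r * S p * S p = r * enorm p ^+ 2 + r.
    by rewrite -mulrA -expr2 Ssq mulrDr mulr1.
  have : 0 <= eps * enorm p ^+ 2 by rewrite mulr_ge0 ?sqr_ge0// ltW.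
  lra.
have -> : z - row_mx g (const_mx (w + r)) =
    r *: slope p + (2 * eps) *: row_mx p 0.
  rewrite -[z in LHS]hsubmxK -/v /slope !scale_row_mx opp_row_mx !add_row_mx.
  have -> : rsubmx z = const_mx w by apply/rowP => i; rewrite (ord1 i) [RHS]mxE.
  congr row_mx; first by rewrite /g opprB addrC subrK scalerDl.
  by apply/rowP => i; rewrite !mxE; ring.
apply: le_trans (enormD _ _) _; apply: lerD.
  by rewrite enormZ ger0_norm// rS.
rewrite enormZ ger0_norm ?mulr_ge0 ?(ltW eps0)//.
have -> : enorm (row_mx p (0 : 'rV[R]_1)) = enorm p.
  by rewrite /enorm dotv_row_mx dotv0l addr0.
rewrite -ler_sqr ?nnegrE ?(ltW e0) ?mulr_ge0 ?enorm_ge0 ?(ltW eps0)//.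
rewrite -eps4 !exprMn.
have -> : 2 ^+ 2 * eps ^+ 2 * enorm p ^+ 2 = 4 * eps * (eps * enorm p ^+ 2) by ring.
rewrite ler_pM2l ?mulr_gt0//; lra.
Qed.

(** A Lipschitz function decreases at most linearly, so z = 0 meets the hypothesis of
    [epi_conj_approx] with rho = |h 0| + |L|. *)
Lemma epi_conj_neq0 h (L : R) : convex_fun h ->
  (forall p q, `|h p - h q| <= L * enorm (p - q)) -> epi_conj h !=set0.
Proof.
move=> hc hL; have [|p||z' Ez' _] := @epi_conj_approx h L (`|h 0| + `|L|) 0 1 hc hL.
- by rewrite addr_ge0.
- rewrite dotv0r sub0r.
  have := hL 0 p; rewrite sub0r enormN => /(le_trans (ler_norm _)) h1.
  have h2 : L * enorm p <= `|L| * enorm (slope p).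
    by rewrite (le_trans (ler_wpM2r (enorm_ge0 _) (ler_norm L)))// ler_wpM2l// enorm_le_slope.
  have h3 : `|h 0| <= `|h 0| * enorm (slope p) by rewrite ler_peMr// enorm_slope_ge1.
  have := ler_norm (- h 0); rewrite normrN; lra.
- exact: ltr01.
by exists z'.
Qed.

(** Half-spaces with normals (p,-1) determine the distance. One direction is Cauchy-Schwarz; in the
    other the error of [epi_conj_approx] disappears because it is arbitrary while the nearest point
    is fixed. *)
Lemma dist_epi_conj_le h (L rho : R) z : convex_fun h ->
  (forall p q, `|h p - h q| <= L * enorm (p - q)) -> 0 <= rho ->
  enorm (z - nearest_point (epi_conj h) z) <= rho <->
  (forall p, dotv (slope p) z - h p <= rho * enorm (slope p)).
Proof.
move=> hc hL rho0.
have [EP Pmin] := nearest_pointP z (@closed_epi_conj h) (epi_conj_neq0 hc hL).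
split=> [d p|hz].
  have := EP p; have := dotv_le (slope p) (z - nearest_point (epi_conj h) z).
  rewrite dotvBr; have : enorm (slope p) * enorm (z - nearest_point (epi_conj h) z)
    <= enorm (slope p) * rho by rewrite ler_wpM2l ?enorm_ge0.
  lra.
apply/ler_addgt0Pr => e e0.
have [z' Ez'] := epi_conj_approx hc hL rho0 hz e0.
exact: le_trans (Pmin _ Ez').
Qed.

End Epigraph.

(** * Lebesgue primitives and absolute continuity *)

Section Levels.
Context d (T : measurableType d) (R : realType).

Lemma measurable_fun_gt_level (D : set T) (f : T -> R) :
  (forall r, measurable (D `&` [set x | r < f x])) -> measurable_fun D f.
Proof.
move=> h mD; apply: (measurability _ (measurable_realfun.RGenOInfty.measurableE R)) => //.
move=> _ [_ [r ->] <-]; have := h r; congr (measurable (_ `&` _)).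
by apply/seteqP; split => x /=; rewrite in_itv/= andbT.
Qed.

End Levels.

(** * Lebesgue and Borel measurability *)

Section LebesgueBorel.
Variable R : realType.
Local Notation bor := (measurableTypeR R).

Lemma leb_measurable (A : set R) :
  measurable (A : set bor) -> measurable (A : set (lebT R)).
Proof. exact: sub_caratheodory. Qed.

Lemma leb_borelE (A : set R) : leb R A = lebesgue_measure A.
Proof. by []. Qed.

Lemma borel_leb_measurable_fun d (Y : measurableType d) (D : set R) (f : R -> Y) :
  measurable (D : set bor) -> measurable_fun (D : set bor) (f : bor -> Y) ->
  measurable_fun (D : set (lebT R)) (f : lebT R -> Y).
Proof. by move=> mD mf _ B mB; apply: leb_measurable; exact: mf. Qed.

Lemma leb_measurable_borelU (A : set R) : measurable (A : set (lebT R)) ->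
  exists X N : set R, [/\ measurable (X : set bor), measurable (N : set bor),
    lebesgue_measure N = 0%E, X `<=` A & A `<=` X `|` N].
Proof.
rewrite -completed_caratheodory_measurable g_sigma_completed_algebra_genE.
move=> [X mX [N [B [mB B0 NB]]] <-]; exists X, B; split => //.
by apply: setUS.
Qed.

Lemma leb_negligible_borel (A : set R) : (leb R).-negligible A ->
  exists N : set R, [/\ measurable (N : set bor), lebesgue_measure N = 0%E & A `<=` N].
Proof.
move=> [B [mB B0 AB]]; have [X [N [mX mN N0 XB BXN]]] := leb_measurable_borelU mB.
exists (X `|` N); split; [exact: measurableU| |exact: subset_trans AB BXN].
apply/eqP; rewrite eq_le measure_ge0 andbT.
apply: le_trans (measureU2 _ mX mN) _.
rewrite [X in (_ + X)%E]N0 adde0 -B0 -[leLHS]/(leb R X).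
by apply: le_measure => //; rewrite inE//; exact: leb_measurable.
Qed.

(** Prepares Lebesgue differentiation, which is applied to Borel functions. Each rational superlevel
    set is Borel up to part of a null Borel set; off the countable union of these null sets, every
    superlevel set is a union of rational ones. *)
Lemma borel_version (f : R -> R) :
  measurable_fun [set: lebT R] (f : lebT R -> R) ->
  exists N : set R, [/\ measurable (N : set bor), lebesgue_measure N = 0%E &
    measurable_fun [set: bor] ((fun x => if x \in N then 0 else f x) : bor -> R)].
Proof.
move=> mf.
have mA (q : rat) : measurable ([set x | ratr q < f x] : set (lebT R)).
  have -> : [set x | ratr q < f x] = setT `&` f @^-1` `]ratr q, +oo[%classic.
    by apply/seteqP; split => x /=; rewrite in_itv/= andbT => // -[].
  exact: mf.
have /choice[X hX] q := leb_measurable_borelU (mA q).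
have /choice[N hN] := hX.
pose NN := \bigcup_q N q.
have mNN : measurable (NN : set bor).
  by apply: bigcupT_measurable_rat => q; have [] := hN q.
exists NN; split => //.
  have : (@lebesgue_measure R).-negligible NN.
    have hN' : (@lebesgue_measure R).-negligible
        (\bigcup_i (if unpickle i is Some q then N q else set0)).
      apply: negligible_bigcup => i; case: unpickle => [q|]; last exact: negligible_set0.
      by exists (N q); have [] := hN q; split.
    apply: negligibleS hN' => x [q _ Nx].
    exists (pickle q); first exact: I.
    by case: (unpickle _) (pickleK q) => // _ [->].
  by move/negligibleP; exact.
(* On [NN] the modified function is 0, so [NN] belongs to the superlevel set exactly when r < 0. *)
apply: measurable_fun_gt_level => r; rewrite setTI.
rewrite [X in measurable X](_ : _ = (NN `&` [set _ | r < 0]) `|`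
    (\bigcup_(q in [set q : rat | r < ratr q]) (X q `\` NN))).
  apply: measurableU.
    by apply: measurableI => //; have [r0|r0] := ltP r 0;
      [rewrite (_ : [set _ | _] = setT)//; apply/seteqP
      |rewrite (_ : [set _ | _] = set0)//; apply/seteqP]; split.
  rewrite bigcup_mkcond; apply: bigcupT_measurable_rat => q.
  case: ifP => // _; apply: measurableD => //.
  by have [] := hN q.
apply/seteqP; split => x /=.
  case: ifPn => [/set_mem NNx r0|/negP Nx rf]; first by left.
  right; have [q] := rat_in_itvoo rf; rewrite in_itv/= => /andP[rq qf].
  exists q => //.
  have {}Nx : ~ NN x by move=> Nx'; apply: Nx; rewrite inE.
  split => //; have [_ _ _ _ /(_ x)] := hN q; case => //= Nqx.
  by case: Nx; exists q.
case=> [[NNx r0]|[q /= rq [Xx Nx]]]; first by rewrite mem_set.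
rewrite memNset//; apply: lt_trans rq _.
by have [_ _ _ + _] := hN q; exact.
Qed.

End LebesgueBorel.

Section Primitive.
Variable R : realType.
Local Notation bor := (measurableTypeR R).
Local Notation L := (lebT R).
Implicit Types (f g : R -> R) (s t a b : R).

(** Functions given on an interval are extended by 0 to the line, so that no interval of integration
    has to be carried along. *)
Definition L1 f := (leb R).-integrable [set: L] (fun t => (f t)%:E).

(** Starting at -oo, the primitive of a function that vanishes before [a] is 0 at [a]; the initial
    time enters through the support only. *)
Definition prim f t : R := \int[leb R]_(u in (`]-oo, t]%classic : set L)) f u.

Lemma leb_itv (i : interval R) : measurable ([set` i] : set L).
Proof. by apply: leb_measurable; exact: measurable_itv. Qed.

Lemma L1_measurable f : L1 f -> measurable_fun [set: L] (f : L -> R).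
Proof. by move=> /integrableP[/measurable_EFinP]. Qed.

Lemma L1_dom f g : measurable_fun [set: L] (f : L -> R) -> L1 g ->
  (forall t, `|f t| <= g t) -> L1 f.
Proof.
move=> mf Lg fg; apply: (le_integrable _ _ _ Lg) => //.
  exact/measurable_EFinP.
by move=> t _ /=; rewrite lee_fin; exact: le_trans (fg t) (ler_norm _).
Qed.

Lemma L1D f g : L1 f -> L1 g -> L1 (fun t => f t + g t).
Proof. by move=> Lf Lg; exact: (integrableD _ Lf Lg). Qed.

Lemma L1B f g : L1 f -> L1 g -> L1 (fun t => f t - g t).
Proof. by move=> Lf Lg; exact: (integrableB _ Lf Lg). Qed.

Lemma L1Z (a : R) f : L1 f -> L1 (fun t => a * f t).
Proof. by move=> Lf; exact: (integrableZl _ a Lf). Qed.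

Lemma L10 : L1 (fun=> 0).
Proof. exact: integrable0. Qed.

Lemma L1_abs f : L1 f -> L1 (fun t => `|f t|).
Proof. by move=> Lf; exact: (integrable_norm Lf). Qed.

Lemma L1_sum (I : finType) (F : I -> R -> R) :
  (forall i, L1 (F i)) -> L1 (fun t => \sum_i F i t).
Proof.
move=> LF; rewrite /L1 [X in _.-integrable _ X](_ : _ =
    (fun t => \sum_i (F i t)%:E)%E); last first.
  by apply/funext => t; rewrite sumEFin.
by apply: integrable_sum => // i _; exact: LF.
Qed.

Lemma L1_integrable f (A : set L) : measurable A -> L1 f ->
  (leb R).-integrable A (EFin \o f).
Proof. by move=> mA Lf; exact: integrableS Lf. Qed.

Lemma L1_patch f (A : set L) : measurable A ->
  (leb R).-integrable A (EFin \o f) -> L1 (f \_ A).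
Proof.
move=> mA iA; have := (integrable_mkcond _ mA).1 iA.
by rewrite restrict_EFin.
Qed.

Lemma L1_mask f (A : set L) : measurable A -> L1 f -> L1 (f \_ A).
Proof. by move=> mA Lf; apply: L1_patch => //; exact: L1_integrable. Qed.

Lemma primD f g t : L1 f -> L1 g -> prim (fun u => f u + g u) t = prim f t + prim g t.
Proof.
by move=> Lf Lg; apply: RintegralD; [exact: leb_itv|exact: L1_integrable (leb_itv _) _..].
Qed.

Lemma primB f g t : L1 f -> L1 g -> prim (fun u => f u - g u) t = prim f t - prim g t.
Proof.
by move=> Lf Lg; apply: RintegralB; [exact: leb_itv|exact: L1_integrable (leb_itv _) _..].
Qed.

Lemma primZ a f t : L1 f -> prim (fun u => a * f u) t = a * prim f t.
Proof.
by move=> Lf; apply: RintegralZl; [exact: leb_itv|exact: L1_integrable (leb_itv _) _].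
Qed.

Lemma prim0 t : prim (fun=> 0) t = 0.
Proof. by rewrite /prim /Rintegral integral0_eq. Qed.

Lemma prim_sum (I : finType) (F : I -> R -> R) t : (forall i, L1 (F i)) ->
  prim (fun u => \sum_i F i u) t = \sum_i prim (F i) t.
Proof.
move=> LF.
suff [_ ->] : L1 (fun u => \sum_(i <- index_enum I) F i u) /\
    prim (fun u => \sum_(i <- index_enum I) F i u) t =
    \sum_(i <- index_enum I) prim (F i) t by [].
elim: (index_enum I) => [|i s [Ls IH]].
  by rewrite !big_nil; under eq_fun do rewrite big_nil; split; [exact: L10|exact: prim0].
rewrite big_cons; under eq_fun do rewrite big_cons.
by split; [exact: L1D|rewrite primD// IH].
Qed.

Lemma eq_prim f g t : (forall u, f u = g u) -> prim f t = prim g t.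
Proof. by move=> /funext ->. Qed.

Lemma le_prim f g t : L1 f -> L1 g -> (forall u, f u <= g u) -> prim f t <= prim g t.
Proof.
move=> Lf Lg fg; apply: le_Rintegral => //; first exact: leb_itv.
  by apply: L1_integrable Lf; exact: leb_itv.
by apply: L1_integrable Lg; exact: leb_itv.
Qed.

Lemma eq_prim_ae f g t : L1 f -> L1 g -> {ae leb R, forall u : L, f u = g u} ->
  prim f t = prim g t.
Proof.
move=> Lf Lg fg; congr fine; apply: ae_eq_integral; first exact: leb_itv.
- apply/measurable_EFinP; apply: measurable_funS (L1_measurable Lf) => //.
- apply/measurable_EFinP; apply: measurable_funS (L1_measurable Lg) => //.
- by move: fg; apply: filterS => u /= -> _.
Qed.

Lemma prim_ge0 f t : (forall u, 0 <= f u) -> 0 <= prim f t.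
Proof. by move=> f0; apply: Rintegral_ge0. Qed.

Lemma prim_itv f s t : L1 f -> s <= t ->
  prim f t - prim f s = \int[leb R]_(u in (`]s, t]%classic : set L)) f u.
Proof.
move=> Lf st; rewrite /prim.
have -> : `]-oo, t]%classic = `]-oo, s]%classic `|` `]s, t]%classic.
  apply/seteqP; split => u /=; rewrite !in_itv/=.
    by move=> ->; case: (leP u s); [left|right].
  by case=> [us|/andP[]//]; exact: le_trans us st.
rewrite Rintegral_setU; [|exact: leb_itv|exact: leb_itv| |].
- by rewrite addrC addKr.
- by apply: L1_integrable Lf; apply: measurableU; exact: leb_itv.
- apply/disj_setPS => u [] /=; rewrite !in_itv/= => us /andP[su _].
  by move: (lt_le_trans su us); rewrite ltxx.
Qed.

Lemma prim_nondecreasing f s t : L1 f -> (forall u, 0 <= f u) -> s <= t ->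
  prim f s <= prim f t.
Proof.
move=> Lf f0 st; rewrite -subr_ge0 prim_itv//.
by apply: Rintegral_ge0.
Qed.

Lemma prim_incr_abs f s t : L1 f -> s <= t ->
  `|prim f t - prim f s| <= prim (fun u => `|f u|) t - prim (fun u => `|f u|) s.
Proof.
move=> Lf st; rewrite !prim_itv//; last exact: L1_abs.
apply: le_normr_Rintegral; first exact: leb_itv.
exact: L1_integrable (leb_itv _) Lf.
Qed.

Lemma leb_set1_ae t : {ae leb R, forall u : L, u <> t :> R}.
Proof.
exists [set t]; split; first exact: leb_measurable.
  by rewrite leb_borelE lebesgue_measure_set1.
by move=> u /= /contrapT.
Qed.

Lemma prim_eq0 f t : L1 f -> (forall u, u < t -> f u = 0) -> prim f t = 0.
Proof.
move=> Lf f0; rewrite -(prim0 t).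
have Lm : L1 (f \_ `]-oo, t[%classic) by apply: L1_mask => //; exact: leb_itv.
rewrite (@eq_prim_ae f ((f \_ `]t, +oo[%classic)))//.
- rewrite /prim; apply: eq_Rintegral => u; rewrite inE/= in_itv/= patchE => ut.
  by rewrite memNset//= in_itv/= andbT; apply/negP; rewrite -leNgt.
- by apply: L1_mask => //; exact: leb_itv.
- apply: filterS (leb_set1_ae t) => u /= ut; rewrite patchE.
  case: ifPn => //; rewrite notin_setE/= in_itv/= andbT => /negP; rewrite -leNgt => ut'.
  by apply: f0; rewrite lt_neqAle ut' andbT; apply/eqP.
Qed.

Lemma prim_mask_ge f s t : L1 f -> s <= t ->
  prim (f \_ `[s, +oo[%classic) t = prim f t - prim f s.
Proof.
move=> Lf st; have Lm : L1 (f \_ `[s, +oo[%classic) by apply: L1_mask => //; exact: leb_itv.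
rewrite -[LHS]subr0 -(@prim_eq0 (f \_ `[s, +oo[%classic) s)//; last first.
  move=> u us; rewrite patchE memNset//= in_itv/= andbT.
  by apply/negP; rewrite -ltNge.
rewrite !prim_itv//; apply: eq_Rintegral => u; rewrite inE/= in_itv/= => /andP[su _].
by rewrite patchE mem_set//= in_itv/= andbT ltW.
Qed.

Lemma abs_cont_prim f a b : L1 f -> abs_cont a b (prim f).
Proof.
move=> Lf e e0; have [d [d0 hd]] := integral_normr_continuous Lf e0.
exists d => // k u v uv dis sd.
(* Half-open pieces stay disjoint when two intervals share an endpoint. *)
pose I (i : 'I_k) : set L := `]u i, v i]%classic.
have mI i : measurable (I i) by exact: leb_itv.
have uvi (i : 'I_k) : u i <= v i by have [_ []] := uv i (ltn_ord i).
have tI : trivIset setT I.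
  apply/trivIsetP => i j _ _ /eqP ij.
  apply/seteqP; split => // x []; rewrite /I /= !in_itv/= => /andP[ux xv] /andP[ux' xv'].
  have ij' : i <> j :> nat by move=> /val_inj.
  case: (dis i j (ltn_ord i) (ltn_ord j) ij') => h.
    by move: (lt_le_trans ux' (le_trans xv h)); rewrite ltxx.
  by move: (lt_le_trans ux (le_trans xv' h)); rewrite ltxx.
pose A := \big[setU/set0]_(i < k) I i.
have mA : measurable A by apply: bigsetU_measurable => i _.
have muA : (leb R A < d%:E)%E.
  rewrite [X in (X < _)%E](@measure_bigsetU_ord _ _ _ (leb R))//.
  rewrite (eq_bigr (fun i : 'I_k => (v i - u i)%:E)) ?sumEFin ?lte_fin//.
  by move=> i _; rewrite [LHS]lebesgue_measure_itv/= lte_fin; case: ltgtP (uvi i) => // ->;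
    rewrite subrr.
apply: le_lt_trans (hd A mA muA).
have LA := L1_abs Lf.
rewrite /Rintegral (@integral_bigsetU_EFin _ _ _ (leb R) _ I (fun x => `|f x|))//; last 3 first.
- exact: index_enum_uniq.
- by apply: sub_trivIset tI.
- apply/measurable_EFinP; apply: measurable_funS (L1_measurable LA) => //.
rewrite -sum_fine//; last first.
  by move=> i _; apply: integrable_fin_num => //; exact: L1_integrable.
apply: ler_sum => i _; apply: le_trans (prim_incr_abs Lf (uvi i)) _.
by rewrite prim_itv.
Qed.

End Primitive.

Section PrimitiveDerivative.
Variable R : realType.
Local Notation bor := (measurableTypeR R).
Local Notation L := (lebT R).

(** The identity from [lebT R] to the Borel line is measurable and transports [leb R] to Lebesgue
    measure, so both claims come from the pushforward formula. *)
Lemma integral_leb_borel (f : R -> R) (D : set R) : measurable (D : set bor) ->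
  measurable_fun [set: bor] (f : bor -> R) -> (leb R).-integrable (D : set L) (EFin \o f) ->
  (@lebesgue_measure R).-integrable (D : set bor) (EFin \o f) /\
  \int[@lebesgue_measure R]_(x in (D : set bor)) f x = \int[leb R]_(x in (D : set L)) f x.
Proof.
move=> mD mf If.
have mid : measurable_fun [set: L] (fun x : L => (x : bor)).
  exact: (@borel_leb_measurable_fun _ _ bor setT (fun x : R => (x : bor))).
have mEf : measurable_fun [set: bor] (EFin \o f) by exact/measurable_EFinP.
split; last first.
  congr fine; rewrite -[RHS](integral_pushforward mid mEf If mD).
  by exact: eq_measure_integral.
have /integrableP[m1 m2] := integrable_pushforward mid mEf If mD.
apply/integrableP; split => //; apply: le_lt_trans m2.
Qed.

Lemma prim_is_derive (f : R -> R) : L1 f ->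
  {ae leb R, forall t : L, is_derive (t : R) 1 (prim f) (f t)}.
Proof.
move=> Lf; have [N [mN N0 mg]] := borel_version (L1_measurable Lf).
set g := (fun x => if x \in N then 0 else f x) in mg.
have Nneg : (leb R).-negligible (N : set L).
  by exists N; split => //; exact: leb_measurable.
have fg : {ae leb R, forall u : L, f u = g u}.
  apply: negligibleS Nneg => u /= fgu; apply: contrapT => Nu; apply: fgu.
  by rewrite /g memNset.
have Lg : L1 g.
  apply: (@L1_dom _ _ (fun u => `|f u|)).
  - exact: (@borel_leb_measurable_fun _ _ _ setT).
  - exact: L1_abs.
  - by move=> u; rewrite /g; case: ifP => //; rewrite normr0.
have pfg : prim f = (fun t => \int[@lebesgue_measure R]_(x in `]-oo, t]) g x).
  apply/funext => t; rewrite (eq_prim_ae t Lf Lg fg).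
  have [_ ->] := @integral_leb_borel g `]-oo, t]%classic (measurable_itv _) mg
    (L1_integrable (leb_itv _) Lg); by [].
have [Ig _] := @integral_leb_borel g setT measurableT mg Lg.
have := @FTC1Ny R g; case.
- move=> y; apply: integrableS Ig => //.
- by apply: open_integrable_locally => //; exact: openT.
move=> A [mA A0 HA].
have Aneg : (leb R).-negligible (A : set L).
  by exists A; split => //; exact: leb_measurable.
have := negligibleU Aneg Nneg; apply: negligibleS => t /= ht.
apply: contrapT => /not_orP[nA nN]; apply: ht.
have [d1 d2] := (contra_notP (HA t)) nA.
rewrite pfg; have -> : f t = g t by rewrite /g memNset.
by rewrite -d2 derive1E; exact/derivableP.
Qed.

End PrimitiveDerivative.

(** * Absolutely continuous functions *)

Section AbsCont.
Variable R : realType.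
Local Notation bor := (measurableTypeR R).
Local Notation L := (lebT R).
Implicit Types (F G : R -> R) (a b s t e : R).

Lemma abs_contW F a b a' b' : a <= a' -> b' <= b -> abs_cont a b F -> abs_cont a' b' F.
Proof.
move=> aa bb AF e e0; have [d d0 hd] := AF e e0; exists d => // k u v uv.
apply: hd => i ik; have [h1 [h2 h3]] := uv i ik.
by split; [exact: le_trans h1|split => //; exact: le_trans bb].
Qed.

Lemma abs_cont_comp F G a b (C : R) : abs_cont a b F ->
  (forall s t, a <= s <= b -> a <= t <= b -> `|G s - G t| <= C * `|F s - F t|) ->
  abs_cont a b G.
Proof.
move=> AF GF e e0.
have C0 : 0 < `|C| + 1 by rewrite ltr_wpDl.
have [d d0 hd] := AF (e / (`|C| + 1)) (divr_gt0 e0 C0).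
exists d => // k u v uv dis sd.
have := hd k u v uv dis sd; rewrite ltr_pdivlMr// mulrC; apply: le_lt_trans.
rewrite mulr_sumr; apply: ler_sum => i _.
have [h1 [h2 h3]] := uv i (ltn_ord i).
apply: le_trans (GF _ _ _ _) _.
- by rewrite h3 (le_trans h1 h2).
- by rewrite h1 (le_trans h2 h3).
- apply: ler_wpM2r => //; apply: le_trans (ler_norm _) _; by rewrite lerDl.
Qed.

Lemma abs_contB F G a b : abs_cont a b F -> abs_cont a b G ->
  abs_cont a b (fun t => F t - G t).
Proof.
move=> AF AG e e0; have e2 : 0 < e / 2 by rewrite divr_gt0.
have [d1 d10 h1] := AF _ e2; have [d2 d20 h2] := AG _ e2.
exists (Num.min d1 d2); first by rewrite lt_min d10.
move=> k u v uv dis; rewrite lt_min => /andP[s1 s2].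
have H1 := h1 k u v uv dis s1; have H2 := h2 k u v uv dis s2.
apply: le_lt_trans (_ : _ <= \sum_(i < k) (`|F (v i) - F (u i)| + `|G (v i) - G (u i)|)) _.
  apply: ler_sum => i _; 
  have -> : F (v i) - G (v i) - (F (u i) - G (u i)) =
    (F (v i) - F (u i)) - (G (v i) - G (u i)) by ring.
  exact: ler_normB.
rewrite big_split/=; lra.
Qed.

Lemma abs_cont_unif F a b : abs_cont a b F -> forall e, 0 < e ->
  exists2 d, 0 < d & forall s t, a <= s <= b -> a <= t <= b -> `|s - t| < d ->
    `|F s - F t| < e.
Proof.
move=> AF e e0; have [d d0 hd] := AF e e0; exists d => //.
have H s t : a <= s -> s <= t -> t <= b -> t - s < d -> `|F t - F s| < e.
  move=> as' st tb std.
  have := hd 1%N (fun=> s) (fun=> t); rewrite !big_ord1; apply => //.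
  by move=> [|i] [|j].
move=> s t /andP[s1 s2] /andP[t1 t2]; case: (leP s t) => st sd.
  rewrite distrC; apply: H => //.
  by apply: le_lt_trans sd; rewrite distrC ler_norm.
by apply: H => //; [exact: ltW|apply: le_lt_trans sd; rewrite ler_norm].
Qed.

Lemma is_derive1_near F t (v : R) : is_derive t 1 F v -> forall e, 0 < e ->
  exists2 r, 0 < r & forall s, `|s - t| < r -> `|F s - F t - v * (s - t)| <= e * `|s - t|.
Proof.
move=> [dF dFE] e e0.
have : (fun h => h^-1 *: ((F \o shift t) (h *: 1) - F t)) @ 0^' --> v.
  by rewrite -dFE; exact: dF.
move=> /cvgrPdist_le/(_ _ e0)/nbhs_ballP[r /= r0 hr]; exists r => // s sr.
have [->|st] := eqVneq s t; first by rewrite !subrr mulr0 subrr normr0 mulr0.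
have st0 : s - t != 0 by rewrite subr_eq0.
have sr' : ball 0 r (s - t) by rewrite /ball/= sub0r normrN.
have := hr _ sr' st0.
rewrite -[(s - t)%:A]/((s - t) * 1) mulr1 subrK => h.
rewrite -[X in X - _](mulVKf st0) [v * _]mulrC -mulrBr normrM mulrC ler_wpM2r//.
by rewrite distrC.
Qed.

(** The exceptional points are covered by an open set [U] of measure less than [d]. Off [U] the zero
    derivative gives slope at most [e]; inside [U] absolute continuity bounds the variation by [e].
    The supremum of [good] joins the two, in place of a covering theorem. *)
Lemma abs_cont_deriv0 F a b : a <= b -> abs_cont a b F ->
  {ae leb R, forall t : L, (t : R) \in `]a, b[ -> is_derive (t : R) 1 F 0} ->
  F b = F a.
Proof.
move=> ab AF aeF.
(* The summand 1 pays for the variation inside [U] and keeps the factor positive when a = b. *)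
suff H e : 0 < e -> `|F b - F a| <= e * (b - a + 1).
  apply/eqP; rewrite -subr_eq0 -normr_le0.
  have c0 : 0 < b - a + 1 by rewrite ltr_wpDl// subr_ge0.
  apply/ler_addgt0Pr => e e0; rewrite add0r.
  by rewrite -[e](divfK (lt0r_neq0 c0)); apply: H; exact: divr_gt0.
move=> e0; have [d d0 hd] := AF e e0.
have [N [mN N0 badN]] := leb_negligible_borel aeF.
(* The derivative is known on the open interval only, so both endpoints count as exceptional. *)
pose N' := N `|` [set a; b].
have mN' : measurable (N' : set bor).
  by apply: measurableU => //; apply: measurableU; exact: measurable_set1.
have N'0 : lebesgue_measure N' = 0%E.
  have ae : (@lebesgue_measure R).-negligible N'.
    apply: negligibleU; first by exists N; split.
    by apply: negligibleU; [exists [set a]|exists [set b]]; split => //;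
      exact: lebesgue_measure_set1.
  by move/negligibleP: ae; exact.
have [U [oU NU muU]] := lebesgue_regularity_outer mN' (le_lt_trans (eq_ind _ (fun x => (x <= 0)%E) (lexx _) _ (esym N'0)) (ltry 0)) d0.
have mU : measurable (U : set bor) by exact: open_measurable.
have {}muU : (leb R U < d%:E)%E.
  apply: le_lt_trans muU.
  have mD : measurable (U `\` N' : set bor) by exact: measurableD.
  rewrite -[leRHS]adde0 -N'0; apply: le_trans (measureU2 _ mD mN').
  rewrite -[leLHS]/(@lebesgue_measure R U).
  apply: le_measure; [exact: mem_set|apply: mem_set; exact: measurableU|].
  by move=> x Ux; have [N'x|N'x] := pselect (N' x); [right|left].
have mUI s : measurable (U `&` `]a, s]%classic : set L).
  by apply: leb_measurable; apply: measurableI => //; exact: measurable_itv.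
pose m s : \bar R := leb R (U `&` `]a, s]%classic).
have m_mono s t : s <= t -> (m s <= m t)%E.
  move=> st; apply: le_measure; [exact: mem_set|exact: mem_set|].
  move=> x [Ux] /=; rewrite !in_itv/= => /andP[ax xs]; split => //=.
  by rewrite ax (le_trans xs st).
have m_add s t : a <= s -> s <= t -> `]s, t]%classic `<=` U -> (m s + (t - s)%:E <= m t)%E.
  move=> as' st stU.
  have -> : (t - s)%:E = leb R `]s, t]%classic.
    rewrite [RHS]lebesgue_measure_itv/= lte_fin EFinB.
    by case: ltgtP st => // -> _; rewrite subee.
  rewrite -[X in (X <= _)%E]measureU//; last 2 first.
  - exact: leb_itv.
  - apply/seteqP; split => // x [[_ /=]]; rewrite !in_itv/= => /andP[_ xs] /andP[sx _].
    by move: (lt_le_trans sx xs); rewrite ltxx.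
  apply: le_measure; [apply: mem_set; apply: measurableU => //; exact: leb_itv|exact: mem_set|].
  move=> x [[Ux]|/=]; rewrite /= !in_itv/= => /andP[sx xs].
    by split => //=; rewrite sx (le_trans xs st).
  split; last by rewrite (le_lt_trans as' sx).
  by apply: stU; rewrite /= in_itv/= sx.
have m_lt s : (m s < d%:E)%E.
  apply: le_lt_trans muU; apply: le_measure; [exact: mem_set| |by move=> ? []].
  by apply: mem_set; exact: leb_measurable.
(* The variation is taken over finitely many non-overlapping intervals whose total length is charged
   to the part of [U] between [a] and [s]. *)
pose good : set R := fun s => a <= s <= b /\ exists (k : nat) (u v : nat -> R),
  [/\ forall i, (i < k)%N -> a <= u i /\ u i <= v i /\ v i <= s,
      forall i j, (i < k)%N -> (j < k)%N -> i <> j -> v i <= u j \/ v j <= u i,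
      ((\sum_(i < k) (v i - u i))%:E <= m s)%E &
      `|F s - F a| <= e * (s - a) + \sum_(i < k) `|F (v i) - F (u i)|].
suff [_ [k [u [v [uv dis uvm]]]]] : good b.
  have suv : \sum_(i < k) (v i - u i) < d.
    by rewrite -lte_fin; exact: le_lt_trans uvm (m_lt b).
  have := hd k u v uv dis suv; lra.
have good_a : good a.
  split; first by rewrite lexx.
  exists 0%N, (fun=> 0), (fun=> 0); split => //.
    by rewrite big_ord0 measure_ge0.
  by rewrite !subrr normr0 mulr0 big_ord0 addr0.
have local t : a <= t <= b -> exists2 r, 0 < r &
    (forall s, `|s - t| < r -> U s) \/
    (forall s, `|s - t| < r -> `|F s - F t| <= e * `|s - t|).
  move=> /andP[at' tb]; have [Ut|Ut] := pselect (U t).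
    have /nbhs_ballP[r /= r0 hr] := open_nbhs_nbhs (conj oU Ut).
    by exists r => //; left => s sr; apply: hr; rewrite /ball/= distrC.
  have N't : ~ N' t by move=> /NU.
  have dt : is_derive t 1 F 0.
    apply: contrapT => nd; apply: N't; have [ta|ta] := eqVneq t a; first by right; left.
    have [tb'|tb'] := eqVneq t b; first by right; right.
    left; apply: badN => /= h; apply: nd; apply: h; rewrite in_itv/=.
    by rewrite !lt_neqAle at' tb tb' eq_sym ta.
  have [r r0 hr] := is_derive1_near dt e0; exists r => //; right => s sr.
  by have := hr s sr; rewrite mul0r subr0.
have sup_good : has_sup good.
  by split; [exists a|exists b => s [/andP[]]].
pose z := sup good.
have az : a <= z by apply: ub_le_sup; [exact: proj2 sup_good|exact: good_a].
have zb : z <= b by apply: ge_sup; [exists a|move=> s [/andP[]]].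
have [r r0 hr] := local z (introT andP (conj az zb)).
have [s gs zs] := sup_adherent r0 sup_good.
have sz : s <= z by apply: ub_le_sup; [exact: proj2 sup_good|exact: gs].
(* [t] is within [r] of the supremum [z], and beyond it unless z = b; so a good [t] forces t = b. *)
pose t := Num.min b (z + r / 2).
have tb : t <= b by rewrite ge_min lexx.
have zt : z <= t by rewrite le_min zb lerDl divr_ge0// ltW.
have tz : t <= z + r / 2 by rewrite ge_min lexx orbT.
have r2 : r / 2 < r by rewrite ltr_pdivrMr// ltr_pMr// ltr1n.
have gt : good t.
  have [/andP[as' sb] [k [u [v [uv dis uvm Fs]]]]] := gs.
  split; first by rewrite tb (le_trans az zt).
  have zsr : z - r < s by [].
  case: hr => hr.
    (* Near a point of [U], the interval from [s] to [t] joins the family as number [k]. *)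
    exists k.+1, (fun i => if (i < k)%N then u i else s), (fun i => if (i < k)%N then v i else t).
    split.
    - move=> i; rewrite ltnS; case: ifP => [ik _|_ _].
        have [h1 [h2 h3]] := uv i ik; split => //; split => //.
        exact: le_trans h3 (le_trans sz zt).
      by split => //; split => //; exact: le_trans sz zt.
    - move=> i j; rewrite !ltnS; case: ifP => [ik _|ik ik'].
        case: ifP => [jk _|jk jk']; first exact: dis.
        by move=> _; left; have [_ [_]] := uv i ik.
      case: ifP => [jk _|jk jk' ij].
        by move=> _; right; have [_ [_]] := uv j jk.
      exfalso; apply: ij; transitivity k; apply/eqP; rewrite eqn_leq.
        by rewrite ik' leqNgt ik.
      by rewrite jk' leqNgt jk.
    - rewrite big_ord_recr/= ltnn EFinD.
      rewrite (eq_bigr (fun i : 'I_k => v i - u i)); last by move=> i _; rewrite ltn_ord.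
      apply: le_trans (m_add s t as' (le_trans sz zt) _); first by rewrite leeD2r.
      move=> x /=; rewrite in_itv/= => /andP[sx xt]; apply: hr.
      rewrite ltr_norml; apply/andP; split; lra.
    - rewrite big_ord_recr/= ltnn.
      rewrite (eq_bigr (fun i : 'I_k => `|F (v i) - F (u i)|)); last first.
        by move=> i _; rewrite ltn_ord.
      have := ler_distD (F s) (F t) (F a).
      have : e * (s - a) <= e * (t - a).
        by rewrite ler_pM2l// lerD2r (le_trans sz zt).
      lra.
  exists k, u, v; split => //.
  - move=> i ik; have [h1 [h2 h3]] := uv i ik; split => //; split => //.
    exact: le_trans h3 (le_trans sz zt).
  - exact: le_trans uvm (m_mono _ _ (le_trans sz zt)).
  - have h1 : `|F s - F z| <= e * (z - s).
      have -> : z - s = `|s - z| by rewrite distrC ger0_norm// subr_ge0.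
      by apply: hr; rewrite ltr_norml; apply/andP; split; lra.
    have h2 : `|F t - F z| <= e * (t - z).
      have -> : t - z = `|t - z| by rewrite ger0_norm// subr_ge0.
      by apply: hr; rewrite ltr_norml; apply/andP; split; lra.
    have := ler_distD (F s) (F t) (F a); have := ler_distD (F z) (F t) (F s).
    rewrite (distrC (F z)); lra.
have tz' : t <= z by apply: ub_le_sup; [exact: proj2 sup_good|exact: gt].
suff -> : b = t by [].
apply/eqP; rewrite eq_le tb andbT; move: tz'; rewrite /t ge_min => /orP[bz|].
  by rewrite le_min lexx (le_trans bz)// lerDl divr_ge0// ltW.
by rewrite gerDl leNgt divr_gt0.
Qed.

End AbsCont.

(** * Fundamental theorem of calculus and Gronwall's inequality *)

Section Gronwall.
Variable R : realType.
Local Notation bor := (measurableTypeR R).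
Local Notation L := (lebT R).
Implicit Types (f c F : R -> R) (a b s t : R).

Lemma abs_cont_FTC F f a b : a <= b -> L1 f -> abs_cont a b F ->
  {ae leb R, forall t : L, (t : R) \in `]a, b[ -> is_derive (t : R) 1 F (f t)} ->
  F b - F a = prim f b - prim f a.
Proof.
move=> ab Lf AF dF.
suff : F b - prim f b = F a - prim f a by lra.
apply: (@abs_cont_deriv0 _ (fun t => F t - prim f t)) => //.
  by apply: abs_contB => //; exact: abs_cont_prim.
apply: filterS2 dF (prim_is_derive Lf) => t dFt dft /dFt{}dFt.
by have := is_deriveB dFt dft; rewrite subrr.
Qed.

Lemma prim_continuous f : L1 f -> continuous (prim f).
Proof.
move=> Lf t; apply/cvgrPdist_lt => /= e e0.
have [d d0 hd] := abs_cont_unif (@abs_cont_prim _ f (t - 1) (t + 1) Lf) e0.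
have m0 : 0 < Num.min d 1 by rewrite lt_min d0 ltr01.
have := nbhsx_ballx t _ m0; apply: filterS => s; rewrite /ball/= lt_min => /andP[sd s1].
by apply: hd => //; move: s1; rewrite ltr_norml => /andP[? ?]; apply/andP; split; lra.
Qed.

Lemma continuous_leb_measurable (h : R -> R) : continuous h ->
  measurable_fun [set: L] (h : L -> R).
Proof.
move=> ch; apply: (@borel_leb_measurable_fun _ _ _ setT) => //.
exact: continuous_measurable_fun.
Qed.

Lemma prim_measurable f : L1 f -> measurable_fun [set: L] (prim f : L -> R).
Proof. by move=> Lf; apply: continuous_leb_measurable; exact: prim_continuous. Qed.

Lemma L1_mul_bounded c (u : R -> R) (B : R) : L1 c -> measurable_fun [set: L] (u : L -> R) ->
  (forall t, `|u t| <= B) -> L1 (fun t => c t * u t).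
Proof.
move=> Lc mu uB; apply: (@L1_dom _ _ (fun t => B * `|c t|)).
- by apply: measurable_funM => //; exact: L1_measurable.
- by apply: L1Z; exact: L1_abs.
- by move=> t; rewrite normrM mulrC ler_wpM2r.
Qed.

Definition Ltotal f : R := \int[leb R]_(u in [set: L]) f u.

Lemma Ltotal_ge0 f : (forall t, 0 <= f t) -> 0 <= Ltotal f.
Proof. by move=> f0; apply: Rintegral_ge0. Qed.

Lemma prim_le_Ltotal f t : L1 f -> (forall t, 0 <= f t) -> prim f t <= Ltotal f.
Proof.
move=> Lf f0; rewrite /prim /Ltotal Rintegral_mkcond.
have mt : measurable (`]-oo, t]%classic : set L) := leb_itv _.
apply: le_Rintegral => //; first exact: L1_mask.
move=> u _; rewrite patchE; by case: ifP.
Qed.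

(** Almost everywhere c exp(C), with C = [prim c], is the derivative of exp(C), which is absolutely
    continuous because C is, and bounded. *)
Lemma prim_expR_le c a t : L1 c -> (forall t, 0 <= c t) ->
  (forall t, t < a -> c t = 0) ->
  L1 (fun u => c u * expR (prim c u)) /\
  prim (fun u => c u * expR (prim c u)) t <= expR (prim c t).
Proof.
move=> Lc c0 ca; set E := fun u => expR (prim c u).
have mE : measurable_fun [set: L] (E : L -> R).
  by apply: measurableT_comp; [exact: measurable_expR|exact: prim_measurable].
have EB u : E u <= expR (Ltotal c) by rewrite ler_expR prim_le_Ltotal.
have LE : L1 (fun u => c u * E u).
  by apply: (L1_mul_bounded Lc mE) => u; rewrite ger0_norm ?expR_ge0//; exact: EB.
split => //; have [ta|at'] := ltP t a.
  by rewrite prim_eq0 ?expR_ge0// => u ut; rewrite ca ?mul0r// (lt_trans ut).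
have : E t - E a = prim (fun u => c u * E u) t - prim (fun u => c u * E u) a.
  apply: abs_cont_FTC => //.
    apply: (@abs_cont_comp _ (prim c) _ _ _ (expR (Ltotal c))).
      exact: abs_cont_prim.
    have H x y : x <= y -> `|E y - E x| <= expR (Ltotal c) * `|prim c y - prim c x|.
      move=> xy; have mxy := prim_nondecreasing Lc c0 xy.
      rewrite !ger0_norm ?subr_ge0 ?ler_expR//.
      apply: le_trans (ler_wpM2r _ (EB y)); last by rewrite subr_ge0.
      (* The tangent inequality exp(d) >= 1 + d bounds the increment of [E] by [E y] times that of
         [prim c]. *)
      have := expR_ge1Dx (prim c x - prim c y); rewrite expRD expRN -/(E x) -/(E y) => h.
      have Ey : 0 < E y := expR_gt0 _.
      have : E y * (1 + (prim c x - prim c y)) <= E y * (E x / E y).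
        by rewrite ler_pM2l.
      have -> : E y * (E x / E y) = E x by rewrite mulrC divfK// lt0r_neq0.
      by move: (E x) (E y) (prim c x) (prim c y) => e1 e2 p1 p2; lra.
    move=> x y _ _; case: (leP x y) => [xy|/ltW xy]; last exact: H.
    by rewrite distrC [X in _ * X]distrC; exact: H.
  apply: filterS (prim_is_derive Lc) => u du _.
  have := is_derive1_comp (is_derive_expR (prim c u)) du.
  by rewrite mulrC.
rewrite [prim (fun u => c u * E u) a]prim_eq0//.
  by rewrite subr0 => <-; rewrite gerBl expR_ge0.
by move=> u ua; rewrite ca ?mul0r.
Qed.

(** The factor 2 in the weight is what makes integration against [c] a contraction by 1/2 on the
    whole line at once, without subdividing it into short intervals. *)
Lemma prim_bielecki c a t : L1 c -> (forall t, 0 <= c t) ->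
  (forall t, t < a -> c t = 0) ->
  L1 (fun u => c u * expR (2 * prim c u)) /\
  prim (fun u => c u * expR (2 * prim c u)) t <= expR (2 * prim c t) / 2.
Proof.
move=> Lc c0 ca; have L2c : L1 (fun u => 2 * c u) by exact: L1Z.
have [||L2 H] := @prim_expR_le (fun u => 2 * c u) a t L2c.
- by move=> u; rewrite mulr_ge0.
- by move=> u ua; rewrite ca ?mulr0.
have E : (fun u => c u * expR (2 * prim c u)) =
    (fun u => 2^-1 * (2 * c u * expR (prim (fun u => 2 * c u) u))).
  by apply/funext => u; rewrite primZ// -mulrA mulKf.
rewrite E; split; first exact: L1Z.
by rewrite primZ// mulrC ler_pM2r// -(primZ _ _ Lc).
Qed.

(** The weighted supremum [S] of [u] is finite by the bound [B], and [prim_bielecki] yields S <= A +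
    S / 2. *)
Lemma gronwall c (u : R -> R) a (A B : R) : L1 c -> (forall t, 0 <= c t) ->
  (forall t, t < a -> c t = 0) -> measurable_fun [set: L] (u : L -> R) ->
  (forall t, 0 <= u t <= B) -> 0 <= A ->
  (forall t, u t <= A + prim (fun s => c s * u s) t) ->
  forall t, u t <= 2 * A * expR (2 * prim c t).
Proof.
move=> Lc c0 ca mu uB A0 hu.
pose S := sup (range (fun t => u t / expR (2 * prim c t))).
have E0 t : 0 < expR (2 * prim c t) := expR_gt0 _.
have E1 t : 1 <= expR (2 * prim c t) by rewrite -expR0 ler_expR mulr_ge0// prim_ge0.
have hs : has_sup (range (fun t => u t / expR (2 * prim c t))).
  split; first by exists (u 0 / expR (2 * prim c 0)), 0.
  exists B => _ [t _ <-]; have /andP[u0 ub] := uB t.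
  by rewrite ler_pdivrMr// (le_trans ub)// ler_peMr// (le_trans u0).
have uS t : u t <= S * expR (2 * prim c t).
  by rewrite -ler_pdivrMr//; apply: ub_le_sup; [exact: (proj2 hs)|exists t].
have S0 : 0 <= S.
  by have := le_trans (proj1 (andP (uB 0))) (uS 0); rewrite pmulr_lge0.
have Lcu : L1 (fun s => c s * u s).
  apply: (L1_mul_bounded Lc mu (B := B)) => t; have /andP[u0 ub] := uB t.
  by rewrite ger0_norm.
have hS : S <= A + S / 2.
  apply: ge_sup; first exact: (proj1 hs).
  move=> _ [t _ <-]; rewrite ler_pdivrMr//.
  have [Lb Hb] := prim_bielecki t Lc c0 ca.
  apply: le_trans (hu t) _; rewrite mulrDl; apply: lerD; first by rewrite ler_peMr.
  rewrite mulrAC -mulrA; apply: le_trans (ler_wpM2l S0 Hb).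
  rewrite -primZ//; apply: le_prim => //; first exact: L1Z.
  by move=> s; rewrite mulrCA ler_wpM2l.
move=> t; apply: le_trans (uS t) _; rewrite ler_pM2r//; lra.
Qed.

End Gronwall.

(** * Measurability *)

Section RationalVectors.
Variables (R : realType) (m : nat).

Definition ratv (q : 'rV[rat]_m) : 'rV[R]_m := map_mx ratr q.

Lemma ratv_dense (x : 'rV[R]_m) (e : R) : 0 < e -> exists q, enorm (x - ratv q) < e.
Proof.
move=> e0; have d0 : 0 < e / m.+1%:R by rewrite divr_gt0.
have /choice[q hq] (i : 'I_m) : exists q : rat, `|x 0 i - ratr q| < e / m.+1%:R.
  move: (e / _) d0 => w w0.
  have [|q] := @rat_in_itvoo _ (x 0 i - w) (x 0 i + w); first by lra.
  rewrite in_itv/= => /andP[q1 q2]; exists q.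
  by rewrite ltr_norml; apply/andP; split; lra.
exists (\row_i q i); apply: le_lt_trans (enorm_sum_le _) _.
apply: (@le_lt_trans _ _ (\sum_(i < m) e / m.+1%:R)).
  by apply: ler_sum => i _; rewrite !mxE ltW.
rewrite sumr_const card_ord -[X in X < _]mulr_natl mulrCA gtr_pMr//.
by rewrite ltr_pdivrMr// mul1r ltr_nat.
Qed.

Lemma lipschitz_le0_ratv (G : 'rV[R]_m -> R) (K : R) :
  (forall x y, `|G x - G y| <= K * enorm (x - y)) ->
  (forall q, G (ratv q) <= 0) -> forall x, G x <= 0.
Proof.
move=> GK Gq x; apply/ler_addgt0Pr => e e0; rewrite add0r.
have K0 : 0 < `|K| + 1 by rewrite ltr_wpDl.
have [q hq] := ratv_dense x (divr_gt0 e0 K0).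
have := Gq q; have := le_trans (ler_norm _) (GK x (ratv q)).
have : K * enorm (x - ratv q) <= (`|K| + 1) * enorm (x - ratv q).
  by rewrite ler_wpM2r ?enorm_ge0//; have := ler_norm K; lra.
have : (`|K| + 1) * enorm (x - ratv q) <= e.
  by rewrite mulrC -ler_pdivlMr// ltW.
lra.
Qed.

Lemma countable_ratv : countable [set: 'rV[rat]_m].
Proof. exact: countableP. Qed.

End RationalVectors.

Lemma cvg_dist_le (R : realType) (a b : nat -> R) (l : R) :
  (forall j, `|a j - l| <= b j) -> b @ \oo --> 0 -> a @ \oo --> l.
Proof.
move=> ab /cvgrPdist_le b0; apply/cvgrPdist_le => e /b0; apply: filterS => j.
by rewrite sub0r normrN distrC => h; apply: le_trans (ab j) (le_trans (ler_norm _) h).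
Qed.

Section MeasurableVectors.
Context d (X : measurableType d) (R : realType).
Implicit Types (D : set X).

Definition vmeas m D (x : X -> 'rV[R]_m) := forall i, measurable_fun D (fun t => x t 0 i).

Lemma measurable_dotv m D (x y : X -> 'rV[R]_m) : vmeas D x -> vmeas D y ->
  measurable_fun D (fun t => dotv (x t) (y t)).
Proof. by move=> mx my; apply: measurable_sum => i; exact: measurable_funM. Qed.

Lemma measurable_enorm m D (x : X -> 'rV[R]_m) : vmeas D x ->
  measurable_fun D (fun t => enorm (x t)).
Proof.
move=> mx; apply: measurableT_comp; last exact: measurable_dotv.
by apply: continuous_measurable_fun; exact: sqrt_continuous.
Qed.

Lemma vmeas_cst m D (v : 'rV[R]_m) : vmeas D (fun=> v).
Proof. by move=> i; exact: measurable_cst. Qed.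

Lemma vmeasD m D (x y : X -> 'rV[R]_m) : vmeas D x -> vmeas D y ->
  vmeas D (fun t => x t + y t).
Proof.
move=> mx my i; rewrite (_ : (fun t => _) = (fun t => x t 0 i + y t 0 i)); first exact: measurable_funD.
by apply/funext => t; rewrite mxE.
Qed.

Lemma vmeasB m D (x y : X -> 'rV[R]_m) : vmeas D x -> vmeas D y ->
  vmeas D (fun t => x t - y t).
Proof.
move=> mx my i; rewrite (_ : (fun t => _) = (fun t => x t 0 i - y t 0 i)); first exact: measurable_funB.
by apply/funext => t; rewrite !mxE.
Qed.

(* [F t (x t) > r] holds iff [F t q - l t * |x t - q| > r] for some rational
   [q], which only involves sections of [F] at constant points. *)
Lemma measurable_lipschitz_comp m D (F : X -> 'rV[R]_m -> R) (l : X -> R)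
    (x : X -> 'rV[R]_m) : measurable D ->
  (forall y, measurable_fun D (F ^~ y)) -> measurable_fun D l -> vmeas D x ->
  (forall t, D t -> forall y y', `|F t y - F t y'| <= l t * enorm (y - y')) ->
  measurable_fun D (fun t => F t (x t)).
Proof.
move=> mD mF ml mx Fl; apply: measurable_fun_gt_level => r.
pose G q t := F t (ratv R q) - l t * enorm (x t - ratv R q).
have -> : D `&` [set t | r < F t (x t)] = \bigcup_q (D `&` [set t | r < G q t]).
  apply/seteqP; split => t /=.
    move=> [Dt rF]; have l0 : 0 < `|l t| + 1 by rewrite ltr_wpDl.
    have d0 : 0 < (F t (x t) - r) / (2 * (`|l t| + 1)).
      by rewrite divr_gt0 ?subr_gt0// mulr_gt0.
    have [q hq] := ratv_dense (x t) d0; exists q => //; split => //=.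
    have := le_trans (ler_norm _) (Fl t Dt (x t) (ratv R q)); rewrite /G.
    have : l t * enorm (x t - ratv R q) <= (`|l t| + 1) * enorm (x t - ratv R q).
      by rewrite ler_wpM2r ?enorm_ge0//; have := ler_norm (l t); lra.
    move: hq; rewrite ltr_pdivlMr ?mulr_gt0//; lra.
  move=> [q _ [Dt /= rG]]; split => //; apply: lt_le_trans rG _; rewrite /G.
  have := le_trans (ler_norm _) (Fl t Dt (ratv R q) (x t)).
  by rewrite enormBC; lra.
apply: countable_bigcupT_measurable; first exact: countable_ratv.
move=> q; have mG : measurable_fun D (G q).
  apply: measurable_funB; first exact: mF.
  by apply: measurable_funM => //; apply: measurable_enorm; apply: vmeasB => //; exact: vmeas_cst.
rewrite (_ : [set t | r < G q t] = G q @^-1` `]r, +oo[%classic); first exact: mG.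
by apply/seteqP; split => t /=; rewrite in_itv/= andbT.
Qed.

End MeasurableVectors.

(** * Measurable dependence of nearest points *)

Section MeasurableProjection.
Context d (X : measurableType d) (R : realType) (n : nat).
Variables (D : set X) (h : X -> 'rV[R]_n -> R).
Hypothesis mD : measurable D.
Hypothesis mh : forall p, measurable_fun D (h ^~ p).
Hypothesis hconv : forall t, D t -> convex_fun (h t).
Hypothesis hlip : forall t, D t -> exists K, forall p q, `|h t p - h t q| <= K * enorm (p - q).

(** By [dist_epi_conj_le] the distance exceeds r >= 0 when one of the inequalities fails, and
    Lipschitz dependence on [p] lets that [p] be rational; what remains is a countable union. *)
Lemma measurable_dist_epi_conj (z : X -> 'rV[R]_(n + 1)) : vmeas D z ->
  measurable_fun D (fun t => enorm (z t - nearest_point (epi_conj (h t)) (z t))).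
Proof.
move=> mz; apply: measurable_fun_gt_level => r.
have [r0|r0] := ltP r 0.
  rewrite (_ : _ `&` _ = D)//; apply/seteqP; split => [t []//|t Dt]; split => //=.
  exact: lt_le_trans (enorm_ge0 _).
pose G q t := dotv (slope (ratv R q)) (z t) - h t (ratv R q) - r * enorm (slope (ratv R q)).
have -> : D `&` [set t | r < enorm (z t - nearest_point (epi_conj (h t)) (z t))] =
    \bigcup_q (D `&` [set t | 0 < G q t]).
  apply/seteqP; split => t /=.
    move=> [Dt]; rewrite ltNge => /negP hr; apply: contrapT => hG; apply: hr.
    have [K hK] := hlip Dt; apply/(dist_epi_conj_le _ (hconv Dt) hK r0) => p.
    pose g p := dotv (slope p) (z t) - h t p - r * enorm (slope p).
    suff : g p <= 0 by rewrite subr_le0.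
    apply: (@lipschitz_le0_ratv _ _ g (enorm (z t) + K + r)).
      move=> x y; rewrite -(slope_lipschitz x y).
      have -> : g x - g y = dotv (slope x - slope y) (z t) - (h t x - h t y)
          - r * (enorm (slope x) - enorm (slope y)) by rewrite /g dotvBl; ring.
      apply: le_trans (ler_normB _ _) _; rewrite mulrDl; apply: lerD; last first.
        by rewrite normrM ger0_norm// ler_wpM2l// enorm_lipschitz.
      apply: le_trans (ler_normB _ _) _; rewrite mulrDl; apply: lerD.
        by rewrite mulrC; exact: dotv_CS.
      by rewrite slope_lipschitz.
    move=> q; rewrite leNgt; apply/negP => gq; apply: hG; exists q => //.
  move=> [q _ [Dt /= gq]]; split => //; rewrite ltNge; apply/negP.
  have [K hK] := hlip Dt; move/(dist_epi_conj_le _ (hconv Dt) hK r0)/(_ (ratv R q)).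
  by move: gq; rewrite /G; lra.
apply: countable_bigcupT_measurable; first exact: countable_ratv.
move=> q; have mG : measurable_fun D (G q).
  apply: measurable_funB; last exact: measurable_cst.
  by apply: measurable_funB => //; apply: measurable_dotv => //; exact: vmeas_cst.
rewrite (_ : [set t | 0 < G q t] = G q @^-1` `]0, +oo[%classic); first exact: mG.
by apply/seteqP; split => t /=; rewrite in_itv/= andbT.
Qed.

(* The residual [z - nearest_point z] is the gradient of half the squared distance. *)
Lemma measurable_nearest_point (z : X -> 'rV[R]_(n + 1)) : vmeas D z ->
  vmeas D (fun t => nearest_point (epi_conj (h t)) (z t)).
Proof.
move=> mz i; pose N t := z t - nearest_point (epi_conj (h t)) (z t).
suff mN : measurable_fun D (fun t => N t 0 i).
  rewrite (_ : (fun t => _) = (fun t => z t 0 i - N t 0 i)); first exact: measurable_funB.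
  by apply/funext => t; rewrite !mxE; ring.
(* Steps 1/(j+1) along the i-th axis: by [hsqdist_lower] and [hsqdist_upper] the difference quotient
   exceeds the i-th coordinate of the residual by at most half the step. *)
pose e j : 'rV[R]_(n + 1) := j.+1%:R^-1 *: delta_mx 0 i.
pose S t := hsqdist (epi_conj (h t)).
have mS v : measurable_fun D (fun t => S t (z t + v)).
  rewrite /S /hsqdist; apply: measurable_funM => //.
  apply: measurable_funX; apply: measurable_dist_epi_conj.
  by apply: vmeasD => //; exact: vmeas_cst.
have dotd v : dotv v (delta_mx 0 i) = v 0 i.
  rewrite /dotv (bigD1 i)//= mxE !eqxx mulr1 big1 ?addr0// => j ji.
  by rewrite mxE eqxx (negbTE ji) mulr0.
apply: (@measurable_fun_cvg _ _ _ _ (fun j t => j.+1%:R * (S t (z t + e j) - S t (z t + 0)))).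
  by move=> j; apply: measurable_funM => //; apply: measurable_funB; exact: mS.
move=> t Dt; apply: (@cvg_dist_le _ _ (fun j => j.+1%:R^-1)); last exact: cvg_harmonic.
move=> j; have [K hK] := hlip Dt.
have cE := @closed_epi_conj _ _ (h t); have vE := @convex_epi_conj _ _ (h t).
have E0 := epi_conj_neq0 (hconv Dt) hK.
have lo := hsqdist_lower (z t) (e j) cE vE E0; have up := hsqdist_upper (z t) (e j) cE E0.
have de : dotv (N t) (e j) = j.+1%:R^-1 * N t 0 i by rewrite /e dotvZr dotd.
have ee : enorm (e j) ^+ 2 = j.+1%:R^-1 * j.+1%:R^-1.
  by rewrite enorm_sqr /e dotvZl dotvZr dotd mxE !eqxx mulr1.
rewrite addr0; move: lo up; rewrite -/(S t) -/(N t) de ee.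
set s := j.+1%:R^-1; have s0 : 0 < s by rewrite invr_gt0.
have -> : j.+1%:R = s^-1 :> R by rewrite invrK.
move: (S t (z t + e j)) (S t (z t)) (N t 0 i) => A B C h1 h2.
have -> : s^-1 * (A - B) - C = s^-1 * (A - B - s * C) by field; rewrite gt_eqF.
rewrite ger0_norm; last by rewrite mulr_ge0 ?invr_ge0 ?(ltW s0)//; lra.
rewrite mulrC ler_pdivrMr//; have : 0 <= s * s by rewrite mulr_ge0// ltW.
lra.
Qed.

End MeasurableProjection.

(** * Filippov's theorem *)

Section VectorPrimitive.
Variable R : realType.
Local Notation L := (lebT R).

Definition L1v m (x : R -> 'rV[R]_m) := forall i, L1 (fun t => x t 0 i).

Definition primv m (x : R -> 'rV[R]_m) (t : R) : 'rV[R]_m :=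
  \row_i prim (fun s => x s 0 i) t.

Lemma L1v_vmeas m (x : R -> 'rV[R]_m) : L1v x -> vmeas [set: L] (x : L -> _).
Proof. by move=> Lx i; exact: L1_measurable. Qed.

Lemma L1v_enorm m (x : R -> 'rV[R]_m) : L1v x -> L1 (fun t => enorm (x t)).
Proof.
move=> Lx; apply: (@L1_dom _ _ (fun t => \sum_i `|x t 0 i|)).
- exact: measurable_enorm (L1v_vmeas Lx).
- by apply: L1_sum => i; exact: L1_abs.
- by move=> t; rewrite ger0_norm ?enorm_ge0//; exact: enorm_sum_le.
Qed.

Lemma L1v_dom m (x : R -> 'rV[R]_m) g : vmeas [set: L] (x : L -> _) -> L1 g ->
  (forall t, enorm (x t) <= g t) -> L1v x.
Proof.
move=> mx Lg xg i; apply: (L1_dom (mx i) Lg) => t.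
exact: le_trans (normr_coord_le _ _) (xg t).
Qed.

Lemma L1vD m (x y : R -> 'rV[R]_m) : L1v x -> L1v y -> L1v (fun t => x t + y t).
Proof.
by move=> Lx Ly i; under eq_fun do rewrite mxE; exact: L1D.
Qed.

Lemma L1vB m (x y : R -> 'rV[R]_m) : L1v x -> L1v y -> L1v (fun t => x t - y t).
Proof.
by move=> Lx Ly i; under eq_fun do rewrite !mxE; exact: L1B.
Qed.

Lemma primvB m (x y : R -> 'rV[R]_m) t : L1v x -> L1v y ->
  primv (fun s => x s - y s) t = primv x t - primv y t.
Proof.
move=> Lx Ly; apply/rowP => i; rewrite !mxE -primB//.
by apply: eq_prim => u; rewrite !mxE.
Qed.

(** Integrate <D, x> for the fixed vector D = [primv x t], apply Cauchy-Schwarz inside the integral,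
    and divide by |D|. *)
Lemma enorm_primv_le m (x : R -> 'rV[R]_m) t : L1v x ->
  enorm (primv x t) <= prim (fun s => enorm (x s)) t.
Proof.
move=> Lx; set D := primv x t.
have [D0|D0] := eqVneq (enorm D) 0.
  by rewrite D0 prim_ge0// => u; exact: enorm_ge0.
have Dp : 0 < enorm D by rewrite lt_def D0 enorm_ge0.
rewrite -(ler_pM2l Dp) -expr2 enorm_sqr -primZ; last exact: L1v_enorm.
have -> : dotv D D = prim (fun s => dotv D (x s)) t.
  rewrite /dotv prim_sum; last by move=> i; exact: L1Z.
  by apply: eq_bigr => i _; rewrite primZ// {2}/D mxE.
apply: le_prim.
- by apply: L1_sum => i; exact: L1Z.
- by apply: L1Z; exact: L1v_enorm.
- by move=> u; exact: dotv_le.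
Qed.

Lemma vmeas_primv m (x : R -> 'rV[R]_m) : L1v x -> vmeas [set: L] (primv x : L -> _).
Proof. by move=> Lx i; under eq_fun do rewrite mxE; exact: prim_measurable. Qed.

End VectorPrimitive.

Section Trajectories.
Variables (R : realType) (n : nat).
Local Notation L := (lebT R).
Implicit Types (z : R -> 'rV[R]_(n + 1)).

(** Only the first [n] coordinates are velocities; the last is the running cost. [x0] is the
    position at the initial time as soon as [z] vanishes before it. *)
Definition traj (x0 : 'rV[R]_n) z t := x0 + primv (fun s => lsubmx (z s)) t.

Lemma L1v_lsubmx z : L1v z -> L1v (fun s => lsubmx (z s)).
Proof. by move=> Lz i; under eq_fun do rewrite mxE; exact: Lz. Qed.

Lemma vmeas_traj x0 z : L1v z -> vmeas [set: L] (traj x0 z : L -> _).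
Proof.
move=> Lz; apply: (@vmeasD _ _ _ _ _ (fun=> x0)); first exact: vmeas_cst.
exact: vmeas_primv (L1v_lsubmx Lz).
Qed.

Lemma traj_dist x0 y0 z z' t : L1v z -> L1v z' ->
  enorm (traj y0 z t - traj x0 z' t) <=
  enorm (y0 - x0) + prim (fun s => enorm (z s - z' s)) t.
Proof.
move=> Lz Lz'; rewrite /traj opprD addrACA; apply: le_trans (enormD _ _) _.
rewrite lerD2l -primvB; [|exact: L1v_lsubmx..].
have LB := L1vB (L1v_lsubmx Lz) (L1v_lsubmx Lz').
apply: le_trans (enorm_primv_le _ LB) _; apply: le_prim.
- exact: L1v_enorm LB.
- exact: L1v_enorm (L1vB Lz Lz').
- by move=> s; rewrite -linearB; exact: enorm_lsubmx.
Qed.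

End Trajectories.

Lemma le0_of_geometric (R : realType) (x c : R) :
  (forall i : nat, x <= c / 2 ^+ i) -> x <= 0.
Proof.
move=> h; rewrite leNgt; apply/negP => x0.
have c0 : 0 <= `|c| / x by rewrite divr_ge0// ltW.
have := archi_boundP c0; set j := Num.bound _ => hj.
have : x * 2 ^+ j <= c by rewrite -ler_pdivlMr ?exprn_gt0//.
have : `|c| < x * j%:R by rewrite mulrC -ltr_pdivrMr.
have : x * j%:R <= x * 2 ^+ j.
  by rewrite ler_pM2l// -natrX ler_nat ltnW// ltn_expl.
by have := ler_norm c; lra.
Qed.

(** The intervals of radius 2B / 2^i around [u i] are nested, and the supremum of their left ends
    lies in all of them. *)
Lemma geometric_limit (R : realType) (u : nat -> R) (B : R) :
  (forall i, `|u i.+1 - u i| <= B / 2 ^+ i) ->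
  exists l, forall i, `|l - u i| <= 2 * B / 2 ^+ i.
Proof.
move=> h.
have p2 i : 0 < 2 ^+ i :> R by rewrite exprn_gt0.
have step i : 2 * B / 2 ^+ i.+1 = B / 2 ^+ i.
  by rewrite exprS; field; rewrite gt_eqF.
have dbl i : 2 * B / 2 ^+ i = B / 2 ^+ i + B / 2 ^+ i by field; rewrite gt_eqF.
pose lo i := u i - 2 * B / 2 ^+ i; pose up i := u i + 2 * B / 2 ^+ i.
have lo_up j i : lo (i + j)%N <= up i /\ lo i <= up (i + j)%N /\
    lo i <= lo (i + j)%N /\ up (i + j)%N <= up i.
  elim: j => [|j [_ [_ [h3 h4]]]].
    rewrite addn0; have : 0 <= B / 2 ^+ i by exact: le_trans (h i).
    rewrite /lo /up dbl => ?; do !split; lra.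
  have hj := h (i + j)%N; have B0 : 0 <= B / 2 ^+ (i + j) by exact: le_trans hj.
  move: hj; rewrite ler_norml => /andP[hj1 hj2].
  rewrite addnS; move: h3 h4; rewrite /lo /up !step !dbl => h3 h4.
  by do !split; lra.
pose l := sup (range lo).
have hs : has_sup (range lo).
  split; first by exists (lo 0%N), 0%N.
  by exists (up 0%N) => _ [j _ <-]; have [] := lo_up j 0%N.
exists l => i; rewrite ler_norml.
have l1 : lo i <= l by apply: ub_le_sup; [exact: proj2 hs|exists i].
have l2 : l <= up i.
  apply: ge_sup; first exact: proj1 hs.
  move=> _ [j _ <-]; have [ij|/ltnW ji] := leqP i j.
    by have [] := lo_up (j - i)%N i; rewrite subnKC.
  by have [_ []] := lo_up (i - j)%N j; rewrite subnKC.
by move: l1 l2; rewrite /lo /up => l1 l2; apply/andP; split; lra.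
Qed.

Lemma geometric_limit_row (R : realType) m (u : nat -> 'rV[R]_m) (B : R) :
  (forall i, enorm (u i.+1 - u i) <= B / 2 ^+ i) ->
  exists l, forall i, enorm (l - u i) <= m%:R * (2 * B / 2 ^+ i).
Proof.
move=> h; have /choice[l hl] c : exists l, forall i, `|l - u i 0 c| <= 2 * B / 2 ^+ i.
  apply: geometric_limit => i; apply: le_trans (h i).
  by have := normr_coord_le (u i.+1 - u i) c; rewrite !mxE.
exists (\row_c l c) => i; apply: le_trans (enorm_sum_le _) _.
apply: (@le_trans _ _ (\sum_(c < m) 2 * B / 2 ^+ i)).
  by apply: ler_sum => c _; rewrite !mxE.
by rewrite sumr_const card_ord [leRHS]mulr_natl.
Qed.

Section Filippov.
Variables (R : realType) (n : nat).
Local Notation L := (lebT R).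
Variables (h : R -> 'rV[R]_n -> 'rV[R]_n -> R) (k : R -> R) (a : R).
Hypothesis hmeas : forall x p, measurable_fun [set: L] (fun t : L => h t x p).
Hypothesis hconv : forall t x, convex_fun (h t x).
Hypothesis hlipx : forall t x y p,
  `|h t x p - h t y p| <= k t * (1 + enorm p) * enorm (x - y).
Hypothesis hlipp : forall t x, exists K, forall p q,
  `|h t x p - h t x q| <= K * enorm (p - q).
Hypothesis Lk : L1 k.
Hypothesis k0 : forall t, 0 <= k t.
Hypothesis ka : forall t, t < a -> k t = 0.

Let E t x := epi_conj (h t x).
Let near t x z := nearest_point (E t x) z.

Lemma near_epi t x z : E t x (near t x z).
Proof.
have [K hK] := hlipp t x.
by have [] := nearest_pointP z (@closed_epi_conj _ _ (h t x)) (epi_conj_neq0 (hconv t x) hK).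
Qed.

(* [epi H*(t,.)] is [2k]-Lipschitz for the Hausdorff distance. *)
Lemma near_dist t x y z (r : R) : 0 <= r ->
  (forall p, dotv (slope p) z - h t x p <= r * enorm (slope p)) ->
  enorm (near t y z - z) <= r + 2 * k t * enorm (x - y).
Proof.
move=> r0 hz; have [K hK] := hlipp t y.
rewrite enormBC; apply/(dist_epi_conj_le z (hconv t y) hK).
  by rewrite addr_ge0// !mulr_ge0// enorm_ge0.
move=> p; rewrite mulrDl; have := hz p.
have := le_trans (ler_norm _) (hlipx t x y p).
(* The factor 2 arises from 1 + |p| <= 2 |(p,-1)|. *)
have : k t * (1 + enorm p) * enorm (x - y) <= 2 * k t * enorm (x - y) * enorm (slope p).
  have -> : 2 * k t * enorm (x - y) * enorm (slope p) =
    k t * (2 * enorm (slope p)) * enorm (x - y) by ring.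
  rewrite ler_wpM2r ?enorm_ge0// ler_wpM2l//.
  by have := enorm_le_slope p; have := enorm_slope_ge1 p; lra.
lra.
Qed.

Lemma near_dist_epi t x y z : E t x z ->
  enorm (near t y z - z) <= 2 * k t * enorm (x - y).
Proof.
move=> Ez; have := @near_dist t x y z 0 (lexx _); rewrite add0r; apply=> p.
by rewrite mul0r subr_le0.
Qed.

Lemma vmeas_near (x : R -> 'rV[R]_n) (z : R -> 'rV[R]_(n + 1)) :
  vmeas [set: L] (x : L -> _) -> vmeas [set: L] (z : L -> _) ->
  vmeas [set: L] ((fun t => near t (x t) (z t)) : L -> _).
Proof.
move=> mx mz.
have mh p : measurable_fun [set: L] (fun t : L => h t (x t) p).
  apply: (@measurable_lipschitz_comp _ L R n setT (fun t x => h t x p)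
      (fun t => k t * (1 + enorm p)) (x : L -> _) measurableT _ _ mx).
  - by move=> y; exact: hmeas.
  - by apply: measurable_funM => //; exact: L1_measurable Lk.
  - by move=> t _ y y'; exact: hlipx.
have cv (t : L) : [set: L] t -> convex_fun (h t (x t)) by [].
have lp (t : L) : [set: L] t ->
  exists K, forall p q, `|h t (x t) p - h t (x t) q| <= K * enorm (p - q) by [].
exact: (@measurable_nearest_point _ L R n setT (fun t : L => h t (x t))
  measurableT mh cv lp (z : L -> _) mz).
Qed.

(** The 1 is the first step of the iteration. For the others, 2 (n + 1) comes from summing a
    geometric series in each coordinate, exp(2c) bounds the weight, and 1 + c bounds the L1 size of
    the first increment. *)
Definition filippov_cst (c : R) : R :=
  1 + 2 * (n + 1)%:R * expR (2 * c) * (1 + c).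

(** The increment after [zs i.+1] is at most [kap] times the distance of the last two trajectories
    ([near_dist_epi]), and in the weight of [prim_bielecki] that distance halves at each step. The
    defect [gam] enters directly only through the first increment. *)
Theorem filippov (zh : R -> 'rV[R]_(n + 1)) (gam : R -> R) (x0 y0 : 'rV[R]_n) :
  L1v zh -> L1 gam -> (forall t, 0 <= gam t) ->
  (forall t p, dotv (slope p) (zh t) - h t (traj x0 zh t) p <= gam t * enorm (slope p)) ->
  exists z, [/\ L1v z, forall t, epi_conj (h t (traj y0 z t)) (z t) &
    forall t, enorm (z t - zh t) <= gam t +
      2 * k t * (filippov_cst (Ltotal (fun t : R => 2 * k t)) * (enorm (y0 - x0) + Ltotal gam))].
Proof.
move=> Lzh Lg g0 hzh.
pose kap t := 2 * k t.
have Lkap : L1 kap by exact: L1Z.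
have kap0 t : 0 <= kap t by rewrite mulr_ge0.
have kapa t : t < a -> kap t = 0 by move=> ta; rewrite /kap ka ?mulr0.
pose T := Ltotal kap; have T0 : 0 <= T by exact: Ltotal_ge0.
pose del := enorm (y0 - x0); have del0 : 0 <= del by exact: enorm_ge0.
have tg0 : 0 <= Ltotal gam by exact: Ltotal_ge0.
pose zs := fix zs (i : nat) : R -> 'rV[R]_(n + 1) :=
  if i is j.+1 then fun t => near t (traj y0 (zs j) t) (zs j t) else zh.
have zsS i t : zs i.+1 t = near t (traj y0 (zs i) t) (zs i t) by [].
pose D i t := enorm (zs i.+1 t - zs i t).
have D0le t : D 0%N t <= gam t + kap t * del.
  rewrite /D zsS /= /kap; apply: le_trans (near_dist _ (g0 t) (hzh t)) _.
  by rewrite lerD2l; rewrite /traj opprD addrACA subrr addr0 enormBC.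
have DSle i t : D i.+1 t <= kap t * enorm (traj y0 (zs i.+1) t - traj y0 (zs i) t).
  by rewrite /D zsS enormBC -[in X in _ <= X]enormBC enormBC; apply: near_dist_epi; rewrite zsS; exact: near_epi.
have mzsS i : L1v (zs i) -> vmeas [set: L] (zs i.+1 : L -> _).
  move=> Li; apply: vmeas_near; [exact: vmeas_traj|exact: L1v_vmeas].
have Lzs_step i : L1v (zs i) -> (exists2 b, L1 b & forall t, D i t <= b t) -> L1v (zs i.+1).
  move=> Li [b Lb Db].
  have -> : zs i.+1 = (fun t => zs i t + (zs i.+1 t - zs i t)).
    by apply/funext => t; rewrite addrC subrK.
  apply: L1vD => //; apply: (L1v_dom _ Lb Db).
  by apply: vmeasB; [exact: mzsS|exact: L1v_vmeas].
pose G := Ltotal gam + T * del.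
have G0 : 0 <= G by rewrite addr_ge0// mulr_ge0.
pose e2 t := expR (2 * prim kap t).
have Lke : L1 (fun t => kap t * e2 t) by have [] := prim_bielecki 0 Lkap kap0 kapa.
have bie t : prim (fun t => kap t * e2 t) t <= e2 t / 2.
  by have [] := prim_bielecki t Lkap kap0 kapa.
have e21 t : 1 <= e2 t by rewrite -expR0 ler_expR mulr_ge0// prim_ge0.
have Lb0 : L1 (fun t => gam t + kap t * del).
  by apply: L1D => //; under eq_fun do rewrite mulrC; exact: L1Z.
(* Integrability of the next iterate needs the bound on the current increment, which needs
   integrable iterates; the induction carries both. *)
have main i : L1v (zs i) /\ L1v (zs i.+1) /\
    (forall t, enorm (traj y0 (zs i.+1) t - traj y0 (zs i) t) <= G / 2 ^+ i * e2 t).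
  elim: i => [|i [Li [LS IH]]].
    have L1' : L1v (zs 1%N) by apply: Lzs_step => //; exists (fun t => gam t + kap t * del).
    split => //; split => // t.
    apply: le_trans (traj_dist _ _ _ L1' Lzh) _; rewrite subrr enorm0 add0r.
    rewrite expr0 divr1; apply: (@le_trans _ _ G); last by rewrite ler_peMr.
    have LD : L1 (fun s => D 0%N s) := L1v_enorm (L1vB L1' Lzh).
    apply: (le_trans (le_prim t LD Lb0 D0le)).
    rewrite primD//; last by under eq_fun do rewrite mulrC; exact: L1Z.
    rewrite /G; apply: lerD; first exact: prim_le_Ltotal.
    under eq_prim do rewrite mulrC.
    by rewrite primZ// mulrC ler_wpM2r// prim_le_Ltotal.
  have DB t : D i.+1 t <= G / 2 ^+ i * (kap t * e2 t).
    by apply: le_trans (DSle i t) _; rewrite mulrCA ler_wpM2l.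
  have LB : L1 (fun t => G / 2 ^+ i * (kap t * e2 t)) by exact: L1Z.
  have LSS : L1v (zs i.+2).
    by apply: Lzs_step => //; exists (fun t => G / 2 ^+ i * (kap t * e2 t)).
  split => //; split => // t.
  apply: le_trans (traj_dist _ _ _ LSS LS) _; rewrite subrr enorm0 add0r.
  have LD : L1 (fun s => D i.+1 s) := L1v_enorm (L1vB LSS LS).
  apply: (le_trans (le_prim t LD LB DB)); rewrite primZ//.
  have -> : G / 2 ^+ i.+1 * e2 t = G / 2 ^+ i * (e2 t / 2).
    by rewrite exprS; field; rewrite expf_neq0.
  by rewrite ler_wpM2l// divr_ge0// exprn_ge0.
have Lzs i : L1v (zs i) by have [] := main i.
have e2T t : e2 t <= expR (2 * T) by rewrite ler_expR ler_pM2l// prim_le_Ltotal.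
(* From the second increment on, [B t / 2 ^+ i] is a bound at each fixed [t], so the limit and the
   inclusion are obtained at every [t]. *)
pose B t := kap t * (G * expR (2 * T)).
have B0 t : 0 <= B t by rewrite mulr_ge0// mulr_ge0// expR_ge0.
have LB : L1 B by rewrite /B; under eq_fun do rewrite mulrC; exact: L1Z.
have DB i t : enorm (zs i.+2 t - zs i.+1 t) <= B t / 2 ^+ i.
  apply: le_trans (DSle i t) _; rewrite /B -mulrA ler_wpM2l//.
  have [_ [_ /(_ t) H]] := main i; apply: le_trans H _.
  rewrite mulrAC ler_wpM2r ?invr_ge0 ?exprn_ge0// ler_wpM2l//.
have /choice[z hz] t : exists l, forall i,
    enorm (l - zs i.+1 t) <= (n + 1)%:R * (2 * B t / 2 ^+ i).
  by apply: geometric_limit_row => i; exact: DB.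
set N : R := (n + 1)%:R in hz *.
have N0 : 0 <= N by rewrite ler0n.
have p2 i : 0 < 2 ^+ i :> R by rewrite exprn_gt0.
have mz : vmeas [set: L] (z : L -> _).
  move=> c; apply: (@measurable_fun_cvg _ L R setT (fun i t => zs i.+1 t 0 c)
      (fun t => z t 0 c)).
    by move=> i; exact: (L1v_vmeas (Lzs i.+1)).
  move=> t _; apply: (@cvg_dist_le _ _ (fun i => N * (2 * B t) * (2^-1 ^+ i))).
    move=> i; have := le_trans (normr_coord_le _ c) (hz t i).
    by rewrite !mxE distrC exprVn mulrA.
  rewrite -[X in _ --> X](mulr0 (N * (2 * B t))).
  apply: cvgM; first exact: cvg_cst.
  by apply: cvg_expr; rewrite ger0_norm ?invr_ge0// invf_lt1// ltr1n.
have hz0 t : enorm (z t - zs 1%N t) <= N * 2 * B t.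
  by have := hz t 0%N; rewrite expr0 divr1 mulrA.
have Lz : L1v z.
  have -> : z = (fun t => zs 1%N t + (z t - zs 1%N t)).
    by apply/funext => t; rewrite addrC subrK.
  apply: L1vD; first exact: Lzs.
  have LNB : L1 (fun t => N * 2 * B t) by exact: L1Z.
  have mD := @vmeasB _ L R (n + 1) setT (z : L -> _) (zs 1%N : L -> _) mz (L1v_vmeas (Lzs 1%N)).
  exact: (L1v_dom mD LNB hz0).
have trajz i t : enorm (traj y0 z t - traj y0 (zs i.+1) t) <= (N * 2 * Ltotal B) / 2 ^+ i.
  apply: le_trans (traj_dist _ _ _ Lz (Lzs _)) _; rewrite subrr enorm0 add0r.
  have L' : L1 (fun s => (N * 2 / 2 ^+ i) * B s) by exact: L1Z.
  have LD : L1 (fun s => enorm (z s - zs i.+1 s)) := L1v_enorm (L1vB Lz (Lzs _)).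
  apply: le_trans (le_prim t LD L' _) _.
    by move=> s; apply: le_trans (hz s i) _; rewrite le_eqVlt; apply/orP; left; apply/eqP; ring.
  rewrite primZ// mulrAC ler_wpM2r ?invr_ge0 ?exprn_ge0// ler_wpM2l ?mulr_ge0//.
  exact: prim_le_Ltotal.
exists z; split => //.
(* [zs i.+2 t] satisfies the inequality at the trajectory of [zs i.+1]; replacing both by their
   limits costs a multiple of 2^-i. *)
- move=> t p; rewrite -subr_le0.
  apply: (@le0_of_geometric _ _ (k t * (1 + enorm p) * (N * 2 * Ltotal B) +
      enorm (slope p) * (N * 2 * B t))) => i.
  have := near_epi t (traj y0 (zs i.+1) t) (zs i.+1 t) p; rewrite -zsS => h1.
  have h2 := dotv_le (slope p) (z t - zs i.+2 t); rewrite dotvBr in h2.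
  have h3 : enorm (slope p) * enorm (z t - zs i.+2 t) <= enorm (slope p) * (N * 2 * B t) / 2 ^+ i.
    rewrite -mulrA ler_wpM2l ?enorm_ge0//; apply: le_trans (hz t i.+1) _.
    rewrite !mulrA ler_wpM2l ?mulr_ge0// lef_pV2 ?posrE//.
    by rewrite ler_eXn2l ?ltr1n.
  have h4 := le_trans (ler_norm _) (hlipx t (traj y0 (zs i.+1) t) (traj y0 z t) p).
  have h5 : k t * (1 + enorm p) * enorm (traj y0 (zs i.+1) t - traj y0 z t) <=
      k t * (1 + enorm p) * (N * 2 * Ltotal B) / 2 ^+ i.
    rewrite -[leRHS]mulrA; apply: ler_wpM2l; first by rewrite mulr_ge0// addr_ge0// enorm_ge0.
    by rewrite enormBC; exact: trajz.
  rewrite mulrDl; lra.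
- move=> t; apply: le_trans (enorm_dist_triangle _ (zs 1%N t) _) _.
  apply: le_trans (lerD (hz0 t) (D0le t)) _.
  rewrite addrCA lerD2l -/(kap t) -mulrA /B.
  have -> : N * (2 * (kap t * (G * expR (2 * T)))) + kap t * del =
    kap t * (del + 2 * N * expR (2 * T) * G) by ring.
  rewrite ler_wpM2l// /filippov_cst -/T -/N -/del /G.
  have : 0 <= N * expR (2 * T) by rewrite mulr_ge0// expR_ge0.
  have -> : 2 * N * expR (2 * T) = 2 * (N * expR (2 * T)) by ring.
  move: (N * _) (Ltotal gam) tg0 => P g' g'0 P0.
  have P1 : 0 <= P * (T * g') by rewrite !mulr_ge0.
  have P2 : 0 <= P * del by rewrite !mulr_ge0.
  lra.
Qed.

End Filippov.

(** * Steiner points *)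

Section SupportFunction.
Variables (R : realType) (m : nat) (K : set 'rV[R]_m) (B : R).
Hypothesis K0 : K !=set0.
Hypothesis KB : forall y, K y -> enorm y <= B.
Implicit Types (p q : 'rV[R]_m).

Let has_sup_dotv p : has_sup [set dotv p y | y in K].
Proof.
split; first by have [y Ky] := K0; exists (dotv p y), y.
exists (enorm p * B) => _ [y Ky <-]; apply: le_trans (dotv_le _ _) _.
by rewrite ler_wpM2l ?enorm_ge0 ?KB.
Qed.

Lemma dotv_le_supp_fun p y : K y -> dotv p y <= supp_fun K p.
Proof. by move=> Ky; apply: ub_le_sup; [exact: proj2 (has_sup_dotv p)|exists y]. Qed.

Lemma supp_fun_le p c : (forall y, K y -> dotv p y <= c) -> supp_fun K p <= c.
Proof. by move=> h; apply: ge_sup; [exact: proj1 (has_sup_dotv p)|move=> _ [y Ky <-]; exact: h]. Qed.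

Lemma supp_funDZ p q c : 0 <= c -> supp_fun K (p + c *: q) <= supp_fun K p + c * supp_fun K q.
Proof.
move=> c0; apply: supp_fun_le => y Ky; rewrite dotvDl dotvZl.
by rewrite lerD ?dotv_le_supp_fun// ler_wpM2l// dotv_le_supp_fun.
Qed.

Lemma supp_fun_lipschitz p q : `|supp_fun K p - supp_fun K q| <= B * enorm (p - q).
Proof.
have H x y : supp_fun K x - supp_fun K y <= B * enorm (x - y).
  rewrite lerBlDl; apply: supp_fun_le => z Kz.
  have := dotv_le_supp_fun y Kz; have := dotv_le (x - y) z; rewrite dotvBl.
  have : enorm (x - y) * enorm z <= B * enorm (x - y).
    by rewrite mulrC ler_wpM2r ?enorm_ge0 ?KB.
  lra.
rewrite ler_norml H andbT lerNl opprB enormBC; exact: H.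
Qed.

End SupportFunction.

Section SphereMeasure.
Variables (R : realType) (m : nat).
Variable mu : {measure set (m.-tuple R) -> \bar R}.
Hypothesis mu_unif : unif_sphere_measure mu.
Local Notation S := (@sphere R m).
Local Notation row := (@row_of_tuple R m).
Implicit Types (f g : 'rV[R]_m -> R) (q r : 'rV[R]_m).

Definition sphere_int f : R := \int[mu]_(p in S) f (row p).
Local Notation I := sphere_int.

(** Measurability everywhere with a bound on the sphere is stable under sums, products and
    reflections, and gives integrability for the finite measure [mu]. *)
Definition sphere_fun f := measurable_fun [set: m.-tuple R] (fun p => f (row p)) /\
  exists C, forall r, enorm r = 1 -> `|f r| <= C.

Lemma vmeas_row : vmeas [set: m.-tuple R] row.
Proof. by move=> i; under eq_fun do rewrite mxE; exact: measurable_tnth. Qed.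

Lemma measurable_sphere : measurable S.
Proof.
have := measurable_enorm vmeas_row measurableT (measurable_set1 (1 : R)).
by rewrite setTI.
Qed.

Lemma mu_sphere : mu S = 1%E.
Proof.
have [m0 m1 _] := mu_unif; have mS := measurable_sphere.
have := measureU mu mS (measurableC mS) (setICr S).
by rewrite setUv [X in (_ + X)%E]m0 adde0 => <-.
Qed.

Lemma sphere_integrable f : sphere_fun f -> mu.-integrable S (EFin \o (fun p => f (row p))).
Proof.
move=> [mf [C hC]]; apply: measurable_bounded_integrable.
- exact: measurable_sphere.
- by rewrite mu_sphere ltry.
- exact: measurable_funS mf.
- exists C; split; first exact: num_real.
  by move=> x Cx p Sp; apply: le_trans (hC _ Sp) (ltW Cx).
Qed.

Lemma sphere_funM f g : sphere_fun f -> sphere_fun g -> sphere_fun (fun r => f r * g r).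
Proof.
move=> [mf [C hC]] [mg [D hD]]; split; first exact: measurable_funM.
exists (C * D) => r r1; rewrite normrM; apply: ler_pM => //; [exact: hC|exact: hD].
Qed.

Lemma sphere_fun_lipschitz f C : (forall r r', `|f r - f r'| <= C * enorm (r - r')) ->
  sphere_fun f.
Proof.
move=> fC; split.
  apply: (@measurable_lipschitz_comp _ _ R m setT (fun _ r => f r) (fun=> C) row) => //.
  exact: vmeas_row.
exists (C + `|f 0|) => r r1; have := fC r 0; rewrite subr0 r1 mulr1 => h.
by rewrite -[f r](subrK (f 0)); apply: le_trans (ler_normD _ _) _; rewrite lerD2r.
Qed.

Lemma sphere_fun_coord i : sphere_fun (fun r => r 0 i).
Proof.
apply: (@sphere_fun_lipschitz _ 1) => r r'; rewrite mul1r.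
by have := normr_coord_le (r - r') i; rewrite !mxE.
Qed.

Lemma sphere_fun_dotv q : sphere_fun (fun r => dotv r q).
Proof.
apply: (@sphere_fun_lipschitz _ (enorm q)) => r r'.
by rewrite -dotvBl mulrC; exact: dotv_CS.
Qed.

Lemma sphere_fun_cst c : sphere_fun (fun=> c).
Proof. by split => //; exists `|c|. Qed.

Lemma sphere_intZ c f : sphere_fun f -> I (fun r => c * f r) = c * I f.
Proof. by move=> sf; apply: RintegralZl; [exact: measurable_sphere|exact: sphere_integrable]. Qed.

Lemma sphere_intD f g : sphere_fun f -> sphere_fun g -> I (fun r => f r + g r) = I f + I g.
Proof.
by move=> sf sg; apply: RintegralD; [exact: measurable_sphere|exact: sphere_integrable..].
Qed.

Lemma sphere_funZ c f : sphere_fun f -> sphere_fun (fun r => c * f r).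
Proof. by move=> sf; apply: sphere_funM => //; exact: sphere_fun_cst. Qed.

Lemma sphere_funD f g : sphere_fun f -> sphere_fun g -> sphere_fun (fun r => f r + g r).
Proof.
move=> [mf [C hC]] [mg [D hD]]; split; first exact: measurable_funD.
exists (C + D) => r r1; apply: le_trans (ler_normD _ _) _.
by rewrite lerD ?hC ?hD.
Qed.

Lemma sphere_int_sum (J : finType) (F : J -> 'rV[R]_m -> R) :
  (forall j, sphere_fun (F j)) -> I (fun r => \sum_j F j r) = \sum_j I (F j).
Proof.
move=> sF.
suff [_ ->] : sphere_fun (fun r => \sum_(j <- index_enum J) F j r) /\
    I (fun r => \sum_(j <- index_enum J) F j r) = \sum_(j <- index_enum J) I (F j) by [].
elim: (index_enum J) => [|j s [Ls IH]].
  rewrite big_nil; under eq_fun do rewrite big_nil.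
  split; first exact: sphere_fun_cst.
  by rewrite /sphere_int Rintegral_cst ?mul0r//; exact: measurable_sphere.
rewrite big_cons; under eq_fun do rewrite big_cons.
split; first exact: sphere_funD.
by rewrite -IH sphere_intD.
Qed.

Lemma sphere_int_le f g : sphere_fun f -> sphere_fun g ->
  (forall r, enorm r = 1 -> f r <= g r) -> I f <= I g.
Proof.
move=> sf sg fg; apply: le_Rintegral; [exact: measurable_sphere|exact: sphere_integrable..|].
by move=> p Sp; exact: fg.
Qed.

Lemma eq_sphere_int f g : (forall r, enorm r = 1 -> f r = g r) -> I f = I g.
Proof. by move=> fg; apply: eq_Rintegral => p /set_mem Sp; exact: fg. Qed.

(** For a unit vector [q], the reflection in the hyperplane orthogonal to it. The invariance of
    [mu], which includes matrices of determinant -1, is applied to these maps. *)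
Definition reflect q r := r - (2 * dotv r q) *: q.

Lemma enorm_reflect q r : enorm q = 1 -> enorm (reflect q r) = enorm r.
Proof.
move=> q1; congr Num.sqrt; have : dotv q q = 1 by rewrite -enorm_sqr q1 expr1n.
by rewrite /reflect dotvBl !dotvBr !dotvZl !dotvZr (dotvC q r) => ->; ring.
Qed.

Lemma sphere_int_reflect q f : enorm q = 1 -> sphere_fun f ->
  sphere_fun (fun r => f (reflect q r)) /\ I (fun r => f (reflect q r)) = I f.
Proof.
move=> q1 [mf [C hC]].
pose Q : 'M[R]_m := 1%:M - 2 *: (q^T *m q).
have qq : q *m q^T = 1%:M.
  apply/matrixP => i j; rewrite !ord1 mxE [RHS]mxE eqxx.
  have : dotv q q = 1 by rewrite -enorm_sqr q1 expr1n.
  by rewrite /dotv => <-; apply: eq_bigr => l _; rewrite mxE.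
have QT : Q^T = Q by rewrite /Q !linearB/= !linearZ/= trmx1 trmx_mul trmxK.
have QQ : Q *m Q^T = 1%:M.
  rewrite QT /Q mulmxBl mul1mx mulmxBr mulmx1 -scalemxAl -scalemxAr.
  have -> : q^T *m q *m (q^T *m q) = q^T *m q by rewrite mulmxA -(mulmxA q^T) qq mulmx1.
  by apply/matrixP => i j; rewrite !mxE; ring.
have rQ r : r *m Q = reflect q r.
  rewrite /Q mulmxBr mulmx1 -scalemxAr mulmxA /reflect -scalerA; congr (_ - 2 *: _).
  have -> : r *m q^T = (dotv r q)%:M.
    by apply/matrixP => i j; rewrite !ord1 !mxE eqxx mulr1n; apply: eq_bigr => l _; rewrite mxE.
  by rewrite mul_scalar_mx.
pose phi (p : m.-tuple R) := tuple_of_row (row p *m Q).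
have rphi p : row (phi p) = reflect q (row p).
  by rewrite -rQ; apply/rowP => i; rewrite mxE tnth_mktuple.
have mphi : measurable_fun setT phi.
  apply/measurable_fun_tnthP => i.
  rewrite [X in measurable_fun _ X](_ : _ = fun p => reflect q (row p) 0 i); last first.
    by apply/funext => p /=; rewrite -rphi mxE.
  rewrite /reflect; under eq_fun do rewrite !mxE.
  apply: measurable_funB; first exact: measurable_tnth.
  apply: measurable_funM => //; apply: measurable_funM => //.
  by apply: measurable_dotv; [exact: vmeas_row|exact: vmeas_cst].
have sfr : sphere_fun (fun r => f (reflect q r)).
  split; last by exists C => r r1; apply: hC; rewrite enorm_reflect.
  have := measurableT_comp mf mphi.
  by rewrite (_ : _ \o _ = fun p => f (reflect q (row p)))//; apply/funext => p /=; rewrite rphi.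
split => //; have [_ _ inv] := mu_unif.
have Sphi : phi @^-1` S = S.
  by apply/seteqP; split => p; rewrite /sphere/= rphi enorm_reflect.
have mEf : measurable_fun setT (EFin \o (fun p => f (row p))) by exact/measurable_EFinP.
have := integral_pushforward mphi (mu := mu) (D := S) mEf.
rewrite Sphi (_ : _ \o phi = EFin \o (fun p => f (reflect q (row p)))); last first.
  by apply/funext => p /=; rewrite rphi.
move=> /(_ (sphere_integrable sfr) measurable_sphere) H.
rewrite /sphere_int /Rintegral -[X in fine X = _]H; congr fine.
apply: eq_measure_integral => A mA _; exact: inv.
Qed.

Lemma delta_dotv r i : dotv r (delta_mx 0 i) = r 0 i.
Proof.
rewrite /dotv (bigD1 i)//= mxE !eqxx mulr1 big1 ?addr0// => j ji.
by rewrite mxE eqxx (negbTE ji) mulr0.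
Qed.

Definition moment i j := I (fun r => r 0 i * r 0 j).

(** Reflection along the i-th axis reverses the sign of the integrand. *)
Lemma moment_neq i j : i != j -> moment i j = 0.
Proof.
move=> ij; have e1 : enorm (delta_mx 0 i : 'rV[R]_m) = 1.
  by rewrite /enorm delta_dotv mxE !eqxx sqrtr1.
have sij := sphere_funM (sphere_fun_coord i) (sphere_fun_coord j).
have [_] := sphere_int_reflect e1 sij; rewrite -/(moment i j).
rewrite (_ : I _ = - moment i j); first by move=> h; lra.
rewrite -mulN1r -sphere_intZ//; apply: eq_sphere_int => r _.
rewrite /reflect delta_dotv !mxE !eqxx eq_sym (negbTE ij) /=; ring.
Qed.

(** Reflection along (e_i - e_j)/sqrt 2 exchanges the two coordinates. *)
Lemma moment_diag i j : moment i i = moment j j.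
Proof.
have [->//|ij] := eqVneq i j.
pose s : R := Num.sqrt (2^-1); have ss : s * s = 2^-1 by rewrite -expr2 sqr_sqrtr// invr_ge0.
pose q : 'rV[R]_m := s *: (delta_mx 0 i - delta_mx 0 j).
have q1 : enorm q = 1.
  rewrite /enorm dotvZl dotvZr mulrA ss dotvBl !dotvBr !delta_dotv !mxE !eqxx.
  by rewrite (negbTE ij) eq_sym (negbTE ij)/= -sqrtr1; congr Num.sqrt; field.
have sii := sphere_funM (sphere_fun_coord i) (sphere_fun_coord i).
have [_] := sphere_int_reflect q1 sii; rewrite -/(moment i i) => <-.
apply: eq_sphere_int => r _.
have -> : reflect q r 0 i = r 0 j.
  rewrite /reflect dotvZr dotvBr !delta_dotv !mxE !eqxx (negbTE ij)/= subr0.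
  have -> : 2 * (s * (r 0 i - r 0 j)) * (s * 1) = 2 * (s * s) * (r 0 i - r 0 j) by ring.
  by rewrite ss; field.
by [].
Qed.

(** The [m] equal diagonal moments add up to the integral of |r|^2 = 1, so each is 1/m: this is the
    origin of the factor [m] in the Steiner point. *)
Lemma momentE i j : m%:R * moment i j = (i == j)%:R.
Proof.
have [->|ij] := eqVneq i j; last by rewrite moment_neq// mulr0.
have : \sum_(l < m) moment l l = 1.
  rewrite /moment -sphere_int_sum; last first.
    by move=> l; apply: sphere_funM; exact: sphere_fun_coord.
  rewrite (@eq_sphere_int _ (fun=> 1)).
    by rewrite /sphere_int Rintegral_cst ?mul1r ?mu_sphere//; exact: measurable_sphere.
  by move=> r r1; rewrite -[LHS]/(dotv r r) -enorm_sqr r1 expr1n.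
rewrite (eq_bigr (fun=> moment j j)); last by move=> l _; exact: moment_diag.
by rewrite sumr_const card_ord mulr_natl.
Qed.

Lemma sphere_int_coord_dotv i q : m%:R * I (fun r => r 0 i * dotv r q) = q 0 i.
Proof.
rewrite (@eq_sphere_int _ (fun r => \sum_j q 0 j * (r 0 i * r 0 j))); last first.
  by move=> r _; rewrite mulr_sumr; apply: eq_bigr => j _; ring.
have s2 j : sphere_fun (fun r => r 0 i * r 0 j).
  by apply: sphere_funM; exact: sphere_fun_coord.
rewrite sphere_int_sum; last by move=> j; exact: sphere_funZ.
rewrite mulr_sumr (bigD1 i)//= big1 ?addr0.
  by rewrite sphere_intZ// mulrCA momentE eqxx mulr1.
by move=> j ji; rewrite sphere_intZ// mulrCA momentE eq_sym (negbTE ji) mulr0.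
Qed.

Lemma steiner_set1 v : steiner mu [set v] = v.
Proof.
apply/rowP => i; rewrite mxE -[RHS]sphere_int_coord_dotv; congr (_ * _).
apply: eq_Rintegral => p _; congr (_ * _).
by rewrite /supp_fun image_set1 sup1.
Qed.

Lemma sphere_int_dotv2 q : m%:R * I (fun r => dotv r q * dotv r q) = dotv q q.
Proof.
rewrite (@eq_sphere_int _ (fun r => \sum_i q 0 i * (r 0 i * dotv r q))); last first.
  by move=> r _; rewrite {1}/dotv mulr_suml; apply: eq_bigr => j _; ring.
have s2 i : sphere_fun (fun r => r 0 i * dotv r q).
  by apply: sphere_funM; [exact: sphere_fun_coord|exact: sphere_fun_dotv].
rewrite sphere_int_sum; last by move=> j; exact: sphere_funZ.
rewrite mulr_sumr; apply: eq_bigr => i _.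
by rewrite sphere_intZ// mulrCA sphere_int_coord_dotv.
Qed.

(* Reflecting in [q^perp] antisymmetrizes [<r,q>], and sublinearity bounds
   [<r,q> (s(r) - s(reflect q r))] by [2 <r,q>^2 s(q)]. *)
Lemma dotv_steiner_le (K : set 'rV[R]_m) (B : R) q : K !=set0 ->
  (forall y, K y -> enorm y <= B) -> enorm q = 1 ->
  dotv (steiner mu K) q <= supp_fun K q.
Proof.
move=> K0 KB q1; pose s := supp_fun K.
have ss : sphere_fun s by apply: (@sphere_fun_lipschitz _ B) => r r'; exact: supp_fun_lipschitz.
have sq := sphere_fun_dotv q.
pose J := I (fun r => dotv r q * s r).
have -> : dotv (steiner mu K) q = m%:R * J.
  rewrite /J (@eq_sphere_int _ (fun r => \sum_i q 0 i * (r 0 i * s r))); last first.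
    by move=> r _; rewrite {1}/dotv mulr_suml; apply: eq_bigr => j _; ring.
  have s2 i : sphere_fun (fun r => r 0 i * s r).
    by apply: sphere_funM => //; exact: sphere_fun_coord.
  rewrite sphere_int_sum; last by move=> j; exact: sphere_funZ.
  rewrite mulr_sumr; apply: eq_bigr => i _.
  by rewrite mxE sphere_intZ// [in RHS]mulrCA mulrC.
have [sr' Jr] := sphere_int_reflect q1 (sphere_funM sq ss).
have qq : dotv q q = 1 by rewrite -enorm_sqr q1 expr1n.
have dr r : dotv (reflect q r) q = - dotv r q.
  by rewrite /reflect dotvBl dotvZl qq; ring.
have : J + J <= I (fun r => (2 * s q) * (dotv r q * dotv r q)).
  rewrite {2}/J -Jr -sphere_intD//; last exact: sphere_funM.
  apply: sphere_int_le.
  - by apply: sphere_funD => //; exact: sphere_funM.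
  - by apply: sphere_funZ; exact: sphere_funM.
  move=> r _ /=; rewrite dr /reflect.
  set c := dotv r q; have [c0|c0] := leP 0 c.
    have := supp_funDZ K0 KB (r - (2 * c) *: q) q (mulr_ge0 (ler0n R 2) c0).
    rewrite subrK -/(s r) -/(s q) -/(s _) => h.
    have : c * s r <= c * (s (r - (2 * c) *: q) + 2 * c * s q) by rewrite ler_wpM2l.
    lra.
  have c0' : 0 <= 2 * - c by rewrite mulr_ge0// oppr_ge0 ltW.
  have := supp_funDZ K0 KB r q c0'; rewrite mulrN scaleNr -/(s r) -/(s q) -/(s _) => h.
  have nc : 0 <= - c by rewrite oppr_ge0 ltW.
  have := ler_wpM2l nc h; lra.
rewrite sphere_intZ//; last exact: sphere_funM.
have := sphere_int_dotv2 q; rewrite qq => H1 H2.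
have m0 : 0 <= m%:R :> R by [].
have := ler_wpM2l m0 H2; rewrite mulrCA H1 -/(s q); lra.
Qed.

End SphereMeasure.

(** * The Steiner selection of an epigraph *)

Section SteinerEpigraph.
Variables (R : realType) (n : nat).
Variable mu : {measure set ((n + 1).-tuple R) -> \bar R}.
Hypothesis mu_unif : unif_sphere_measure mu.

(** [epi_conj h] is an intersection of half-spaces with normals [slope p], and [dotv_steiner_le],
    stated for unit vectors, keeps the Steiner point in every half-space that contains [K]. *)
Lemma steiner_epi_conj (h : 'rV[R]_n -> R) (K : set 'rV[R]_(n + 1)) (B : R) :
  K !=set0 -> (forall y, K y -> enorm y <= B) -> K `<=` epi_conj h ->
  epi_conj h (steiner mu K).
Proof.
move=> K0 KB Kh p; set q := slope p.
have q0 : 0 < enorm q by apply: lt_le_trans (enorm_slope_ge1 p).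
pose u := (enorm q)^-1 *: q.
have u1 : enorm u = 1 by rewrite enormZ ger0_norm ?invr_ge0 ?(ltW q0)// mulVf// gt_eqF.
have -> : q = enorm q *: u by rewrite scalerA mulfV ?scale1r// gt_eqF.
rewrite dotvZl -ler_pdivlMl// dotvC.
apply: le_trans (dotv_steiner_le mu_unif K0 KB u1) _.
apply: (supp_fun_le K0 KB) => y Ky; rewrite dotvZl ler_pM2l ?invr_gt0//.
exact: Kh.
Qed.

Lemma dist_set_nearest (E : set 'rV[R]_(n + 1)) z : closed E -> E !=set0 ->
  dist_set z E = enorm (z - nearest_point E z).
Proof.
move=> cE E0; have [EP Pmin] := nearest_pointP z cE E0.
apply/eqP; rewrite eq_le; apply/andP; split.
  apply: ge_inf; last by exists (nearest_point E z).
  by exists 0 => _ [y _ <-]; exact: enorm_ge0.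
apply: lb_le_inf; first by exists (enorm (z - nearest_point E z)), (nearest_point E z).
by move=> _ [y Ey <-]; exact: Pmin.
Qed.

Variable H : R -> 'rV[R]_n -> 'rV[R]_n -> R.

Lemma epiHE t x : epiH H t x = epi_conj (H t x).
Proof.
apply/seteqP; split => z /=.
  move=> hz p; rewrite dotv_slope dotvC.
  have : ((dotv (lsubmx z) p - H t x p)%:E <= (rsubmx z 0 0)%:E)%E.
    by apply: le_trans hz; apply: ereal_sup_ubound; exists p.
  by rewrite lee_fin; lra.
move=> hz; apply: ge_ereal_sup => _ [p _ <-]; rewrite lee_fin.
by have := hz p; rewrite dotv_slope dotvC; lra.
Qed.

Lemma steiner_fl_epi t x a : convex_fun (H t x) ->
  (exists K, forall p q, `|H t x p - H t x q| <= K * enorm (p - q)) ->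
  epi_conj (H t x) (steiner_fl H mu t x a).
Proof.
move=> hc [L hL]; have cE := @closed_epi_conj _ _ (H t x).
have E0 := epi_conj_neq0 hc hL; have [EP _] := nearest_pointP a cE E0.
rewrite /steiner_fl; apply: (@steiner_epi_conj _ _ (enorm a + 2 * dist_set a (epiH H t x))).
(* The nearest point belongs to Phi because its distance d satisfies d <= 2 d. *)
- exists (nearest_point (epi_conj (H t x)) a); split; first by rewrite epiHE.
  rewrite /= epiHE dist_set_nearest// enormBC; have := enorm_ge0 (a - nearest_point (epi_conj (H t x)) a); lra.
- move=> y [_ /= ya]; rewrite -[y](subrK a); apply: le_trans (enormD _ _) _; lra.
- by move=> y []; rewrite epiHE.
Qed.

Lemma steiner_fl_id t x a : epi_conj (H t x) a -> steiner_fl H mu t x a = a.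
Proof.
move=> Ea; have cE := @closed_epi_conj _ _ (H t x).
rewrite /steiner_fl (_ : PhiH H t x a = [set a]); first exact: steiner_set1.
(* At distance 0 the ball shrinks to the point [a]. *)
have d0 : dist_set a (epiH H t x) = 0.
  by rewrite epiHE dist_set_nearest ?nearest_point_id ?subrr ?enorm0//; exists a.
apply/seteqP; split => y; rewrite /PhiH/= d0 mulr0.
  move=> [_ ya]; apply/eqP; rewrite -subr_eq0; apply/eqP; apply: enorm_eq0.
  by apply/eqP; rewrite eq_le ya enorm_ge0.
by move=> ->; rewrite subrr enorm0 epiHE.
Qed.

End SteinerEpigraph.

(** * The Bolza problem *)

Section LocalLipschitz.
Variables (R : realType) (n : nat).

Lemma pointwise_lipschitz01 (f : R -> R) (C : R) :
  (forall s, 0 <= s <= 1 -> exists2 r, 0 < r &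
     forall s', `|s' - s| < r -> `|f s' - f s| <= C * `|s' - s|) ->
  `|f 1 - f 0| <= C.
Proof.
move=> hf.
pose good : set R := fun s => 0 <= s <= 1 /\ `|f s - f 0| <= C * s.
suff [_] : good 1 by rewrite mulr1.
have good0 : good 0 by split; rewrite ?lexx ?ler01// subrr normr0 mulr0.
have hs : has_sup good by split; [exists 0|exists 1 => s [/andP[]]].
pose z := sup good.
have z0 : 0 <= z by apply: ub_le_sup; [exact: proj2 hs|exact: good0].
have z1 : z <= 1 by apply: ge_sup; [exact: proj1 hs|move=> s [/andP[]]].
have [r r0 hr] := hf z (introT andP (conj z0 z1)).
have [s gs zs] := sup_adherent r0 hs; rewrite -/z in zs.
have sz : s <= z by apply: ub_le_sup; [exact: proj2 hs|exact: gs].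
pose t := Num.min 1 (z + r / 2).
have r20 : 0 < r / 2 by rewrite divr_gt0.
have r2 : r / 2 < r by rewrite ltr_pdivrMr// ltr_pMr// ltr1n.
have t1 : t <= 1 by rewrite ge_min lexx.
have zt : z <= t by rewrite le_min z1 lerDl ltW.
have tz : t <= z + r / 2 by rewrite ge_min lexx orbT.
have gt : good t.
  split; first by rewrite t1 (le_trans z0 zt).
  have [_ fs] := gs.
  have h1 : `|f s - f z| <= C * (z - s).
    have -> : z - s = `|s - z| by rewrite distrC ger0_norm// subr_ge0.
    by apply: hr; rewrite ltr_norml; apply/andP; split; lra.
  have h2 : `|f t - f z| <= C * (t - z).
    have -> : t - z = `|t - z| by rewrite ger0_norm// subr_ge0.
    by apply: hr; rewrite ltr_norml; apply/andP; split; lra.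
  have := ler_distD (f s) (f t) (f 0); have := ler_distD (f z) (f t) (f s).
  rewrite (distrC (f z)); lra.
have tz' : t <= z by apply: ub_le_sup; [exact: proj2 hs|exact: gt].
suff -> : 1 = t by [].
apply/eqP; rewrite eq_le t1 andbT; move: tz'; rewrite /t ge_min => /orP[bz|].
  by rewrite le_min lexx (le_trans bz)// lerDl ltW.
by rewrite gerDl leNgt r20.
Qed.

Lemma closed_enorm_ball (r : R) : closed [set x : 'rV[R]_n | enorm x <= r].
Proof.
apply: (preimage_closed (f := @enorm R n) (D := [set s | s <= r])).
  by move=> x _; exact: enorm_continuous.
exact: closed_le.
Qed.

(** By compactness one [K] bounds the slope around every point of the ball; following the segment
    from [y] to [x], which stays in the ball, turns it into a Lipschitz constant. *)
Lemma local_lipschitz_ball (g : 'rV[R]_n -> R) (rad : R) :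
  (forall x0, exists r, 0 < r /\ exists K : R, forall x y,
     enorm (x - x0) < r -> enorm (y - x0) < r -> `|g x - g y| <= K * enorm (x - y)) ->
  exists2 K, 0 <= K & forall x y, enorm x <= rad -> enorm y <= rad ->
    `|g x - g y| <= K * enorm (x - y).
Proof.
move=> hg; pose A : set 'rV[R]_n := [set x | enorm x <= rad].
have cA : compact A.
  apply: bounded_closed_compact; last exact: closed_enorm_ball.
  exists rad; split; first exact: num_real.
  by move=> M rM x Ax; apply: le_trans (mxnorm_le_enorm x) (le_trans Ax (ltW rM)).
pose P (K : R) (x : 'rV[R]_n) := exists2 r, 0 < r & forall u, enorm (u - x) < r ->
  `|g u - g x| <= K * enorm (u - x).
have [] : \forall K \near +oo, A `<=` P K.
  have cov := proj1 (compact_near_coveringP A) cA.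
  apply: (cov R (pinfty_nbhs R) P _) => x Ax.
  have [r [r0 [K0 hK]]] := hg x.
  have D0 : 0 < n%:R + 1 :> R by rewrite ltr_wpDl.
  (* [ball] refers to the max norm; the denominator n + 1 brings its points within r / 2 in the
     Euclidean norm. *)
  exists (ball x (r / 2 / (n%:R + 1)), [set K | K0 <= K]) => /=.
    split; first by apply: nbhsx_ballx; rewrite !divr_gt0.
    by exists K0; split; [exact: num_real|move=> y /ltW].
  move=> [x' K] /= [xx' KK].
  have {}xx' : enorm (x' - x) < r / 2.
    rewrite enormBC; apply: le_lt_trans (enorm_le_mxnorm _) _.
    move: xx'; rewrite mx_norm_ball /ball_/= ltr_pdivlMr// mulrC.
    by apply: le_lt_trans; rewrite ler_wpM2r// lerDl.
  exists (r / 2); first by rewrite divr_gt0.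
  move=> u ux'; apply: le_trans (hK u x' _ _) _.
  - apply: le_lt_trans (enorm_dist_triangle _ x' _) _; lra.
  - by apply: lt_le_trans xx' _; rewrite ler_pdivrMr// ler_pMr// ler1n.
  - by rewrite ler_wpM2r ?enorm_ge0.
move=> K1 [_ hK1]; pose K := `|K1| + 1.
have hK : A `<=` P K by apply: hK1; rewrite /K; have := ler_norm K1; lra.
exists K; first by rewrite addr_ge0.
move=> x y Ax Ay.
pose f s := g (y + s *: (x - y)).
have f1 : f 1 = g x by rewrite /f scale1r addrC subrK.
have f0 : f 0 = g y by rewrite /f scale0r addr0.
rewrite -f1 -f0; apply: pointwise_lipschitz01 => s /andP[s0 s1].
have As : A (y + s *: (x - y)).
  rewrite /A/=; have -> : y + s *: (x - y) = s *: x + (1 - s) *: y.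
    by apply/rowP => i; rewrite !mxE; ring.
  apply: le_trans (enormD _ _) _; rewrite !enormZ !ger0_norm ?subr_ge0//.
  have : s * enorm x <= s * rad by rewrite ler_wpM2l.
  have : (1 - s) * enorm y <= (1 - s) * rad by rewrite ler_wpM2l// subr_ge0.
  lra.
have [r r0 hr] := hK _ As.
have D0 : 0 < enorm (x - y) + 1 by rewrite ltr_wpDl// enorm_ge0.
exists (r / (enorm (x - y) + 1)); first exact: divr_gt0.
move=> s'; rewrite ltr_pdivlMr// => hs'.
have E : y + s' *: (x - y) - (y + s *: (x - y)) = (s' - s) *: (x - y).
  by apply/rowP => i; rewrite !mxE; ring.
have := hr (y + s' *: (x - y)); rewrite E enormZ -/(f s') -/(f s).
have -> : K * enorm (x - y) * `|s' - s| = K * (`|s' - s| * enorm (x - y)) by ring.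
apply; apply: le_lt_trans hs'; rewrite ler_wpM2l//; lra.
Qed.

End LocalLipschitz.

Section Clip.
Variables (R : realType) (n : nat) (r : R).
Implicit Types (x y : 'rV[R]_n).

(** Truncation by coordinates does not increase Euclidean distances, fixes the ball of radius [r],
    and maps into the ball of radius n r, where (HLC) supplies one function k. *)
Definition clip x : 'rV[R]_n := \row_i Num.max (- r) (Num.min r (x 0 i)).

Lemma clip_lipschitz x y : enorm (clip x - clip y) <= enorm (x - y).
Proof.
apply: enorm_le_mono => i; rewrite !mxE.
move: (x 0 i) (y 0 i) => a b; rewrite !maxEle !minEle.
by do !case: ifPn; rewrite -?ltNge -?ltNge -?ltNge => *; rewrite ler_norml; apply/andP; split;
  case: (ger0P (a - b)) => *; lra.
Qed.

Hypothesis r0 : 0 <= r.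

Lemma clip_coord x i : `|clip x 0 i| <= r /\ `|clip x 0 i| <= `|x 0 i|.
Proof.
rewrite mxE; move: (x 0 i) => a; have r0' := r0; have a0 := normr_ge0 a.
have /andP[a1 a2] : - `|a| <= a <= `|a| by rewrite -ler_norml.
split; rewrite ler_norml le_max ge_max ge_min !le_min.
  by rewrite !lexx/= andbT; lra.
have h1 : - `|a| <= r by lra.
have h2 : - r <= `|a| by lra.
by rewrite h1 h2 a1 a2 !orbT.
Qed.

Lemma enorm_clip_le x : enorm (clip x) <= enorm x.
Proof. by apply: enorm_le_mono => i; have [] := clip_coord x i. Qed.

Lemma enorm_clip x : enorm (clip x) <= n%:R * r.
Proof.
apply: le_trans (enorm_sum_le _) _; apply: le_trans (_ : _ <= \sum_(i < n) r) _.
  by apply: ler_sum => i _; have [] := clip_coord x i.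
by rewrite sumr_const card_ord mulr_natl.
Qed.

Lemma clip_id x : enorm x <= r -> clip x = x.
Proof.
move=> xr; apply/rowP => i; rewrite mxE.
have := le_trans (normr_coord_le x i) xr; rewrite ler_norml => /andP[h1 h2].
by rewrite (min_idPr h2) (max_idPr h1).
Qed.

End Clip.

(** The integral of a nonnegative function is a supremum over simple functions below it, which is
    monotone for arbitrary functions. It is meant for running costs along a control. *)
Lemma le_integral_any d (T : measurableType d) (R : realType)
    (mu : {measure set T -> \bar R}) (D : set T) (f g : T -> \bar R) :
  (forall x, D x -> (f x <= g x)%E) ->
  (\int[mu]_(x in D) f x <= \int[mu]_(x in D) g x)%E.
Proof.
move=> fg; rewrite integralE [leRHS]integralE.
have H (u v : T -> \bar R) : (forall x, 0 <= u x)%E -> (forall x, 0 <= v x)%E ->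
    (forall x, D x -> (u x <= v x)%E) -> (\int[mu]_(x in D) u x <= \int[mu]_(x in D) v x)%E.
  move=> u0 v0 uv; rewrite !ge0_integralE//; apply: ereal_sup_le => _ [h hu <-].
  exists h => // x; apply: le_trans (hu x) _; rewrite !patchE.
  by case: ifPn => // /set_mem; exact: uv.
apply: leeB; apply: H => x; rewrite ?funepos_ge0 ?funeneg_ge0// => Dx.
  by rewrite !funeposE ge_max !le_max fg//= lexx orbT.
by rewrite !funenegE ge_max !le_max leeN2 fg//= lexx orbT.
Qed.

Section PrimitiveEstimates.
Variable R : realType.
Local Notation L := (lebT R).
Implicit Types (f g : R -> R).

Lemma leb_measurable_ae f g : measurable_fun [set: L] (f : L -> R) ->
  {ae leb R, forall u : L, f u = g u} -> measurable_fun [set: L] (g : L -> R).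
Proof.
move=> mf fg; apply/measurable_EFinP.
apply: (@ae_measurable_fun _ L R (leb R) completed_lebesgue_measure_is_complete setT (EFin \o f)).
  by move: fg; apply: filterS => u /= ->.
exact/measurable_EFinP.
Qed.

Lemma Ltotal_prim f t : (forall u, t < u -> f u = 0) -> Ltotal f = prim f t.
Proof.
move=> f0; rewrite /Ltotal /prim [RHS]Rintegral_mkcond; apply: eq_Rintegral => u _.
rewrite patchE; case: ifPn => //; rewrite notin_setE/= in_itv/= => /negP; rewrite -ltNge.
exact: f0.
Qed.

(** Nothing is accumulated before [t], so only t <= s matters; the absolute value spares the
    distinction of which time is earlier. This is how |Psi(t0) - Psi(s0)| arises. *)
Lemma prim_le_incr f g s t : L1 f -> L1 g -> (forall u, 0 <= g u) ->
  (forall u, u < t -> f u = 0) -> (forall u, f u <= g u) ->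
  prim f s <= `|prim g s - prim g t|.
Proof.
move=> Lf Lg g0 f0 fg; have [st|/ltW ts] := leP s t.
  rewrite (@prim_eq0 _ f s)// => u us; apply: f0; exact: lt_le_trans us st.
rewrite -[prim f s]subr0 -(@prim_eq0 _ f t)// !prim_itv//.
apply: le_trans (ler_norm _); apply: le_Rintegral; [exact: leb_itv| | |by []].
  by apply: L1_integrable => //; exact: leb_itv.
by apply: L1_integrable => //; exact: leb_itv.
Qed.

Lemma Ltotal_mask_le g s t : L1 g -> (forall u, 0 <= g u) ->
  Ltotal (g \_ `[s, t[%classic) <= `|prim g t - prim g s|.
Proof.
move=> Lg g0; have Lm : L1 (g \_ `[s, t[%classic) by apply: L1_mask => //; exact: leb_itv.
rewrite (@Ltotal_prim _ t); last first.
  move=> u tu; rewrite patchE memNset//= in_itv/= => /andP[_ ut].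
  by move: (lt_trans tu ut); rewrite ltxx.
apply: prim_le_incr => //.
  move=> u us; rewrite patchE memNset//= in_itv/= => /andP[su _].
  by move: (le_lt_trans su us); rewrite ltxx.
by move=> u; rewrite patchE; case: ifP.
Qed.

(** Gronwall's inequality for 1 + |x|, whose growth is linear rather than affine: hence the form of
    the radius [r]. The integral of |v| only supplies the finiteness that [gronwall] asks for. *)
Lemma vec_gronwall n (c : R -> R) (x0 : 'rV[R]_n) (v : R -> 'rV[R]_n) (M : R) :
  L1 c -> (forall t, 0 <= c t) -> (forall t, t < 0 -> c t = 0) -> L1v v ->
  enorm x0 <= M ->
  (forall t, enorm (v t) <= c t * (1 + enorm (x0 + primv v t))) ->
  forall t, enorm (x0 + primv v t) <= 2 * (1 + M) * expR (2 * Ltotal c).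
Proof.
move=> Lc c0 cN Lv x0M hv t.
have M0 : 0 <= M := le_trans (enorm_ge0 _) x0M.
pose u t := 1 + enorm (x0 + primv v t).
have u0 s : 0 <= u s by rewrite addr_ge0// enorm_ge0.
have Ln := L1v_enorm Lv.
have bnd s : enorm (x0 + primv v s) <= M + prim (fun r => enorm (v r)) s.
  by apply: le_trans (enormD _ _) _; rewrite lerD// enorm_primv_le.
have uB s : 0 <= u s <= 1 + (M + Ltotal (fun r => enorm (v r))).
  rewrite u0/= lerD2l; apply: le_trans (bnd s) _; rewrite lerD2l.
  by apply: prim_le_Ltotal => // r; exact: enorm_ge0.
have mu : measurable_fun [set: L] (u : L -> R).
  have mv := @vmeasD _ L R n setT (fun=> x0) (primv v : L -> _) 
    (@vmeas_cst _ L R n setT x0) (vmeas_primv Lv).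
  exact: measurable_funD (measurable_cst _) (measurable_enorm mv).
have Lcu : L1 (fun s => c s * u s).
  apply: (L1_mul_bounded Lc mu) => s; rewrite ger0_norm//.
  exact: (proj2 (andP (uB s))).
have H s : u s <= (1 + M) + prim (fun r => c r * u r) s.
  rewrite /u -addrA lerD2l; apply: le_trans (bnd s) _; rewrite lerD2l.
  exact: le_prim.
have A0 : 0 <= 1 + M by rewrite addr_ge0.
have := gronwall Lc c0 cN mu uB A0 H t.
have : expR (2 * prim c t) <= expR (2 * Ltotal c).
  by rewrite ler_expR ler_pM2l// prim_le_Ltotal.
move=> /(ler_wpM2l (mulr_ge0 (ler0n R 2) A0)) h1 h2.
have := le_trans h2 h1; rewrite /u; lra.
Qed.

End PrimitiveEstimates.

Section RowDerivative.
Variables (R : realType) (n : nat).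
Implicit Types (y : 'rV[R]_n) (z : R -> 'rV[R]_(n + 1)).

Lemma is_derive_row (x : R -> 'rV[R]_n) (t : R) (v : 'rV[R]_n) :
  (forall i, is_derive t 1 (fun s => x s 0 i) (v 0 i)) -> is_derive t 1 x v.
Proof.
move=> h; have dx : derivable x t 1.
  by apply/derivable_mxP => i j; rewrite ord1; have [] := h j.
split => //; rewrite derive_mx//; apply/rowP => j; rewrite mxE.
by have [_ ->] := h j.
Qed.

Lemma is_derive_row_coord (x : R -> 'rV[R]_n) (t : R) (v : 'rV[R]_n) i :
  is_derive t 1 x v -> is_derive t 1 (fun s => x s 0 i) (v 0 i).
Proof.
move=> [dx <-]; rewrite derive_mx// mxE; apply/derivableP.
exact: ((derivable_mxP x t 1).1 dx 0 i).
Qed.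

Lemma traj_coord y z i : (fun t => traj y z t 0 i) =
  (fun t => y 0 i + prim (fun s => z s 0 (lshift 1 i)) t).
Proof.
apply/funext => t; rewrite !mxE; congr (_ + _); apply: eq_prim => s.
by rewrite mxE.
Qed.

Lemma traj_start s y z : L1v z -> (forall t, t < s -> z t = 0) -> traj y z s = y.
Proof.
move=> Lz z0; apply/rowP => i.
rewrite -[LHS]/((fun t => traj y z t 0 i) s) traj_coord prim_eq0 ?addr0//.
by move=> u us; rewrite z0// mxE.
Qed.

End RowDerivative.

Section ControlRegularity.
Variable R : realType.
Local Notation L := (lebT R).
Implicit Types (F f : R -> R) (a b : R).

Lemma integral_prim (f : R -> R) s t : L1 f -> (forall u, ~~ (s <= u <= t) -> f u = 0) ->
  (\int[leb R]_(u in (`[s, t]%classic : set L)) (f u)%:E = (prim f t)%:E)%E.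
Proof.
move=> Lf f0; have mI : measurable (`[s, t]%classic : set L) := leb_itv _.
have Iw := L1_integrable mI Lf.
rewrite -[LHS]fineK; last exact: integrable_fin_num Iw.
congr (_%:E); rewrite -[LHS]/(Rintegral _ _ _) /prim Rintegral_mkcond [RHS]Rintegral_mkcond.
congr (Rintegral _ _ _); apply/funext => u; rewrite !patchE.
have [h|h] := boolP (s <= u <= t); last by rewrite f0//; do 2 case: ifP.
by rewrite !mem_set//= in_itv/=//; case/andP: h.
Qed.

(* The bound from below makes the negative part integrable, so that a finite
   integral controls the positive part. *)
Lemma integrable_lt_pinfty (D : set L) (f g : R -> R) : measurable D ->
  measurable_fun D (f : L -> R) -> (leb R).-integrable D (EFin \o g) ->
  (forall t, D t -> 0 <= g t /\ - g t <= f t) ->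
  (\int[leb R]_(t in D) (f t)%:E < +oo)%E ->
  (leb R).-integrable D (EFin \o f).
Proof.
move=> mD mf ig fg fI; pose F := (EFin \o f) : L -> \bar R.
have mF : measurable_fun D F by apply/measurable_EFinP.
have negI : (\int[leb R]_(t in D) F^\- t < +oo)%E.
  have /integrableP[mg ] := ig; apply: le_lt_trans; apply: ge0_le_integral => //.
  - exact: measurable_funeneg.
  - exact: measurableT_comp.
  move=> t Dt; have [g0 gf] := fg t Dt; rewrite /= ger0_norm// funenegE /F/=.
  by rewrite -EFin_max lee_fin ge_max g0 andbT lerNl.
have negE : (\int[leb R]_(t in D) F^\- t)%E \is a fin_num.
  by rewrite ge0_fin_numE//; apply: integral_ge0.
have posI : (\int[leb R]_(t in D) F^\+ t < +oo)%E.
  rewrite ltNge leye_eq; apply/negP => /eqP E; move: fI.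
  rewrite integralE -/F E; move: negE; case: (integral _ _ _) => //.
apply/integrableP; split => //.
rewrite (eq_integral (fun t => (F^\+ t + F^\- t)%E)); last first.
  by move=> t _; have := congr1 (fun h => h t) (fune_abse F).
rewrite ge0_integralD//; [exact: lte_add_pinfty|exact: measurable_funepos|exact: measurable_funeneg].
Qed.

(** Composition with this projection continues a function by constants, so that absolute continuity
    on [a,b] becomes continuity on the line. *)
Definition clamp a b s := Num.max a (Num.min b s).

Lemma clamp_itv a b s : a <= b -> a <= clamp a b s <= b.
Proof. by move=> ab; rewrite /clamp le_max lexx ge_max ab ge_min lexx. Qed.

Lemma clamp_id a b s : a <= s <= b -> clamp a b s = s.
Proof. by move=> /andP[sa sb]; rewrite /clamp (min_idPr sb) (max_idPr sa). Qed.

Lemma clamp_lipschitz a b s t : `|clamp a b s - clamp a b t| <= `|s - t|.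
Proof.
rewrite /clamp !maxEle !minEle.
by do !case: ifPn; rewrite -?ltNge -?ltNge -?ltNge => *; rewrite ler_norml; apply/andP; split;
  have := ler_norm (s - t); have := ler_normr; have := lerNnormlW (lexx `|s - t|); lra.
Qed.

Lemma abs_cont_clamp_continuous F a b : a <= b -> abs_cont a b F ->
  continuous (F \o clamp a b).
Proof.
move=> ab AF t; apply/cvgrPdist_lt => /= e e0.
have [d d0 hd] := abs_cont_unif AF e0.
near=> s; apply: hd; [exact: clamp_itv|exact: clamp_itv|].
apply: le_lt_trans (clamp_lipschitz _ _ _ _) _.
near: s; exact: (@cvgr_dist_lt _ _ _ _ _ (fun x => x) t).
Unshelve. all: by end_near. Qed.

Lemma abs_cont_bounded F a b : a <= b -> abs_cont a b F ->
  exists B, forall t, a <= t <= b -> `|F t| <= B.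
Proof.
move=> ab AF.
have cF : continuous (fun s => `|(F \o clamp a b) s|).
  by move=> s; apply: cvg_norm; exact: abs_cont_clamp_continuous.
have [c _ hc] := EVT_max ab (continuous_subspaceT cF).
exists (`|(F \o clamp a b) c|) => t tab; rewrite -{1}(clamp_id tab).
by apply: hc; rewrite in_itv.
Qed.

(* The derivative is an a.e. limit of difference quotients. *)
Lemma abs_cont_derivative_measurable F f a b : a <= b -> abs_cont a b F ->
  {ae leb R, forall t : L, (t : R) \in `]a, b[ -> is_derive (t : R) 1 F (f t)} ->
  measurable_fun [set: L] (f \_ `[a, b]%classic : L -> R).
Proof.
move=> ab AF aeF; pose G := F \o clamp a b.
have cG : continuous G := abs_cont_clamp_continuous ab AF.
pose D (k : nat) t := k.+1%:R * (G (t + k.+1%:R^-1) - G t).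
have mD k : measurable_fun [set: L] (D k : L -> R).
  apply: continuous_leb_measurable => t; apply: cvgM; first exact: cvg_cst.
  apply: cvgB; last exact: cG.
  apply: (@continuous_comp _ _ _ (fun x : R => x + k.+1%:R^-1) G t); last exact: cG.
  by apply: cvgD; [exact: cvg_id|exact: cvg_cst].
set f' := f \_ `[a, b]%classic.
have : {ae leb R, forall t : L, (fun k => D k t) @ \oo --> f' t}.
  have ta := leb_set1_ae a; have tb := leb_set1_ae b.
  apply: filterS3 ta tb aeF => t /eqP ta /eqP tb dF.
  (* Away from the endpoints [G] has derivative [f']: it is constant outside [a,b] and equals [F]
     inside. *)
  suff [v [dG ->]] : exists v, is_derive (t : R) 1 G v /\ f' t = v.
    apply/cvgrPdist_le => /= e e0.
    have [r r0 hr] := is_derive1_near dG e0.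
    near=> k; have kr : k.+1%:R^-1 < r by near: k; exact: near_infty_natSinv_lt (PosNum r0).
    have k0 : 0 < k.+1%:R^-1 :> R by rewrite invr_gt0.
    have := hr (t + k.+1%:R^-1); rewrite addrAC subrr add0r gtr0_norm// => /(_ kr) h.
    have kV : k.+1%:R * k.+1%:R^-1 = 1 :> R by rewrite mulfV// pnatr_eq0.
    rewrite distrC (_ : D k t - v = k.+1%:R * (G (t + k.+1%:R^-1) - G t - v * k.+1%:R^-1)).
      rewrite normrM ger0_norm//; apply: le_trans (ler_wpM2l _ h) _ => //.
      by rewrite mulrCA kV mulr1.
    by rewrite mulrBr mulrCA kV mulr1.
  have cst (A : set R) (y : R) : open A -> A t -> (forall s, A s -> y = G s) -> is_derive (t : R) 1 G 0.
    move=> oA At AG; apply: (near_eq_is_derive _ (is_derive_cst y (t : R) 1)).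
    by near=> s; apply: AG; near: s; exact: open_nbhs_nbhs.
  have [tla|at_] := ltP (t : R) a.
    exists 0; split; last by rewrite /f' patchE memNset//= in_itv/= leNgt tla.
    apply: (cst [set s | s < a] (F a)) => [||s /= sa]; [exact: open_lt|by []|].
    by rewrite /G/= /clamp (max_idPl _)// ge_min (ltW sa) orbT.
  have [tlb|bt] := ltP b (t : R).
    exists 0; split; last by rewrite /f' patchE memNset//= in_itv/= (leNgt _ b) tlb andbF.
    apply: (cst [set s | b < s] (F b)) => [||s /= bs]; [exact: open_gt|by []|].
    by rewrite /G/= /clamp (min_idPl (ltW bs)) (max_idPr ab).
  have tab : a < t < b by rewrite !lt_neqAle at_ bt tb eq_sym ta.
  exists (f t); split; last by rewrite /f' patchE mem_set//= in_itv/= at_ bt.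
  apply: (near_eq_is_derive _ (dF _)); last by rewrite in_itv.
  near=> s; rewrite /G/= clamp_id//.
  have : s \in `]a, b[ by near: s; apply: near_in_itvoo; rewrite in_itv.
  by rewrite in_itv/= => /andP[? ?]; rewrite !ltW.
move=> [N [mN N0 sN]]; have mNC : measurable (~` N) by exact: measurableC.
have m1 : measurable_fun (~` N) (f' : L -> R).
  apply: (@measurable_fun_cvg _ _ _ _ (fun k => D k : L -> R)) => [k|t Nt].
    exact: measurable_funTS.
  by apply: contrapT => h; apply: Nt; apply: sN.
have m2 := (measurable_restrictT _ mNC).1 m1.
apply: (leb_measurable_ae m2); exists N; split => // t /= h; apply: contrapT => Nt.
by apply: h; rewrite patchE mem_set.
Unshelve. all: by end_near. Qed.

End ControlRegularity.

(** * Admissible pairs and their transfer *)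

Section BolzaProblem.
Variables (R : realType) (n : nat) (T : R).
Variables (H : R -> 'rV[R]_n -> 'rV[R]_n -> R).
Variable mu : {measure set ((n + 1).-tuple R) -> \bar R}.
Variable g : 'rV[R]_n -> R.
Local Notation L := (lebT R).

(** The inclusion is asked at every time of [s,T], so that the Steiner selection reproduces [z]
    pointwise; z = 0 before [s] keeps the trajectory at [y] until then. *)
Definition admissible (s : R) (y : 'rV[R]_n) (z : R -> 'rV[R]_(n + 1)) :=
  [/\ L1v z, (forall t, ~~ (s <= t <= T) -> z t = 0) &
      forall t, s <= t <= T -> epi_conj (H t (traj y z t)) (z t)].

Definition cost (y : 'rV[R]_n) (z : R -> 'rV[R]_(n + 1)) : R :=
  g (traj y z T) + prim (fun t => rsubmx (z t) 0 0) T.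

Variables (c k : R -> R) (M r Kg : R).
Hypothesis mu_unif : unif_sphere_measure mu.
Hypothesis Hmeas : forall x p : 'rV[R]_n,
  measurable_fun (`[0, T] : set L) (fun t : L => H t x p).
Hypothesis Hconv : forall t, 0 <= t <= T -> forall x, convex_fun (H t x).
Hypothesis c_ge0 : forall t, 0 <= t <= T -> 0 <= c t.
Hypothesis c_int : (leb R).-integrable (`[0, T] : set L) (fun t => (c t)%:E).
Hypothesis H_lipp : forall t, 0 <= t <= T -> forall x p q,
  `|H t x p - H t x q| <= c t * (1 + enorm x) * enorm (p - q).
Hypothesis M_ge0 : 0 <= M.
Hypothesis rE : r = 2 * (1 + M) * expR (2 * Ltotal (c \_ `[0, T]%classic)).
Hypothesis k_ge0 : forall t, 0 <= t <= T -> 0 <= k t.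
Hypothesis k_int : (leb R).-integrable (`[0, T] : set L) (fun t => (k t)%:E).
Hypothesis H_lipx : forall t, 0 <= t <= T -> forall x y p,
  enorm x <= n%:R * r + r -> enorm y <= n%:R * r + r ->
  `|H t x p - H t y p| <= k t * (1 + enorm p) * enorm (x - y).
Hypothesis H0_int : (leb R).-integrable (`[0, T] : set L) (fun t => (H t 0 0)%:E).
Hypothesis Kg_ge0 : 0 <= Kg.
Hypothesis g_lip : forall x y, enorm x <= r -> enorm y <= r ->
  `|g x - g y| <= Kg * enorm (x - y).

Let cI := c \_ `[0, T]%classic.
Let kI := k \_ `[0, T]%classic.
Definition psi : R -> R :=
  (fun t => `|H t 0 0| + k t * r + c t * (1 + r)) \_ `[0, T]%classic.

Lemma mask_in (f : R -> R) s t u : s <= u <= t -> (f \_ `[s, t]%classic) u = f u.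
Proof. by move=> sut; rewrite patchE mem_set//= in_itv. Qed.

Lemma mask_out (f : R -> R) s t u : ~~ (s <= u <= t) -> (f \_ `[s, t]%classic) u = 0.
Proof. by move=> sut; rewrite patchE memNset//= in_itv/=; exact/negP. Qed.

Lemma radius_ge1 : 1 <= r.
Proof.
have E1 : 1 <= expR (2 * Ltotal (c \_ `[0, T]%classic)).
  rewrite -expR0 ler_expR mulr_ge0// Ltotal_ge0// => t.
  by case: (boolP (0 <= t <= T)) => h; [rewrite mask_in ?c_ge0|rewrite mask_out].
rewrite rE; apply: le_trans E1 _; rewrite ler_peMl ?expR_ge0//.
by have := M_ge0; lra.
Qed.

Let r_ge0 : 0 <= r := le_trans ler01 radius_ge1.

Lemma L1cI : L1 cI. Proof. by apply: L1_patch => //; exact: leb_itv. Qed.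
Lemma L1kI : L1 kI. Proof. by apply: L1_patch => //; exact: leb_itv. Qed.

Lemma cI_ge0 t : 0 <= cI t.
Proof. by case: (boolP (0 <= t <= T)) => h; [rewrite /cI mask_in ?c_ge0|rewrite /cI mask_out]. Qed.

Lemma kI_ge0 t : 0 <= kI t.
Proof. by case: (boolP (0 <= t <= T)) => h; [rewrite /kI mask_in ?k_ge0|rewrite /kI mask_out]. Qed.

Lemma mask_lt0 (f : R -> R) t : t < 0 -> (f \_ `[0, T]%classic) t = 0.
Proof. by move=> t0; rewrite mask_out// leNgt t0. Qed.

Lemma psi_ge0 t : 0 <= psi t.
Proof.
case: (boolP (0 <= t <= T)) => h; last by rewrite /psi mask_out.
rewrite /psi mask_in// !addr_ge0// mulr_ge0 ?c_ge0 ?k_ge0//.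
by rewrite addr_ge0.
Qed.

Lemma L1psi : L1 psi.
Proof.
have -> : psi = (fun t => (`|((fun t => H t 0 0) \_ `[0, T]%classic) t| + r * kI t) + (1 + r) * cI t).
  apply/funext => t; case: (boolP (0 <= t <= T)) => h.
    by rewrite /psi /kI /cI !mask_in//; ring.
  by rewrite /psi /kI /cI !mask_out// normr0 !mulr0 !addr0.
apply: L1D; last exact: L1Z L1cI.
apply: L1D; last exact: L1Z L1kI.
by apply: L1_abs; apply: L1_patch => //; exact: leb_itv.
Qed.

Lemma H_lipp_ex t x : 0 <= t <= T ->
  exists K, forall p q, `|H t x p - H t x q| <= K * enorm (p - q).
Proof. by move=> tT; exists (c t * (1 + enorm x)); exact: H_lipp. Qed.

Lemma enorm_slope0 : enorm (slope (0 : 'rV[R]_n)) = 1.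
Proof.
apply/eqP; rewrite -(@eqrXn2 _ 2)// ?enorm_ge0//.
by rewrite enorm_slope_sqr enorm0 expr0n/= add0r expr1n.
Qed.

Lemma H_bound t x p : 0 <= t <= T -> enorm x <= r -> `|H t x p| <= psi t * enorm (slope p).
Proof.
move=> tT xr; rewrite /psi mask_in//.
have nr : enorm x <= n%:R * r + r by rewrite ler_wpDl// mulr_ge0.
have nr0 : enorm (0 : 'rV[R]_n) <= n%:R * r + r by rewrite enorm0 addr_ge0 ?mulr_ge0.
have h1 := H_lipx tT 0 nr nr0; rewrite enorm0 addr0 mulr1 subr0 in h1.
have h2 := H_lipp tT x p 0; rewrite subr0 in h2.
have k0 := k_ge0 tT; have c0 := c_ge0 tT.
have s1 := enorm_slope_ge1 p; have s2 := enorm_le_slope p.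
have h3 : k t * enorm x <= k t * r by rewrite ler_wpM2l.
have h4 : c t * (1 + enorm x) * enorm p <= c t * (1 + r) * enorm (slope p).
  by rewrite ler_pM ?mulr_ge0 ?addr_ge0 ?enorm_ge0// ler_wpM2l// lerD2l.
have h5 : `|H t 0 0| + k t * r <= (`|H t 0 0| + k t * r) * enorm (slope p).
  by rewrite ler_peMr// addr_ge0// mulr_ge0.
have t1 := ler_distD (H t x 0) (H t x p) 0; have t2 := ler_distD (H t 0 0) (H t x 0) 0.
rewrite !subr0 in t1 t2; rewrite [leRHS]mulrDl; lra.
Qed.

(** [C] is a Lipschitz constant of H(t,x,.), and the conjugate of a [C]-Lipschitz function is
    infinite outside the ball of radius [C]. *)
Lemma epi_velocity t x z : 0 <= t <= T -> epi_conj (H t x) z ->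
  enorm (lsubmx z) <= c t * (1 + enorm x).
Proof.
move=> tT Ez; set v := lsubmx z; set C := c t * _.
rewrite leNgt; apply/negP => Cv.
have C0 : 0 <= C by rewrite mulr_ge0 ?c_ge0// addr_ge0// enorm_ge0.
have v0 : 0 < enorm v := le_lt_trans C0 Cv.
have d0 : 0 < enorm v * (enorm v - C) by rewrite mulr_gt0// subr_gt0.
(* Tested at p = lam v, the epigraph inequality gives lam |v| (|v| - C) <= w + H(t,x,0), with w the
   last coordinate of [z]; this [lam] makes the left side too large. *)
pose lam := (`|rsubmx z 0 0| + `|H t x 0| + 1) / (enorm v * (enorm v - C)).
have lam0 : 0 <= lam by rewrite divr_ge0 ?(ltW d0)// !addr_ge0.
have lamE : lam * (enorm v * (enorm v - C)) = `|rsubmx z 0 0| + `|H t x 0| + 1.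
  by rewrite /lam divfK// gt_eqF.
have := Ez (lam *: v); rewrite dotv_slope dotvZl -/v -enorm_sqr.
have := le_trans (ler_norm _) (H_lipp tT x (lam *: v) 0).
rewrite subr0 enormZ ger0_norm// -/C.
have := ler_norm (rsubmx z 0 0); have := ler_norm (H t x 0); lra.
Qed.

Lemma epi_running_cost t x z : 0 <= t <= T -> enorm x <= r -> epi_conj (H t x) z ->
  - psi t <= rsubmx z 0 0.
Proof.
move=> tT xr Ez; have := Ez 0; rewrite dotv_slope dotv0l sub0r.
have := le_trans (ler_norm _) (H_bound 0 tT xr); rewrite enorm_slope0 mulr1; lra.
Qed.

Lemma velocity_bound_radius (x0 : 'rV[R]_n) (v : R -> 'rV[R]_n) : L1v v -> enorm x0 <= M ->
  (forall t, enorm (v t) <= cI t * (1 + enorm (x0 + primv v t))) ->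
  forall t, enorm (x0 + primv v t) <= r.
Proof.
move=> Lv x0M hv t; rewrite rE.
apply: (vec_gronwall L1cI cI_ge0 _ Lv x0M hv) => u; exact: mask_lt0.
Qed.

Lemma admissible_radius s y z : 0 <= s -> enorm y <= M -> admissible s y z ->
  forall t, enorm (traj y z t) <= r.
Proof.
move=> s0 yM [Lz z0 Ez]; apply: velocity_bound_radius => //; first exact: L1v_lsubmx.
move=> t; have [st|st] := boolP (s <= t <= T); last first.
  by rewrite z0// linear0 enorm0 mulr_ge0 ?cI_ge0// addr_ge0// enorm_ge0.
have tT : 0 <= t <= T by case/andP: st => st ->; rewrite (le_trans s0 st).
by rewrite /cI mask_in//; apply: epi_velocity => //; exact: Ez.
Qed.

Lemma enorm_clip_radius (x : 'rV[R]_n) : enorm (clip r x) <= n%:R * r + r.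
Proof. by apply: le_trans (enorm_clip r_ge0 x) _; rewrite lerDl. Qed.

(** Meets the global hypotheses of [filippov]. Outside [s,T], where it is 0, the epigraph of the
    conjugate consists of the (0,w) with w >= 0, so velocities vanish there. *)
Definition Hcut s t x p : R := if s <= t <= T then H t (clip r x) p else 0.

Lemma Hcut_meas s x p : 0 <= s -> measurable_fun [set: L] (fun t : L => Hcut s t x p).
Proof.
move=> s0; have -> : (fun t : L => Hcut s t x p) =
    ((fun t : L => H t (clip r x) p) \_ (`[s, T]%classic : set L)).
  apply/funext => t; rewrite /Hcut; case: ifPn => h; first by rewrite mask_in.
  by rewrite mask_out.
apply/(measurable_restrictT _ _).1; first exact: leb_itv.
apply: measurable_funS (Hmeas _ _); first exact: leb_itv.
by move=> t /=; rewrite !in_itv/= => /andP[st ->]; rewrite (le_trans s0 st).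
Qed.

Lemma Hcut_conv s t x : 0 <= s -> convex_fun (Hcut s t x).
Proof.
move=> s0 p q lam lam01; rewrite /Hcut; case: ifPn => [/andP[st tT]|_]; last by rewrite !mulr0 addr0.
by apply: Hconv => //; rewrite tT (le_trans s0 st).
Qed.

Lemma Hcut_lipx s t x y p : 0 <= s ->
  `|Hcut s t x p - Hcut s t y p| <= kI t * (1 + enorm p) * enorm (x - y).
Proof.
move=> s0; rewrite /Hcut; case: ifPn => [/andP[st tT]|_]; last first.
  by rewrite subrr normr0 !mulr_ge0 ?kI_ge0 ?addr_ge0 ?enorm_ge0.
have tI : 0 <= t <= T by rewrite tT (le_trans s0 st).

rewrite /kI mask_in//; apply: le_trans (H_lipx tI p (enorm_clip_radius x) (enorm_clip_radius y)) _.
rewrite ler_wpM2l ?clip_lipschitz//.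
by rewrite mulr_ge0 ?k_ge0// addr_ge0// enorm_ge0.
Qed.

Lemma Hcut_lipp s t x : 0 <= s ->
  exists K, forall p q, `|Hcut s t x p - Hcut s t x q| <= K * enorm (p - q).
Proof.
move=> s0; have [/andP[st tT]|h] := boolP (s <= t <= T).
  have tI : 0 <= t <= T by rewrite tT (le_trans s0 st).
  exists (c t * (1 + enorm (clip r x))) => p q.
  by rewrite /Hcut st tT; exact: H_lipp.
rewrite /Hcut (negbTE h).
by exists 0 => p q; rewrite subrr normr0 mul0r.
Qed.

(** With d = |x0 - y0|, Del = |Psi(t0) - Psi(s0)| and K the product of [Ltotal] and [filippov_cst],
    the new pair is within Del + K (d + 2 Del) of the old one in L1. The terminal cost sees this
    with factor [Kg], the running cost with factor 1, each with a further gap of at most d + Del. *)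
Definition stab_cst : R :=
  (Kg + 1) * (2 + 2 * (Ltotal (fun t => 2 * kI t) * filippov_cst n (Ltotal (fun t => 2 * kI t)))).

Lemma stab_cst_ge0 : 0 <= stab_cst.
Proof.
have T0 : 0 <= Ltotal (fun t => 2 * kI t) by apply: Ltotal_ge0 => t; rewrite mulr_ge0// kI_ge0.
rewrite /stab_cst /filippov_cst; move: (Ltotal _) T0 => a a0.
have e0 : 0 <= expR (2 * a) := expR_ge0 _.
have h : 0 <= 2 * (n + 1)%:R * expR (2 * a) * (1 + a) by rewrite !mulr_ge0// addr_ge0.
by rewrite mulr_ge0 ?addr_ge0// mulr_ge0// mulr_ge0// addr_ge0.
Qed.

(** From time [s0] on the old pair is [z1], started at its position [x1] at that time; if t0 <= s0
    its beginning is dropped. Both orders of the times thus follow one computation. *)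
Lemma admissible_transfer s0 t0 x0 y0 zh : 0 <= s0 <= T -> 0 <= t0 <= T ->
  enorm x0 <= M -> enorm y0 <= M -> admissible t0 x0 zh ->
  exists2 z, admissible s0 y0 z &
    cost y0 z <= cost x0 zh + stab_cst * (enorm (x0 - y0) + `|prim psi t0 - prim psi s0|).
Proof.
move=> /andP[s00 s0T] /andP[t00 t0T] x0M y0M zhA; have [Lzh zh0 Ezh] := zhA.
have Xr := admissible_radius t00 x0M zhA.
pose z1 t := if s0 <= t then zh t else 0.
have z1E i : (fun t => z1 t 0 i) = ((fun t => zh t 0 i) \_ `[s0, +oo[%classic).
  apply/funext => t; rewrite patchE /z1; case: ifPn => st.
    by rewrite mem_set//= in_itv/= st.
  by rewrite memNset ?mxE//= in_itv/= andbT; apply/negP.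
have Lz1 : L1v z1.
  by move=> i; rewrite z1E; apply: L1_mask => //; exact: leb_itv.
pose x1 := traj x0 zh s0.
have trajE t : s0 <= t -> traj x1 z1 t = traj x0 zh t.
  move=> st; rewrite /x1 /traj -addrA; congr (_ + _); apply/rowP => i; rewrite !mxE.
  have -> : (fun s => lsubmx (z1 s) 0 i) = ((fun t => zh t 0 (lshift 1 i)) \_ `[s0, +oo[%classic).
    by rewrite -z1E; apply/funext => s; rewrite mxE.
  have E : (fun s => lsubmx (zh s) 0 i) = (fun t => zh t 0 (lshift 1 i)).
    by apply/funext => s; rewrite mxE.
  by rewrite prim_mask_ge// E; ring.
(* For t0 <= s0 the interval is empty and [z1] has no defect. *)
pose gam := psi \_ `[s0, t0[%classic.
have Lgam : L1 gam by apply: L1_mask; [exact: leb_itv|exact: L1psi].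
have gam0 t : 0 <= gam t by rewrite /gam patchE; case: ifP => // _; exact: psi_ge0.
have hz1 t p : dotv (slope p) (z1 t) - Hcut s0 t (traj x1 z1 t) p <= gam t * enorm (slope p).
  have g0 : 0 <= gam t * enorm (slope p) by rewrite mulr_ge0// enorm_ge0.
  rewrite /Hcut; case: ifPn => [/andP[st tT]|stT].
    rewrite trajE// clip_id// /z1 st; have [t0t|tt0] := leP t0 t.
      by apply: le_trans g0; rewrite subr_le0; apply: Ezh; rewrite t0t tT.
    have -> : zh t = 0 by apply: zh0; rewrite leNgt tt0.
    rewrite dotv0r sub0r /gam patchE mem_set/= ?in_itv/= ?st//.
    apply: le_trans (ler_norm _) _; rewrite normrN; apply: H_bound => //.
    by rewrite tT (le_trans s00 st).
  rewrite subr0; suff -> : z1 t = 0 by rewrite dotv0r.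
  rewrite /z1; case: ifP => // st; apply: zh0; move: stT; rewrite st/=.
  by apply: contra => /andP[].
have kIlt0 t : t < 0 -> kI t = 0 by move=> ?; exact: mask_lt0.
have [z [Lz Ez dz]] := @filippov R n (Hcut s0) kI 0
  (fun x p => Hcut_meas x p s00) (fun t x => Hcut_conv t x s00)
  (fun t x y p => Hcut_lipx t x y p s00) (fun t x => Hcut_lipp t x s00)
  L1kI kI_ge0 kIlt0 z1 gam x1 y0 Lz1 Lgam gam0 hz1.
(* Outside [s0,T] the pair [z] may keep a nonnegative last coordinate; cutting it off leaves the
   trajectory unchanged. *)
pose z2 t := if s0 <= t <= T then z t else 0.
have z20 t : ~~ (s0 <= t <= T) -> z2 t = 0 by rewrite /z2 => /negbTE ->.
have z_out t : ~~ (s0 <= t <= T) -> lsubmx (z t) = 0.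
  move=> st; apply: enorm_eq0; apply/eqP; rewrite eq_le enorm_ge0 andbT.
  have E p : dotv p (lsubmx (z t)) <= rsubmx (z t) 0 0.
    by have := Ez t p; rewrite dotv_slope /Hcut (negbTE st) subr_le0.
  move: (lsubmx (z t)) (rsubmx (z t) 0 0) E => v w E.
  rewrite leNgt; apply/negP => v0.
  have D0 : dotv v v != 0 by rewrite -enorm_sqr expf_neq0// gt_eqF.
  have := E (((`|w| + 1) / dotv v v) *: v).
  rewrite dotvZl divfK//; have := ler_norm w; lra.
have trajz2 t : traj y0 z2 t = traj y0 z t.
  congr (_ + primv _ _); apply/funext => s; rewrite /z2; case: ifPn => // h.
  by rewrite z_out// linear0.
have Lz2 : L1v z2.
  move=> i; have -> : (fun t => z2 t 0 i) = ((fun t => z t 0 i) \_ `[s0, T]%classic).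
    apply/funext => t; rewrite /z2; case: ifPn => h; first by rewrite mask_in.
    by rewrite mask_out// mxE.
  by apply: L1_mask => //; exact: leb_itv.
(* [clip] does not increase norms, so the growth bound holds for the untruncated state, and Gronwall
   confines the trajectory to the ball where [clip] is the identity. *)
have yr t : enorm (traj y0 z t) <= r.
  apply: velocity_bound_radius => //; first exact: L1v_lsubmx.
  move=> u; case: (boolP (s0 <= u <= T)) => h; last first.
    by rewrite z_out// enorm0 mulr_ge0 ?cI_ge0// addr_ge0// enorm_ge0.
  have uT : 0 <= u <= T by case/andP: h => h ->; rewrite (le_trans s00 h).
  have := Ez u; rewrite -/(traj y0 z u) (_ : Hcut _ _ _ = H u (clip r (traj y0 z u))); last first.
    by apply/funext => p; rewrite /Hcut h.
  move/(epi_velocity uT) => hv; apply: le_trans hv _; rewrite /cI mask_in//.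
  by rewrite ler_wpM2l ?c_ge0// lerD2l (enorm_clip_le r_ge0).
exists z2.
  split => // t h; rewrite trajz2 /z2 h.
  have := Ez t; rewrite (_ : Hcut _ _ _ = H t (clip r (traj y0 z t))); last first.
    by apply/funext => p; rewrite /Hcut h.
  by rewrite clip_id.
pose Del := `|prim psi t0 - prim psi s0|.
pose d := enorm (x0 - y0).
have Del0 : 0 <= Del := normr_ge0 _.
have d0 : 0 <= d := enorm_ge0 _.
have zh_lt t : t < t0 -> zh t = 0 by move=> tt0; rewrite zh0// leNgt tt0.
have Lvh := L1v_enorm (L1v_lsubmx Lzh).
have vpsi t : enorm (lsubmx (zh t)) <= psi t.
  have [tt|tt] := boolP (t0 <= t <= T); last by rewrite zh0// linear0 enorm0 psi_ge0.
  have tT : 0 <= t <= T by case/andP: tt => h ->; rewrite (le_trans t00 h).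
  apply: le_trans (epi_velocity tT (Ezh t tt)) _; rewrite /psi mask_in//.
  have : c t * (1 + enorm (traj x0 zh t)) <= c t * (1 + r).
    by rewrite ler_wpM2l ?c_ge0// lerD2l.
  have : 0 <= k t * r by rewrite mulr_ge0 ?k_ge0.
  have := normr_ge0 (H t 0 0); lra.
have del0 : enorm (y0 - x1) <= d + Del.
  apply: le_trans (enorm_dist_triangle _ x0 _) _; rewrite enormBC; apply: lerD => //.
  rewrite /x1 /traj opprD addrA subrr add0r enormN.
  apply: le_trans (enorm_primv_le _ (L1v_lsubmx Lzh)) _.
  rewrite /Del distrC; apply: prim_le_incr => //; [exact: L1psi|exact: psi_ge0|].
  by move=> u /zh_lt ->; rewrite linear0 enorm0.
have tg : Ltotal gam <= Del by apply: Ltotal_mask_le; [exact: L1psi|exact: psi_ge0].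
pose kap t := 2 * kI t.
have Lkap : L1 kap by exact: L1Z L1kI.
have kap0 t : 0 <= kap t by rewrite mulr_ge0// kI_ge0.
set Tk := Ltotal kap in dz *.
have Tk0 : 0 <= Tk by exact: Ltotal_ge0.
pose A0 := filippov_cst n Tk.
have A00 : 0 <= A0.
  by rewrite addr_ge0// !mulr_ge0 ?expR_ge0// addr_ge0.
pose S := prim (fun t => enorm (z t - z1 t)) T.
have LS := L1v_enorm (L1vB Lz Lz1).
have S_le : S <= Del + Tk * (A0 * (d + 2 * Del)).
  pose e t := gam t + (A0 * (enorm (y0 - x1) + Ltotal gam)) * kap t.
  have Le : L1 e by apply: L1D => //; exact: L1Z.
  apply: le_trans (le_prim T LS Le _) _.
    by move=> t; apply: le_trans (dz t) _; rewrite /e lerD2l mulrC.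
  rewrite primD//; last exact: L1Z.
  apply: lerD; first exact: le_trans (prim_le_Ltotal _ Lgam gam0) tg.
  rewrite primZ// mulrC; apply: ler_pM => //.
  - by rewrite prim_ge0.
  - by rewrite mulr_ge0// addr_ge0 ?enorm_ge0 ?Ltotal_ge0.
  - exact: prim_le_Ltotal.
  - by rewrite ler_wpM2l//; lra.
have S0 : 0 <= S by apply: prim_ge0 => t; exact: enorm_ge0.
have gdiff : g (traj y0 z T) - g (traj x0 zh T) <= Kg * (d + Del + S).
  apply: le_trans (ler_norm _) _; apply: le_trans (g_lip (yr T) (Xr T)) _.
  rewrite ler_wpM2l// -trajE//; apply: le_trans (traj_dist _ _ _ Lz Lz1) _.
  exact: lerD.
have Lw2 : L1 (fun t => rsubmx (z2 t) 0 0).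
  by under eq_fun do rewrite mxE; exact: Lz2.
have Lw1 : L1 (fun t => rsubmx (z1 t) 0 0).
  by under eq_fun do rewrite mxE; exact: Lz1.
have Lwh : L1 (fun t => rsubmx (zh t) 0 0).
  by under eq_fun do rewrite mxE; exact: Lzh.
have w2 : prim (fun t => rsubmx (z2 t) 0 0) T <= prim (fun t => rsubmx (z1 t) 0 0) T + S.
  rewrite -primD//; apply: le_prim => //; first exact: L1D.
  move=> t; rewrite /z2; case: ifPn => h.
    rewrite -lerBlDl; apply: le_trans (ler_norm _) _.
    by have := normr_coord_le (z t - z1 t) (rshift n 0); rewrite !mxE.
  have -> : z1 t = 0.
    rewrite /z1; case: ifP => // st; apply: zh0; move: h; rewrite st/=.
    by apply: contra => /andP[].
  by rewrite !mxE add0r enorm_ge0.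
(* The running cost before [s0] is discarded; being at least -psi, it can have saved no more than
   the increment of Psi. *)
have w1 : prim (fun t => rsubmx (z1 t) 0 0) T <= prim (fun t => rsubmx (zh t) 0 0) T + Del.
  have -> : (fun t => rsubmx (z1 t) 0 0) = ((fun t => rsubmx (zh t) 0 0) \_ `[s0, +oo[%classic).
    apply/funext => t; rewrite mxE -[LHS]/((fun t => z1 t 0 (rshift n 0)) t) z1E.
    by congr ((_ \_ _) t); apply/funext => u; rewrite mxE.
  rewrite prim_mask_ge// lerD2l -mulN1r -primZ//.
  rewrite /Del distrC; apply: prim_le_incr => //; [exact: L1Z|exact: L1psi|exact: psi_ge0| |].
    by move=> u /zh_lt ->; rewrite !mxE mulr0.
  move=> u; rewrite mulN1r lerNl.
  have [tt|tt] := boolP (t0 <= u <= T); last by rewrite zh0// !mxE oppr_le0 psi_ge0.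
  have tT : 0 <= u <= T by case/andP: tt => h ->; rewrite (le_trans t00 h).
  exact: epi_running_cost (Ezh u tt).
rewrite /cost trajz2 -/d -/Del /stab_cst -/kap -/Tk -/A0.
have KS : Kg * S <= Kg * (Del + Tk * (A0 * (d + 2 * Del))) by rewrite ler_wpM2l.
have P1 : 0 <= Tk * A0 by rewrite mulr_ge0.
have Kg0 := Kg_ge0.
have P2 : 0 <= Tk * A0 * d by rewrite mulr_ge0.
have P3 : 0 <= Kg * (Tk * A0 * d) by rewrite mulr_ge0.
have P4 : 0 <= Kg * d by rewrite mulr_ge0.
lra.
Qed.

(** * Admissible pairs and the value function *)

Lemma value_fun_le_cost s0 y0 z : 0 <= s0 -> admissible s0 y0 z ->
  (value_fun H mu T g s0 y0 <= (cost y0 z)%:E)%E.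
Proof.
move=> s00 [Lz z0 Ez].
have st_id t : s0 <= t <= T -> steiner_fl H mu t (traj y0 z t) (z t) = z t.
  by move=> h; apply: (steiner_fl_id mu_unif); exact: Ez.
have z_lt t : t < s0 -> z t = 0 by move=> ts; apply: z0; rewrite leNgt ts.
have Sz : S_f H mu T s0 y0 (traj y0 z) z.
  split => [i|i||].
  - rewrite traj_coord; have Li : L1 (fun s => z s 0 (lshift 1 i)) by exact: Lz.
    apply: (abs_cont_comp (C := 1) (abs_cont_prim s0 T Li)) => s t _ _.
    by rewrite opprD addrACA subrr add0r mul1r.
  - by apply: L1_integrable; [exact: leb_itv|exact: Lz].
  - have : {ae leb R, forall t : L, forall i : 'I_n,
        is_derive (t : R) 1 (prim (fun s => z s 0 (lshift 1 i))) (z t 0 (lshift 1 i))}.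
      by apply: filter_forall => i; apply: prim_is_derive; exact: Lz.
    apply: filterS => t dt; rewrite in_itv/= => /andP[st tT].
    rewrite /steiner_f st_id; last by rewrite !ltW.
    apply: is_derive_row => i; rewrite traj_coord mxE.
    have := is_deriveD (is_derive_cst (y0 0 i) (t : R) 1) (dt i).
    by rewrite add0r.
  - exact: traj_start.
apply: ereal_inf_lbound; exists (traj y0 z, z) => //=.
rewrite /cost EFinD; congr (_ + _)%E.
have Lw : L1 (fun t => rsubmx (z t) 0 0).
  by under eq_fun do rewrite mxE; exact: Lz.
rewrite -(@integral_prim _ _ s0 T Lw); last by move=> u h; rewrite z0// !mxE.
apply: eq_integral => t; rewrite inE/= in_itv/= => h; congr (_%:E).
by rewrite /steiner_l st_id.
Qed.

(* The least running cost compatible with the velocity, the supremum over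
   rational momenta of <v, p> - H, is measurable, unlike an arbitrary one. *)
Lemma admissible_of_velocity t0 x0 (zl : R -> 'rV[R]_(n + 1)) (v : R -> 'rV[R]_n) :
  0 <= t0 -> enorm x0 <= M -> L1v v ->
  (forall t, t0 <= t <= T -> lsubmx (zl t) = v t) ->
  (forall t, ~~ (t0 <= t <= T) -> v t = 0) ->
  (forall t, t0 <= t <= T -> epi_conj (H t (x0 + primv v t)) (zl t)) ->
  (\int[leb R]_(t in (`[t0, T]%classic : set L)) (rsubmx (zl t) 0 0)%:E < +oo)%E ->
  exists2 z, admissible t0 x0 z /\ (forall t, lsubmx (z t) = v t) &
    ((prim (fun t => rsubmx (z t) 0 0) T)%:E <=
     \int[leb R]_(t in (`[t0, T]%classic : set L)) (rsubmx (zl t) 0 0)%:E)%E.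
Proof.
move=> t00 x0M Lv zlv v0 Ezl Il; pose X t := x0 + primv v t.
have tI t : t0 <= t <= T -> 0 <= t <= T by case/andP=> t0t ->; rewrite (le_trans t00 t0t).
have Xr : forall t, enorm (X t) <= r.
  apply: velocity_bound_radius => // t; have [h|h] := boolP (t0 <= t <= T); last first.
    by rewrite v0// enorm0 mulr_ge0 ?cI_ge0// addr_ge0// enorm_ge0.
  rewrite /cI mask_in ?tI// -zlv//; apply: epi_velocity; [exact: tI|exact: Ezl].
pose G t q := dotv (ratv R q) (v t) - H t (X t) (ratv R q).
pose S t := [set G t q | q in [set: 'rV[rat]_n]].
pose w t := if t0 <= t <= T then sup (S t) else 0.
have S0 t : S t !=set0 by exists (G t 0), 0.
have lub t : t0 <= t <= T -> ubound (S t) (rsubmx (zl t) 0 0).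
  move=> h _ [q _ <-]; have := Ezl t h (ratv R q); rewrite dotv_slope zlv// /G -/(X t); lra.
have w_le t : t0 <= t <= T -> w t <= rsubmx (zl t) 0 0.
  by move=> h; rewrite /w h; apply: ge_sup => //; exact: lub.
have w_ge t q : t0 <= t <= T -> G t q <= w t.
  move=> h; rewrite /w h; apply: sup_upper_bound; last by exists q.
  by split => //; exists (rsubmx (zl t) 0 0); exact: lub.
pose z t : 'rV[R]_(n + 1) := row_mx (v t) (const_mx (w t)).
have zv t : lsubmx (z t) = v t by rewrite row_mxKl.
have zw t : rsubmx (z t) 0 0 = w t by rewrite row_mxKr mxE.
have Ez t : t0 <= t <= T -> epi_conj (H t (X t)) (z t).
  move=> h p; rewrite dotv_slope zv zw -subr_le0.
  pose g' p := dotv p (v t) - w t - H t (X t) p; rewrite -/(g' p).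
  apply: (@lipschitz_le0_ratv _ _ g' (enorm (v t) + c t * (1 + enorm (X t)))) => [p1 p2|q].
    have -> : g' p1 - g' p2 = dotv (p1 - p2) (v t) - (H t (X t) p1 - H t (X t) p2).
      by rewrite /g' dotvBl; ring.
    apply: le_trans (ler_normB _ _) _; rewrite mulrDl; apply: lerD.
      by rewrite mulrC; exact: dotv_CS.
    exact: H_lipp (tI _ h) _ _ _.
  by have := w_ge t q h; rewrite /G /g'; lra.
have mI : measurable (`[t0, T]%classic : set L) := leb_itv _.
have mX : vmeas [set: L] (X : L -> _).
  by apply: (@vmeasD _ _ _ _ _ (fun=> x0)); [exact: vmeas_cst|exact: vmeas_primv].
have mw : measurable_fun (`[t0, T]%classic : set L) (w : L -> R).
  apply: measurable_fun_gt_level => rho.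
  have -> : `[t0, T]%classic `&` [set t | rho < w t] =
      \bigcup_q (`[t0, T]%classic `&` [set t | rho < G t q]) :> set L.
    apply/seteqP; split => t /=; rewrite in_itv/=.
      move=> [h]; rewrite /w h => /(sup_gt (S0 t))[_ [q _ <-] Gq].
      by exists q => //; split => //=; rewrite in_itv.
    by move=> [q _ [h Gq]]; split => //; apply: lt_le_trans Gq (w_ge t q _).
  apply: countable_bigcupT_measurable; first exact: countable_ratv.
  move=> q; have mG : measurable_fun (`[t0, T]%classic : set L) (G ^~ q : L -> R).
    apply: measurable_funB.
      apply: measurable_dotv; first exact: vmeas_cst.
      by move=> i; apply: measurable_funTS; exact: L1_measurable.
    (* The truncated function is Lipschitz in the whole state space, and along [X], which stays
       within [r], it coincides with [H]. *)
    pose F t y := H t (clip r y) (ratv R q).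
    rewrite [X in measurable_fun _ X](_ : _ = (fun t => F t (X t))); last first.
      by apply/funext => t; rewrite /F clip_id.
    have mXI : vmeas (`[t0, T]%classic : set L) (X : L -> _).
      by move=> i; apply: measurable_funTS; exact: mX.
    apply: (@measurable_lipschitz_comp _ L R n (`[t0, T]%classic) F
      (fun t => k t * (1 + enorm (ratv R q))) X mI _ _ mXI).
    - move=> y; apply: measurable_funS (Hmeas _ _); first exact: leb_itv.
      by move=> t /=; rewrite !in_itv/=; exact: tI.
    - apply: measurable_funM; last exact: measurable_cst.
      have /integrableP[/measurable_EFinP mk _] := k_int.
      apply: measurable_funS mk; first exact: leb_itv.
      by move=> t /=; rewrite !in_itv/=; exact: tI.
    - move=> t /=; rewrite in_itv/= => h y y'; rewrite /F.
      apply: le_trans (H_lipx (tI t h) _ (enorm_clip_radius y) (enorm_clip_radius y')) _.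
      by rewrite ler_wpM2l ?clip_lipschitz// mulr_ge0 ?k_ge0 ?tI// addr_ge0// enorm_ge0.
  rewrite (_ : [set t | rho < G t q] = (G ^~ q) @^-1` `]rho, +oo[%classic); first exact: mG.
  by apply/seteqP; split => t /=; rewrite in_itv/= andbT.
have w0 t : ~~ (t0 <= t <= T) -> w t = 0 by rewrite /w => /negbTE ->.
have int_le : (\int[leb R]_(t in (`[t0, T]%classic : set L)) (w t)%:E <=
    \int[leb R]_(t in (`[t0, T]%classic : set L)) (rsubmx (zl t) 0 0)%:E)%E.
  by apply: le_integral_any => t /=; rewrite in_itv/= => h; rewrite lee_fin w_le.
have Iw : (leb R).-integrable (`[t0, T]%classic : set L) (EFin \o w).
  apply: (@integrable_lt_pinfty _ _ _ psi) => //.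
  - by apply: L1_integrable => //; exact: L1psi.
  - move=> t /=; rewrite in_itv/= => h; split; first exact: psi_ge0.
    by rewrite -zw; apply: epi_running_cost (Ez t h); [exact: tI|].
  - exact: le_lt_trans int_le Il.
have Lw : L1 w.
  have -> : w = w \_ `[t0, T]%classic.
    apply/funext => t; have [h|h] := boolP (t0 <= t <= T); first by rewrite mask_in.
    by rewrite mask_out// w0.
  exact: L1_patch.
have Ev : (fun s => lsubmx (z s)) = v by apply/funext => s.
exists z.
  split => //; split => [i|t h|t h].
  - have [j ->|j ->] := split_ordP i.
      by under eq_fun do rewrite /z row_mxEl; exact: Lv.
    by under eq_fun do rewrite /z row_mxEr mxE; exact: Lw.
  - rewrite /z v0// w0// (_ : const_mx 0 = 0) ?row_mx0//.
  - by rewrite /traj Ev; exact: Ez.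
under eq_fun do rewrite zw.
by rewrite -(@integral_prim _ _ t0).
Qed.

(** The bound by [r] presupposes an integrable velocity. A cruder bound comes first: [x] is bounded
    on [t0,T] by continuity, so [v] is dominated by a multiple of [c], and it is measurable as a
    derivative. *)
Lemma admissible_of_control t0 x0 x a : 0 <= t0 <= T -> enorm x0 <= M ->
  S_f H mu T t0 x0 x a ->
  (\int[leb R]_(t in (`[t0, T]%classic : set L)) (steiner_l H mu t (x t) (a t))%:E < +oo)%E ->
  exists2 z, admissible t0 x0 z &
    ((cost x0 z)%:E <= (g (x T))%:E +
     \int[leb R]_(t in (`[t0, T]%classic : set L)) (steiner_l H mu t (x t) (a t))%:E)%E.
Proof.
move=> /andP[t00 t0T] x0M [ACx _ dx xt0] Il.
have tI t : t0 <= t <= T -> 0 <= t <= T by case/andP=> t0t ->; rewrite (le_trans t00 t0t).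
pose zl t := steiner_fl H mu t (x t) (a t).
have Ezl t : t0 <= t <= T -> epi_conj (H t (x t)) (zl t).
  move=> h; apply: (steiner_fl_epi mu_unif); first exact: Hconv (tI t h) _.
  exact: H_lipp_ex (tI t h).
pose v t := if t0 <= t <= T then lsubmx (zl t) else 0.
have v0 t : ~~ (t0 <= t <= T) -> v t = 0 by rewrite /v => /negbTE ->.
have vE t : t0 <= t <= T -> v t = lsubmx (zl t) by rewrite /v => ->.
have /choice[B hB] i : exists B, forall t, t0 <= t <= T -> `|x t 0 i| <= B.
  exact: abs_cont_bounded (ACx i).
have xB t : t0 <= t <= T -> enorm (x t) <= \sum_i B i.
  by move=> h; apply: le_trans (enorm_sum_le _) _; apply: ler_sum => i _; exact: hB.
have B0 : 0 <= \sum_i B i by apply: le_trans (xB t0 _); rewrite ?enorm_ge0// lexx.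
have mv : vmeas [set: L] (v : L -> _).
  move=> i.
  rewrite [X in measurable_fun _ X](_ : _ = (fun t => lsubmx (zl t) 0 i) \_ `[t0, T]%classic).
    apply: abs_cont_derivative_measurable (ACx i) _ => //.
    by apply: filterS dx => t dt /dt; exact: is_derive_row_coord.
  apply/funext => t; have [h|h] := boolP (t0 <= t <= T); first by rewrite mask_in ?vE.
  by rewrite mask_out// v0// mxE.
have vB t : enorm (v t) <= (1 + \sum_i B i) * cI t.
  have [h|h] := boolP (t0 <= t <= T); last first.
    by rewrite v0// enorm0 mulr_ge0 ?cI_ge0// addr_ge0.
  rewrite vE// mulrC /cI mask_in ?tI//; apply: le_trans (epi_velocity (tI t h) (Ezl t h)) _.
  by rewrite ler_wpM2l ?c_ge0 ?tI// lerD2l xB.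
have Lv : L1v v by apply: (L1v_dom mv _ vB); apply: L1Z; exact: L1cI.
have xE t : t0 <= t <= T -> x t = x0 + primv v t.
  move=> /andP[t0t tT]; apply/rowP => i; rewrite !mxE; apply/eqP.
  rewrite -subr_eq0 opprD addrA subr_eq0 -{1}xt0.
  have := @abs_cont_FTC R (fun t => x t 0 i) (fun t => v t 0 i) t0 t t0t (Lv i).
  move=> ->.
  - by rewrite (@prim_eq0 _ _ t0) ?subr0// => u ut; rewrite v0 ?mxE// leNgt ut.
  - exact: abs_contW (lexx _) tT (ACx i).
  apply: filterS dx => s ds; rewrite in_itv/= => /andP[t0s st]; rewrite vE.
    by apply: is_derive_row_coord; apply: ds; rewrite in_itv/= t0s (lt_le_trans st).
  by rewrite (ltW t0s) (ltW (lt_le_trans st tT)).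
have [|z [Az zv] zc] := admissible_of_velocity t00 x0M Lv (fun t h => esym (vE t h)) v0 _ Il.
  by move=> t h; rewrite -xE//; exact: Ezl.
exists z => //; rewrite /cost EFinD.
have -> : traj x0 z T = x T by rewrite xE ?t0T ?lexx// /traj (funext zv).
exact: leeD.
Qed.

(** At the final time a pair can be concentrated on the null set {T}; its value there only has to
    lie in E, where the Steiner selection puts it. *)
Lemma admissible_at_end x0 : 0 <= T -> exists z, admissible T x0 z.
Proof.
move=> T0; have TT : 0 <= T <= T by rewrite T0 lexx.
pose a := steiner_fl H mu T x0 0.
pose z t := if t == T then a else 0.
have Lz : L1v z.
  move=> i; have mT : measurable ([set T] : set L) by exact: leb_measurable.
  rewrite (_ : (fun t => z t 0 i) = (fun=> a 0 i) \_ [set T]); last first.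
    apply/funext => t; rewrite patchE /z; case: eqP => [->|tT]; first by rewrite mem_set.
    by rewrite memNset ?mxE.
  apply: L1_patch => //; apply: measurable_bounded_integrable => //.
  - by rewrite leb_borelE lebesgue_measure_set1.
  - by exists `|a 0 i|; split => // u au t _; exact: ltW.
have aez : {ae leb R, forall t : L, z t = 0}.
  by apply: filterS (leb_set1_ae T) => t /eqP/negbTE tT; rewrite /z tT.
have trT : traj x0 z T = x0.
  apply/rowP => i; rewrite -[LHS]/((fun t => traj x0 z t 0 i) T) traj_coord.
  rewrite -[RHS]addr0; congr (_ + _); rewrite -(prim0 T).
  apply: eq_prim_ae; [exact: Lz|exact: L10|].
  by apply: filterS aez => t ->; rewrite mxE.
exists z; split => // t.
  by rewrite -eq_le /z => /negbTE; rewrite eq_sym => ->.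
rewrite -eq_le => /eqP <-; rewrite trT /z eqxx.
by apply: (steiner_fl_epi mu_unif); [exact: Hconv|exact: H_lipp_ex].
Qed.

(** Transferring the degenerate pair at time [T] back to [s0] gives a pair of finite cost, so
    [filippov] also serves as the existence theorem. *)
Lemma value_fun_lt_pinfty s0 y0 : 0 <= s0 <= T -> enorm y0 <= M ->
  (value_fun H mu T g s0 y0 < +oo)%E.
Proof.
move=> s0T y0M; have /andP[s00 s0T'] := s0T; have T0 : 0 <= T := le_trans s00 s0T'.
have [zh Azh] := admissible_at_end y0 T0.
have [|z Az _] := admissible_transfer s0T _ y0M y0M Azh; first by rewrite T0 lexx.
exact: le_lt_trans (value_fun_le_cost s00 Az) (ltry _).
Qed.

Definition cost_lbound := `|g 0| + Kg * r + prim psi T.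

Lemma cost_ge t0 x0 z : 0 <= t0 -> enorm x0 <= M -> admissible t0 x0 z ->
  - cost_lbound <= cost x0 z.
Proof.
move=> t00 x0M Az; have Xr := admissible_radius t00 x0M Az; have [Lz z0 Ez] := Az.
have g1 : `|g 0 - g (traj x0 z T)| <= Kg * r.
  apply: le_trans (g_lip _ (Xr T)) _; first by rewrite enorm0.
  by rewrite ler_wpM2l// sub0r enormN.
have w1 : - prim psi T <= prim (fun t => rsubmx (z t) 0 0) T.
  rewrite -mulN1r -primZ; last exact: L1psi.
  apply: le_prim => [||u]; first exact: L1Z L1psi.
    by under eq_fun do rewrite mxE; exact: Lz.
  rewrite mulN1r; have [h|h] := boolP (t0 <= u <= T).
    apply: epi_running_cost (Ez u h) => //.
    by case/andP: h => h ->; rewrite (le_trans t00 h).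
  by rewrite z0// !mxE oppr_le0 psi_ge0.
have := ler_norm (g 0 - g (traj x0 z T)); have := ler_norm (- g 0).
rewrite normrN /cost_lbound /cost; lra.
Qed.

Lemma value_fun_gt_ninfty t0 x0 : 0 <= t0 <= T -> enorm x0 <= M ->
  (-oo < value_fun H mu T g t0 x0)%E.
Proof.
move=> t0T x0M; apply: (@lt_le_trans _ _ (- cost_lbound)%:E); first exact: ltNyr.
apply: le_ereal_inf_tmp => _ [[x a] /= Sxa <-].
have [->|Il] := eqVneq (\int[leb R]_(t in (`[t0, T]%classic : set L))
    (steiner_l H mu t (x t) (a t))%:E)%E +oo%E.
  by rewrite addey// leey.
rewrite -ltey in Il.
have [z Az zc] := admissible_of_control t0T x0M Sxa Il.
apply: le_trans zc; rewrite lee_fin; apply: cost_ge Az => //.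
by case/andP: t0T.
Qed.

(** A control of infinite running cost satisfies the bound trivially; the others pass through
    admissible pairs. *)
Lemma value_fun_transfer s0 t0 x0 y0 : 0 <= s0 <= T -> 0 <= t0 <= T ->
  enorm x0 <= M -> enorm y0 <= M ->
  (value_fun H mu T g s0 y0 <= value_fun H mu T g t0 x0 +
    (stab_cst * (enorm (x0 - y0) + `|prim psi t0 - prim psi s0|))%:E)%E.
Proof.
move=> s0T t0T x0M y0M; rewrite -leeBlDr//.
apply: le_ereal_inf_tmp => _ [[x a] /= Sxa <-].
have [->|Il] := eqVneq (\int[leb R]_(t in (`[t0, T]%classic : set L))
    (steiner_l H mu t (x t) (a t))%:E)%E +oo%E.
  by rewrite addey// leey.
rewrite -ltey in Il.
have [z Az zc] := admissible_of_control t0T x0M Sxa Il.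
have [z' Az' zc'] := admissible_transfer s0T t0T x0M y0M Az.
rewrite EFinN leeBlDr//; apply: le_trans (value_fun_le_cost _ Az') _; first by case/andP: s0T.
by apply: le_trans (leeD zc (lexx _)); rewrite -EFinD lee_fin.
Qed.

Lemma value_fun_regular : exists alpha : R -> R, exists CM : R,
  [/\ abs_cont 0 T alpha, 0 < CM &
    forall t s x y, 0 <= t <= T -> 0 <= s <= T -> enorm x <= M -> enorm y <= M ->
      (`|value_fun H mu T g t x - value_fun H mu T g s y|
        <= (`|alpha t - alpha s| + CM * enorm (x - y))%:E)%E].
Proof.
have A0 := stab_cst_ge0.
(* [stab_cst] is known to be nonnegative; the summand 1 makes the constant positive. *)
exists (fun t => stab_cst * prim psi t), (stab_cst + 1); split.
- apply: (abs_cont_comp (C := stab_cst) (abs_cont_prim 0 T L1psi)) => s t _ _.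
  by rewrite -mulrBr normrM (ger0_norm A0).
- by rewrite ltr_wpDl.
move=> t s x y tT sT xM yM.
have h1 := value_fun_transfer sT tT xM yM; have h2 := value_fun_transfer tT sT yM xM.
have fin u p : 0 <= u <= T -> enorm p <= M -> value_fun H mu T g u p \is a fin_num.
  by move=> uT pM; rewrite fin_real// value_fun_gt_ninfty// value_fun_lt_pinfty.
move: h1 h2 (fin _ _ tT xM) (fin _ _ sT yM).
case: (value_fun H mu T g t x) => // a; case: (value_fun H mu T g s y) => // b.
rewrite -!EFinD !lee_fin -mulrBr normrM (ger0_norm A0) => h1 h2 _ _.
rewrite (enormBC y) (distrC (prim psi s)) in h2.
have d0 := enorm_ge0 (x - y).
rewrite ler_norml; lra.
Qed.

End BolzaProblem.

Theorem theorem4p9 (R : realType) (n : nat) (T : R)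
    (H : R -> 'rV[R]_n -> 'rV[R]_n -> R)
    (mu : {measure set ((n + 1).-tuple R) -> \bar R})
    (g : 'rV[R]_n -> R) :
  (* mu is the normalized rotation-invariant measure on S^n in R^{n+1} *)
  unif_sphere_measure mu ->
  (* (H1) *)
  (forall x p : 'rV[R]_n,
     measurable_fun (`[0, T] : set (lebT R)) (fun t : lebT R => H t x p)) ->
  (* (H2) *)
  (forall t, 0 <= t <= T ->
     continuous (fun xp : 'rV[R]_n * 'rV[R]_n => H t xp.1 xp.2)) ->
  (* (H3) *)
  (forall t, 0 <= t <= T -> forall (x p q : 'rV[R]_n) (lam : R), 0 <= lam <= 1 ->
     H t x (lam *: p + (1 - lam) *: q) <= lam * H t x p + (1 - lam) * H t x q) ->
  (* (H4), with c integrable on [0,T] *)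
  (exists c : R -> R,
     [/\ measurable_fun (`[0, T] : set (lebT R)) (c : lebT R -> R),
         (forall t, 0 <= t <= T -> 0 <= c t),
         (leb R).-integrable (`[0, T] : set (lebT R)) (fun t => (c t)%:E) &
         forall t, 0 <= t <= T -> forall x p q : 'rV[R]_n,
           `|H t x p - H t x q| <= c t * (1 + enorm x) * enorm (p - q)]) ->
  (* (HLC), with each k_R integrable on [0,T] *)
  (forall Rad : R, 0 < Rad -> exists k : R -> R,
     [/\ measurable_fun (`[0, T] : set (lebT R)) (k : lebT R -> R),
         (forall t, 0 <= t <= T -> 0 <= k t),
         (leb R).-integrable (`[0, T] : set (lebT R)) (fun t => (k t)%:E) &
         forall t, 0 <= t <= T -> forall x y p : 'rV[R]_n,
           enorm x <= Rad -> enorm y <= Rad ->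
           `|H t x p - H t y p| <= k t * (1 + enorm p) * enorm (x - y)]) ->
  (* t |-> H(t,0,0) integrable on [0,T] *)
  (leb R).-integrable (`[0, T] : set (lebT R)) (fun t => (H t 0 0)%:E) ->
  (* g locally Lipschitz *)
  (forall x0 : 'rV[R]_n, exists r : R, 0 < r /\ exists L : R,
     forall x y : 'rV[R]_n, enorm (x - x0) < r -> enorm (y - x0) < r ->
       `|g x - g y| <= L * enorm (x - y)) ->
  (* conclusion *)
  forall M : R, 0 < M ->
    exists alpha : R -> R, exists CM : R,
      [/\ abs_cont 0 T alpha, 0 < CM &
          forall (t s : R) (x y : 'rV[R]_n),
            0 <= t <= T -> 0 <= s <= T -> enorm x <= M -> enorm y <= M ->
            (`|value_fun H mu T g t x - value_fun H mu T g s y|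
               <= (`|alpha t - alpha s| + CM * enorm (x - y))%:E)%E].
Proof.
move=> mu_unif H1 _ H3 [c [_ c0 ci H4]] HLC H0i g_loc M M0.
(* [r] is fixed from [c] and [M] before (HLC) is invoked, at a radius n r + r that covers the image
   of [clip] and is positive even for n = 0. *)
pose r := 2 * (1 + M) * expR (2 * Ltotal (c \_ `[0, T]%classic)).
have r0 : 0 < r by rewrite !mulr_gt0 ?expR_gt0// addr_gt0.
have [|k [_ k0 ki Hk]] := HLC (n%:R * r + r); first by rewrite ltr_wpDl// mulr_ge0// ltW.
have [Kg Kg0 gK] := local_lipschitz_ball r g_loc.
have Hc t : 0 <= t <= T -> forall x, convex_fun (H t x).
  by move=> tT x p q lam; exact: H3.
exact: (value_fun_regular mu_unif H1 Hc c0 ci H4 (ltW M0) erefl k0 ki Hk H0i Kg0 gK).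
Qed.
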